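(* Let $A$ be a brick gentle algebra. There is a poset isomorphism $\mathrm{Bic}(A)\cong\mathrm{torshad}(\Pi(A))$, and $$\mathcal{B}ic(A)=\{\mathfrak T\mid \widetilde{\mathfrak T}\in\mathrm{torshad}(\Pi(A))\},$$ where for a torsion shadow $\widetilde{\mathfrak T}$ we set $\mathfrak T:=\mathrm{add}\big(\bigoplus M(w)\mid M(\widetilde w)\in\widetilde{\mathfrak T}\big)$, $w$ denoting the string of $A$ to which $\widetilde w$ specializes.
   Context: Setting: $k$ a field, $A=kQ/I$, $Q$ a finite connected quiver, $I$ admissible generated by paths (paths composed right to left). Gentle: (S1) each vertex has at most two incoming and two outgoing arrows; (S2) for each arrow $\alpha$ at most one $\beta$ with $\alpha\beta$ a path not in $I$ and at most one $\gamma$ with $\gamma\alpha$ a path not in $I$; (G1) $I$ generated by paths of length two; (G2) for each arrow $\alpha$ at most one $\beta$ with $\alpha\beta$ a path in $I$ and at most one $\gamma$ with $\gamma\alpha$ a path in $I$. Brick gentle: moreover every indecomposable module has endomorphism ring a division ring. Strings (for any bound quiver algebra $k\Gamma/J$, $J$ generated by paths): words $w=\gamma_d^{\epsilon_d}\cdots\gamma_1^{\epsilon_1}$ in arrows and formal inverses ($s(\gamma^{-1})=t(\gamma)$, $t(\gamma^{-1})=s(\gamma)$), consecutive letters composable, no $\gamma\gamma^{-1}$ or $\gamma^{-1}\gamma$, neither $w$ nor $w^{-1}$ containing a subword which is a path in $J$; plus length-zero strings $e_i$; $w$ is identified with $w^{-1}$; $\mathrm{Str}(A)$ denotes the strings of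 $A$. String module $M(w)$: with $x_1=s(\gamma_1^{\epsilon_1})$, $x_{i+1}=t(\gamma_i^{\epsilon_i})$, $M(w)$ has basis $b_1,\dots,b_{d+1}$ with $b_j$ at vertex $x_j$; arrow $\gamma_i$ sends $b_i\mapsto b_{i+1}$ if $\epsilon_i=1$ and $b_{i+1}\mapsto b_i$ if $\epsilon_i=-1$; all other arrow actions on basis vectors are zero. Biclosed sets: a concatenation of strings $u,v$ is a string $v\gamma^{\pm1}u$ with $\gamma\in Q_1$. $X\subseteq\mathrm{Str}(A)$ is closed if it contains every concatenation of two of its elements; biclosed if $X$ and $\mathrm{Str}(A)\setminus X$ are closed; $\mathrm{Bic}(A)$ is the poset of biclosed sets under inclusion. Biclosed subcategories: a subcategory $\mathcal C$ of $\mathrm{mod}(A)$ (full, closed under isomorphism) is weakly extension-closed if for every short exact sequence $0\to X\to Y\to Z\to0$ of indecomposables with $X,Z\in\mathcal C$ we have $Y\in\mathcal C$; $\mathcal C$ is biclosed if $\mathcal C$ and $\mathcal C^c=\{X\mid \mathrm{add}(X)\cap\mathcal C=0\}$ are weakly extension-closed; $\mathcal{B}ic(A)$ is the set of biclosed subcategories. The algebra $\Pi(A)$: $\overline Q$ has vertices $Q_0$ and arrows $Q_1\sqcup\{\gamma^*:t(\gamma)\to s(\gamma)\mid\gamma\in Q_1\}$; $\overline I$ is the ideal generated by $\beta\alpha$ and $\alpha^*\beta^*$ for all paths $\beta\alpha\in I$ of length two; $\Pi(A)=k\overline Q/\overline I$. A string $\widetilde w$ of $\Pi(A)$ specializes to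 the word obtained by replacing each $\gamma^*$ by $\gamma^{-1}$ and each $(\gamma^* )^{-1}$ by $\gamma$; $\widetilde{\mathrm{Str}}(A)$ is the set of strings of $\Pi(A)$ which specialize to a string of $A$. $\mathcal M:=\mathrm{add}(\bigoplus M(\widetilde w)\mid\widetilde w\in\widetilde{\mathrm{Str}}(A))\subseteq\mathrm{mod}(\Pi(A))$. A torsion class of $\mathrm{mod}(\Pi(A))$ is a subcategory closed under quotients and extensions; $\mathrm{torshad}(\Pi(A))$ is the poset, ordered by inclusion, of all $\mathcal T\cap\mathcal M$ with $\mathcal T$ a torsion class of $\mathrm{mod}(\Pi(A))$.
   Formalization: Biclosed subcategories are additionally required to contain 0 and be closed under finite direct sums and direct summands (otherwise the equality fails, e.g. for A = k); torsion classes are required to contain 0. *)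

(* Defs.v *)
From HB Require Import structures.
From mathcomp Require Import all_boot all_order all_algebra.
Set Implicit Arguments. Unset Strict Implicit. Unset Printing Implicit Defensive.
Import GRing.Theory.
Local Open Scope ring_scope.

(* A bound quiver (Q, I): vertices 'I_nv, arrows a finite type, and a list of
   generating paths of I.  A path is stored in WALKING order: the path
   beta alpha (alpha first, composition right to left) is [:: alpha; beta]. *)
Record bquiver := BQuiver {
  nv : nat;
  arr : finType;
  src : arr -> 'I_nv;
  tgt : arr -> 'I_nv;
  rels : seq (seq arr) }.

Definition consec {T} (P : T -> T -> Prop) (s : seq T) :=
  forall s1 x y s2, s = s1 ++ x :: y :: s2 -> P x y.
Definition has_infix {T : Type} (r s : seq T) := exists s1 s2, s = s1 ++ r ++ s2.

Definition is_path (Q : bquiver) (p : seq (arr Q)) :=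
  consec (fun a b => tgt a = src b) p.

Definition qconnected (Q : bquiver) :=
  forall U : {set 'I_(nv Q)}, (forall a : arr Q, (src a \in U) = (tgt a \in U)) ->
    U = set0 \/ U = setT.

Definition gentle (Q : bquiver) :=
  (0 < nv Q)%N /\ qconnected Q /\
  (* admissible: some power of the arrow ideal lies in I *)
  (exists m, forall p : seq (arr Q), size p = m -> is_path p ->
      exists2 r, r \in rels Q & has_infix r p) /\
  (forall r, r \in rels Q -> exists a b, r = [:: a; b] /\ tgt a = src b) /\
  (forall v : 'I_(nv Q),
     (#|[set a : arr Q | tgt a == v]| <= 2)%N /\ (#|[set a : arr Q | src a == v]| <= 2)%N) /\
  (forall al b1 b2 : arr Q,
     tgt b1 = src al -> [:: b1; al] \notin rels Q ->
     tgt b2 = src al -> [:: b2; al] \notin rels Q -> b1 = b2) /\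
  (forall al g1 g2 : arr Q,
     src g1 = tgt al -> [:: al; g1] \notin rels Q ->
     src g2 = tgt al -> [:: al; g2] \notin rels Q -> g1 = g2) /\
  (forall al b1 b2 : arr Q,
     [:: b1; al] \in rels Q -> [:: b2; al] \in rels Q -> b1 = b2) /\
  (forall al g1 g2 : arr Q,
     [:: al; g1] \in rels Q -> [:: al; g2] \in rels Q -> g1 = g2).

(* letter (g, true) = g, letter (g, false) = g^{-1} *)
Definition letter (Q : bquiver) := (arr Q * bool)%type.
(* a word: starting vertex and letters in walking order
   (w = g_d^e_d ... g_1^e_1 is stored as [:: g_1^e_1; ...; g_d^e_d]) *)
Definition word (Q : bquiver) := ('I_(nv Q) * seq (letter Q))%type.

Definition lsrc Q (l : letter Q) : 'I_(nv Q) := if l.2 then src l.1 else tgt l.1.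
Definition ltgt Q (l : letter Q) : 'I_(nv Q) := if l.2 then tgt l.1 else src l.1.

Definition is_string (Q : bquiver) (w : word Q) :=
  (match w.2 with [::] => True | l :: _ => w.1 = lsrc l end) /\
  consec (fun l1 l2 => ltgt l1 = lsrc l2) w.2 /\
  consec (fun l1 l2 : letter Q => ~ (l1.1 = l2.1 /\ l1.2 <> l2.2)) w.2 /\
  (forall r, r \in rels Q ->
     ~ has_infix [seq (a, true) | a <- r] w.2 /\
     ~ has_infix [seq (a, false) | a <- rev r] w.2).

Definition endv Q (w : word Q) : 'I_(nv Q) := last w.1 [seq ltgt l | l <- w.2].
Definition winv Q (w : word Q) : word Q :=
  (endv w, rev [seq (l.1, ~~ l.2) | l <- w.2]).

Definition concat_closed Q (X : word Q -> Prop) :=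
  forall (u v : word Q) (l : letter Q), X u -> X v ->
    endv u = lsrc l -> ltgt l = v.1 ->
    @is_string Q (u.1, u.2 ++ l :: v.2) -> X (u.1, u.2 ++ l :: v.2).

(* A set of strings (w identified with w^{-1}) is modelled as an
   inversion-invariant set of string words. *)
Definition biclosed_set Q (X : word Q -> Prop) :=
  (forall w, X w -> @is_string Q w) /\
  (forall w, X w -> X (winv w)) /\
  concat_closed X /\
  concat_closed (fun w => @is_string Q w /\ ~ X w).

(* A module over kQ/I: k^rdim (row vectors, right action x |-> x *m A) with
   orthogonal vertex idempotents summing to 1 and arrow actions. *)
Record rep (F : fieldType) (Q : bquiver) := Rep {
  rdim : nat;
  ridem : 'I_(nv Q) -> 'M[F]_rdim;
  ract : arr Q -> 'M[F]_rdim }.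

Definition pathmx F Q (M : rep F Q) (p : seq (arr Q)) : 'M[F]_(rdim M) :=
  foldl (fun A a => A *m ract M a) 1%:M p.

Definition is_module F Q (M : rep F Q) :=
  (forall i j, ridem M i *m ridem M j = if i == j then ridem M i else 0) /\
  (\sum_i ridem M i = 1%:M) /\
  (forall a, ract M a = ridem M (src a) *m ract M a *m ridem M (tgt a)) /\
  (forall r, r \in rels Q -> pathmx M r = 0).

Definition is_hom F Q (M N : rep F Q) (f : 'M[F]_(rdim M, rdim N)) :=
  (forall i, ridem M i *m f = f *m ridem N i) /\
  (forall a, ract M a *m f = f *m ract N a).
Arguments is_hom {F Q} M N f.

Definition iso F Q (M N : rep F Q) :=
  exists f g, is_hom M N f /\ is_hom N M g /\ f *m g = 1%:M /\ g *m f = 1%:M.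

Definition dsum F Q (M N : rep F Q) : rep F Q :=
  @Rep F Q (rdim M + rdim N)
    (fun i => block_mx (ridem M i) 0 0 (ridem N i))
    (fun a => block_mx (ract M a) 0 0 (ract N a)).

Definition indecomposable F Q (M : rep F Q) :=
  is_module M /\ (0 < rdim M)%N /\
  forall X Y : rep F Q, is_module X -> is_module Y -> iso M (dsum X Y) ->
    rdim X = 0%N \/ rdim Y = 0%N.

Definition end_division F Q (M : rep F Q) :=
  forall f, is_hom M M f -> f != 0 ->
    exists g, is_hom M M g /\ f *m g = 1%:M /\ g *m f = 1%:M.

Definition brick_gentle (F : fieldType) (Q : bquiver) :=
  gentle Q /\ forall M : rep F Q, indecomposable M -> end_division M.

Definition ses F Q (X Y Z : rep F Q) :=
  exists f g, is_hom X Y f /\ is_hom Y Z g /\ row_free f /\ row_full g /\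
    f *m g = 0 /\ (\rank f + \rank g)%N = rdim Y.

Inductive sums F Q (S : rep F Q -> Prop) : rep F Q -> Prop :=
| sums0 M : is_module M -> rdim M = 0%N -> sums S M
| sumsS X Y : S X -> sums S Y -> sums S (dsum X Y).

Definition add F Q (S : rep F Q -> Prop) (M : rep F Q) :=
  is_module M /\ exists K N, is_module K /\ sums S N /\ iso (dsum M K) N.

Definition Mstr (F : fieldType) Q (w : word Q) : rep F Q :=
  @Rep F Q (size w.2).+1
   (fun i => \matrix_(p < (size w.2).+1, q < (size w.2).+1)
       (if (p == q :> nat) && (nth w.1 (w.1 :: [seq ltgt l | l <- w.2]) p == i)
        then 1 else 0))
   (fun a => \matrix_(p < (size w.2).+1, q < (size w.2).+1)
       (if has (fun jl : nat * letter Q =>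
                 ((jl.2 == (a, true)) && (p == jl.1 :> nat) && (q == jl.1.+1 :> nat))
              || ((jl.2 == (a, false)) && (p == jl.1.+1 :> nat) && (q == jl.1 :> nat)))
             (zip (iota 0 (size w.2)) w.2)
        then 1 else 0)).

Definition subcategory F Q (C : rep F Q -> Prop) :=
  (forall M, C M -> is_module M) /\
  (forall M, is_module M -> rdim M = 0%N -> C M) /\
  (forall M N, C M -> is_module N -> iso M N -> C N) /\
  (forall M N, C M -> C N -> C (dsum M N)) /\
  (forall M N, is_module M -> is_module N -> C (dsum M N) -> C M).

Definition weakly_ext_closed F Q (C : rep F Q -> Prop) :=
  forall X Y Z, indecomposable X -> indecomposable Y -> indecomposable Z ->
    ses X Y Z -> C X -> C Z -> C Y.

Definition subcat_compl F Q (C : rep F Q -> Prop) (M : rep F Q) :=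
  is_module M /\ forall N, add (fun X => X = M) N -> C N -> rdim N = 0%N.

Definition biclosed_subcat F Q (C : rep F Q -> Prop) :=
  subcategory C /\ weakly_ext_closed C /\ weakly_ext_closed (subcat_compl C).

Definition Pi (Q : bquiver) : bquiver :=
  @BQuiver (nv Q) (arr Q + arr Q)%type
    (fun x => match x with inl a => src a | inr a => tgt a end)
    (fun x => match x with inl a => tgt a | inr a => src a end)
    ([seq [seq inl a | a <- r] | r <- rels Q] ++
     [seq [seq inr a | a <- rev r] | r <- rels Q]).

Definition spec Q (w : word (Pi Q)) : word Q :=
  (w.1, [seq (match l.1 with inl a => (a, l.2) | inr a => (a, ~~ l.2) end)
        | l <- w.2]).

Definition torsion_class F Q (T : rep F Q -> Prop) :=
  (forall M, T M -> is_module M) /\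
  (forall M, is_module M -> rdim M = 0%N -> T M) /\
  (forall M N, T M -> is_module N -> iso M N -> T N) /\
  (forall M N f, T M -> is_module N -> is_hom M N f -> row_full f -> T N) /\
  (forall X Y Z, T X -> T Z -> is_module Y -> ses X Y Z -> T Y).

Definition tilde_string Q (w : word (Pi Q)) := @is_string (Pi Q) w /\ @is_string Q (spec w).

Definition calM F Q : rep F (Pi Q) -> Prop :=
  add (fun M => exists w, tilde_string w /\ M = Mstr F w).

Definition torshad F Q (S : rep F (Pi Q) -> Prop) :=
  exists T, torsion_class T /\ forall M, S M <-> T M /\ calM M.

Definition frakT F Q (S : rep F (Pi Q) -> Prop) : rep F Q -> Prop :=
  add (fun M => exists w : word (Pi Q),
         tilde_string w /\ S (Mstr F w) /\ M = Mstr F (spec w)).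

(* Main.v *)
(** Over a brick gentle algebra no string meets a vertex twice, since a closed
    string produces an indecomposable module with a nonzero nilpotent
    endomorphism.  Hence all string modules are thin bricks, the functorial
    filtrations of Gelfand and Ponomarev show that they exhaust the
    indecomposable modules of A, and every submodule of M(w) is spanned by basis
    vectors.

    A biclosed set X corresponds to the torsion class of those modules over Pi(A)
    all of whose quotients M(u~) specialize into X; it is closed under extensions
    because a submodule of M(u~) cuts u into runs of positions lying alternately
    in the sub and in the quotient.  Conversely a torsion class T gives the set X
    of specializations of its string modules.  Each w in X has a lift all of whose
    string quotients lie in X: make a letter point away from the prefix before it
    exactly when that prefix is in X.  Finally M(w~) belongs to T as soon as its
    string quotients specialize into X: compare w~ with a lift w~' of w such that
    M(w~') is in T; a segment on which they agree, submodule of M(w~) and quotient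
    of M(w~'), splits M(w~) into an extension of smaller modules of T. *)

Require Import Defs.
From HB Require Import structures.
From mathcomp Require Import all_boot all_order all_algebra.
From mathcomp Require Import zify.
From Stdlib Require Import Classical FunctionalExtensionality PropExtensionality.
Set Implicit Arguments. Unset Strict Implicit. Unset Printing Implicit Defensive.
Import GRing.Theory.
Local Open Scope ring_scope.

(** * Modules, retracts and the Krull-Schmidt property *)

(** Modules over [Pi A] are never classified. Torsion classes there are tested only on surjections
    onto string modules, which suffices on [calM] because, by Krull-Schmidt, an indecomposable
    summand of an object of [calM] is again such a string module. A lift of a string of [A] is
    always a string of [Pi A], so the directions of its letters can be chosen at will. In a module
    [M(w)] with distinct vertices the vertex idempotents separate the basis vectors; hence
    endomorphisms are scalars, and the image of a map into [M(w)] is recorded by a colouring of the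
    positions of [w], which turns exact sequences into combinatorics of words. Distinctness also
    bounds the length of a string by the number of vertices: no bands arise, and the half-strings of
    the functorial filtration are finite words found by a search that must stop. Direct summands are
    handled as split monomorphisms, so that complements appear only where a decomposition is
    required. *)

Section Rep.
Variables (F : fieldType) (Q : bquiver).
Implicit Types M N K L X Y Z : rep F Q.

Lemma hom_id M : is_hom M M 1%:M.
Proof. by split=> ?; rewrite mulmx1 mul1mx. Qed.

Lemma hom_comp M N K (f : 'M_(rdim M, rdim N)) (g : 'M_(rdim N, rdim K)) :
  is_hom M N f -> is_hom N K g -> is_hom M K (f *m g).
Proof.
by move=> [f1 f2] [g1 g2]; split=> i; rewrite mulmxA ?f1 ?f2 -mulmxA ?g1 ?g2 mulmxA.
Qed.

Lemma homD M N (f g : 'M_(rdim M, rdim N)) :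
  is_hom M N f -> is_hom M N g -> is_hom M N (f + g).
Proof.
by move=> [f1 f2] [g1 g2]; split=> i; rewrite mulmxDr mulmxDl ?f1 ?f2 ?g1 ?g2.
Qed.

Lemma homN M N (f : 'M_(rdim M, rdim N)) : is_hom M N f -> is_hom M N (- f).
Proof. by move=> [f1 f2]; split=> i; rewrite mulmxN mulNmx ?f1 ?f2. Qed.

Lemma hom0 M N : is_hom M N 0.
Proof. by split=> i; rewrite mulmx0 mul0mx. Qed.

Lemma hom_inv M N (f : 'M_(rdim M, rdim N)) (g : 'M_(rdim N, rdim M)) :
  is_hom M N f -> f *m g = 1%:M -> g *m f = 1%:M -> is_hom N M g.
Proof.
move=> [f1 f2] fg gf; split=> i.
  by rewrite -[RHS]mulmx1 -fg -mulmxA (mulmxA (ridem M i)) f1 !mulmxA gf mul1mx.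
by rewrite -[RHS]mulmx1 -fg -mulmxA (mulmxA (ract M i)) f2 !mulmxA gf mul1mx.
Qed.

Lemma hom_pathmx M N (f : 'M_(rdim M, rdim N)) p :
  is_hom M N f -> pathmx M p *m f = f *m pathmx N p.
Proof.
move=> [f1 f2]; rewrite /pathmx.
elim/last_ind: p => [|p a IH]; first by rewrite /= mul1mx mulmx1.
by rewrite !foldl_rcons -mulmxA f2 mulmxA IH mulmxA.
Qed.

(** A direct summand given by a split monomorphism, without a chosen complement; [retract_iso_dsum]
    recovers one. *)
Definition retract X M := exists i p, is_hom X M i /\ is_hom M X p /\ i *m p = 1%:M.

Lemma retract_refl M : retract M M.
Proof. by exists 1%:M, 1%:M; rewrite mul1mx; have := hom_id M. Qed.

Lemma retract_trans X Y Z : retract X Y -> retract Y Z -> retract X Z.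
Proof.
move=> [i [p [hi [hp ip]]]] [j [q [hj [hq jq]]]].
exists (i *m j), (q *m p); split; first exact: hom_comp hi hj.
split; first exact: hom_comp hq hp.
by rewrite mulmxA -(mulmxA i) jq mulmx1.
Qed.

Lemma iso_retract X Y : iso X Y -> retract X Y.
Proof. by move=> [f [g [? [? [? ?]]]]]; exists f, g. Qed.

Lemma iso_sym X Y : iso X Y -> iso Y X.
Proof. by move=> [f [g [? [? [? ?]]]]]; exists g, f. Qed.

Lemma iso_rdim X Y : iso X Y -> rdim X = rdim Y.
Proof.
move=> [f [g [_ [_ [fg gf]]]]]; apply/eqP; rewrite eqn_leq; apply/andP; split.
  by rewrite -(mxrank1 F (rdim X)) -fg (leq_trans (mxrankM_maxl _ _)) ?rank_leq_col.
by rewrite -(mxrank1 F (rdim Y)) -gf (leq_trans (mxrankM_maxl _ _)) ?rank_leq_col.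
Qed.

(** Since [i] is injective, each module axiom can be checked after composing with it, inside [M]. *)
Lemma retract_module X M i p : is_module M -> is_hom X M i -> is_hom M X p ->
  i *m p = 1%:M -> is_module X.
Proof.
move=> [m1 [m2 [m3 m4]]] hi hp ip.
have inj m (A B : 'M_(m, rdim X)) : A *m i = B *m i -> A = B.
  by move=> e; rewrite -(mulmx1 A) -(mulmx1 B) -ip !mulmxA e.
have [i1 i2] := hi.
split.
  move=> k l; apply: inj; rewrite -mulmxA i1 mulmxA i1 -mulmxA m1.
  by case: eqP => // _; rewrite ?mulmx0 ?mul0mx.
split.
  apply: inj; rewrite mulmx_suml (eq_bigr (fun k => i *m ridem M k)) //.
  by rewrite -mulmx_sumr m2 mul1mx mulmx1.
split.
  move=> a; apply: inj.
  transitivity (i *m (ridem M (src a) *m ract M a *m ridem M (tgt a))).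
    by rewrite i2 {1}m3.
  by rewrite -[in RHS]mulmxA i1 -[in RHS]mulmxA (mulmxA (ract X a)) i2 !mulmxA i1.
by move=> r rR; apply: inj; rewrite (hom_pathmx _ hi) m4 // mulmx0 mul0mx.
Qed.

(** The image of [e] in coordinates: [i] is a basis of its row space, and [p] applies [e] and reads
    off coordinates in that basis. *)
Lemma split_idem M e : is_module M -> is_hom M M e -> e *m e = e ->
  exists K i p, [/\ is_module K, is_hom K M i, is_hom M K p, i *m p = 1%:M & p *m i = e].
Proof.
move=> mM [e1 e2] ee.
pose i := row_base e; pose p := e *m pinvmx i.
have ie : i *m e = i.
  have /submxP [D ->] : (i <= e)%MS by rewrite eq_row_base.
  by rewrite -mulmxA ee.
have ip : i *m p = 1%:M by rewrite mulmxA ie mulmxVp // row_base_free.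
have pi : p *m i = e by rewrite mulmxKpV // eq_row_base.
have ep : e *m p = p by rewrite mulmxA ee.
clearbody p; clearbody i.
pose K := @Rep F Q (\rank e) (fun k => i *m ridem M k *m p) (fun a => i *m ract M a *m p).
have hi : is_hom K M i.
  by split=> k; rewrite /= -mulmxA pi -mulmxA ?e1 ?e2 mulmxA ie.
have hp : is_hom M K p.
  have E A : p *m (i *m A *m p) = e *m A *m p by rewrite !mulmxA pi.
  by split=> k; rewrite [RHS]E -?e1 -?e2 -mulmxA ep.
by exists K, i, p; split=> //; apply: (retract_module mM hi hp ip).
Qed.

Lemma module_block X Y : is_module X -> is_module Y -> is_module (dsum X Y).
Proof.
move=> [x1 [x2 [x3 x4]]] [y1 [y2 [y3 y4]]]; split.
  move=> i j; rewrite /= mulmx_block !mulmx0 !mul0mx !addr0 !add0r x1 y1.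
  by case: eqP => // _; rewrite block_mx0.
split.
  have -> : \sum_i ridem (dsum X Y) i = block_mx (\sum_i ridem X i) 0 0 (\sum_i ridem Y i).
    apply: (big_ind3 (fun a b c => a = block_mx b 0 0 c)); first by rewrite block_mx0.
      by move=> a b c a' b' c' -> ->; rewrite add_block_mx !addr0.
    by [].
  by rewrite x2 y2 -scalar_mx_block.
split.
  by move=> a; rewrite /= !mulmx_block !(mulmx0, mul0mx, addr0, add0r) -x3 -y3.
move=> r rR; have -> : pathmx (dsum X Y) r = block_mx (pathmx X r) 0 0 (pathmx Y r).
  rewrite /pathmx; elim/last_ind: {rR} r => [|r a IH]; first by rewrite /= -scalar_mx_block.
  by rewrite !foldl_rcons IH /= mulmx_block !mulmx0 !mul0mx !addr0 !add0r.
by rewrite x4 // y4 // block_mx0.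
Qed.

Lemma hom_inl X Y : is_hom X (dsum X Y) (row_mx 1%:M 0).
Proof. by split=> i; rewrite mul_row_block mul_mx_row !mul1mx !mulmx1 !mul0mx !mulmx0 !addr0. Qed.
Lemma hom_inr X Y : is_hom Y (dsum X Y) (row_mx 0 1%:M).
Proof. by split=> i; rewrite mul_row_block mul_mx_row !mul1mx !mulmx1 !mul0mx !mulmx0 !add0r. Qed.
Lemma hom_prl X Y : is_hom (dsum X Y) X (col_mx 1%:M 0).
Proof. by split=> i; rewrite /= mul_block_col mul_col_mx !mul1mx !mulmx1 !mul0mx !mulmx0 !addr0. Qed.
Lemma hom_prr X Y : is_hom (dsum X Y) Y (col_mx 0 1%:M).
Proof. by split=> i; rewrite /= mul_block_col mul_col_mx !mul1mx !mulmx1 !mul0mx !mulmx0 !add0r. Qed.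

Lemma hom_row Z X Y (f : 'M_(rdim Z, rdim X)) (g : 'M_(rdim Z, rdim Y)) :
  is_hom Z X f -> is_hom Z Y g -> is_hom Z (dsum X Y) (row_mx f g).
Proof.
move=> [f1 f2] [g1 g2]; split=> i;
by rewrite mul_mx_row mul_row_block !mulmx0 add0r addr0 ?f1 ?f2 ?g1 ?g2.
Qed.
Lemma hom_col Z X Y (f : 'M_(rdim X, rdim Z)) (g : 'M_(rdim Y, rdim Z)) :
  is_hom X Z f -> is_hom Y Z g -> is_hom (dsum X Y) Z (col_mx f g).
Proof.
move=> [f1 f2] [g1 g2]; split=> i;
by rewrite /= mul_block_col mul_col_mx !mul0mx add0r addr0 ?f1 ?f2 ?g1 ?g2.
Qed.

Lemma retract_inl X Y : retract X (dsum X Y).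
Proof.
exists (row_mx 1%:M 0), (col_mx 1%:M 0); split; first exact: hom_inl.
by split; [exact: hom_prl | rewrite mul_row_col mul1mx mul0mx addr0].
Qed.
Lemma retract_inr X Y : retract Y (dsum X Y).
Proof.
exists (row_mx 0 1%:M), (col_mx 0 1%:M); split; first exact: hom_inr.
by split; [exact: hom_prr | rewrite mul_row_col mul1mx mul0mx add0r].
Qed.

(** The complement splits the idempotent [1 - p i]. *)
Lemma retract_iso_dsum X M : is_module M -> retract X M ->
  exists K, [/\ is_module K, retract K M & iso M (dsum X K)].
Proof.
move=> mM [i [p [hi [hp ip]]]].
pose e := 1%:M - p *m i.
have he : is_hom M M e by apply: homD (hom_id M) (homN (hom_comp hp hi)).
have pe : i *m e = 0 by rewrite mulmxBr mulmx1 mulmxA ip mul1mx subrr.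
have ep : e *m p = 0 by rewrite mulmxBl mul1mx -mulmxA ip mulmx1 subrr.
have ee : e *m e = e by rewrite {1}/e mulmxBl mul1mx -mulmxA pe mulmx0 subr0.
have [K [j [q [mK hj hq jq qj]]]] := split_idem mM he ee.
have iq : i *m q = 0.
  by rewrite -[q]mulmx1 -jq !mulmxA -(mulmxA i) qj pe mul0mx.
have jp : j *m p = 0.
  by rewrite -[j]mul1mx -jq -!mulmxA (mulmxA q) qj ep mulmx0.
exists K; split=> //; first by exists j, q.
exists (row_mx p q), (col_mx i j); split; first exact: hom_row.
split; first exact: hom_col.
split; first by rewrite mul_row_col qj /e addrC subrK.
by rewrite mul_col_row ip iq jp jq -scalar_mx_block.
Qed.

Lemma retract_dsum X Y N (i : 'M_(rdim X, rdim N)) p (j : 'M_(rdim Y, rdim N)) q :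
  is_hom X N i -> is_hom N X p -> is_hom Y N j -> is_hom N Y q ->
  i *m p = 1%:M -> j *m q = 1%:M -> i *m q = 0 -> j *m p = 0 -> retract (dsum X Y) N.
Proof.
move=> hi hp hj hq ip jq iq jp.
exists (col_mx i j), (row_mx p q); split; first exact: hom_col.
by split; [exact: hom_row | rewrite mul_col_row ip iq jp jq -scalar_mx_block].
Qed.

Lemma matrix_eq0_dim n (A : 'M[F]_n) : n = 0%N -> A = 0.
Proof. by move=> n0; apply/matrixP => i; have := ltn_ord i; rewrite {2}n0. Qed.

Lemma mx10_dim n : (1%:M : 'M[F]_n) = 0 -> n = 0%N.
Proof. by move=> e; rewrite -(mxrank1 F n) e mxrank0. Qed.

Definition only_trivial_idem M :=
  forall e, is_hom M M e -> e *m e = e -> e = 0 \/ e = 1%:M.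

Lemma indecomposableP M : indecomposable M <->
  [/\ is_module M, (0 < rdim M)%N & only_trivial_idem M].
Proof.
split=> [[mM [d0 ind]]|[mM d0 ind]].
  split=> // e he ee.
  have [K [i [p [mK hi hp ip pi]]]] := split_idem mM he ee.
  have [|L [mL _ isoM]] := @retract_iso_dsum K M mM; first by exists i, p.
  have [K0|L0] := ind _ _ mK mL isoM.
    left; rewrite -pi; have -> : p = 0; last by rewrite mul0mx.
    by rewrite -[p]mulmx1 (matrix_eq0_dim 1%:M K0) mulmx0.
  right; have /= dM := iso_rdim isoM; rewrite L0 addn0 in dM.
  have le : (rdim K <= \rank e)%N.
    rewrite -(mxrank1 F (rdim K)) -ip -[i in i *m p]mul1mx -{1}ip -(mulmxA i) pi.
    by apply: leq_trans (mxrankM_maxl _ _) _; apply: mxrankM_maxr.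
  have re : \rank e = rdim M.
    by apply/eqP; rewrite eqn_leq rank_leq_row /= (leq_trans _ le) // dM.
  have eu : e \in unitmx by rewrite -row_full_unit /row_full re.
  by rewrite -[LHS](mulKmx eu) ee mulVmx.
split=> //; split=> // X Y mX mY [f [g [hf [hg [fg gf]]]]].
pose e := f *m col_mx 1%:M 0 *m row_mx 1%:M 0 *m g.
have he : is_hom M M e.
  by apply: hom_comp hg; apply: hom_comp (hom_inl _ _); apply: hom_comp hf (hom_prl _ _).
have ee : e *m e = e.
  rewrite /e !mulmxA -(mulmxA _ g) gf mulmx1 -(mulmxA _ (row_mx _ _) (col_mx _ _)).
  by rewrite mul_row_col mul1mx mul0mx addr0 mulmx1.
have x : row_mx 1%:M 0 *m g *m e = row_mx 1%:M 0 *m g :> 'M_(rdim X, _).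
  rewrite /e !mulmxA -(mulmxA _ g) gf mulmx1.
  by rewrite mul_row_col mul1mx mul0mx addr0 mul1mx.
have y : row_mx 0 1%:M *m g *m e = 0 :> 'M_(rdim Y, _).
  rewrite /e !mulmxA -(mulmxA _ g) gf mulmx1.
  by rewrite mul_row_col mul1mx mul0mx addr0 !mul0mx.
have [e0|e1] := ind e he ee.
  left; apply: mx10_dim; rewrite e0 mulmx0 in x.
  have : row_mx 1%:M 0 *m g *m (f *m col_mx 1%:M 0) = 1%:M :> 'M_(rdim X).
    by rewrite !mulmxA -(mulmxA _ g) gf mulmx1 mul_row_col mul1mx mul0mx addr0.
  by rewrite -x mul0mx => ->.
right; apply: mx10_dim; rewrite e1 mulmx1 in y.
have : row_mx 0 1%:M *m g *m (f *m col_mx 0 1%:M) = 1%:M :> 'M_(rdim Y).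
  by rewrite !mulmxA -(mulmxA _ g) gf mulmx1 mul_row_col mul1mx mul0mx add0r.
by rewrite y mul0mx => ->.
Qed.

Lemma indec_retract_iso X M : indecomposable M -> retract X M -> (0 < rdim X)%N -> iso X M.
Proof.
move=> /indecomposableP [mM _ ind] [i [p [hi [hp ip]]]] d0.
have pp : p *m i *m (p *m i) = p *m i by rewrite mulmxA -(mulmxA p) ip mulmx1.
have [e0|e1] := ind (p *m i) (hom_comp hp hi) pp.
  have : (1%:M : 'M[F]_(rdim X)) = 0.
    have : i *m (p *m i) *m p = 1%:M by rewrite !mulmxA ip mul1mx ip.
    by rewrite e0 mulmx0 mul0mx => ->.
  by move/mx10_dim => d0'; rewrite d0' in d0.
by exists i, p.
Qed.

(** Fitting's lemma. A power [g] of [f] of minimal rank splits the space into its image and its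
    kernel. The projection [e] onto the image commutes with everything that commutes with [f], so it
    is an idempotent endomorphism. *)
Lemma fitting M f : indecomposable M -> is_hom M M f ->
  f \in unitmx \/ exists k, f ^+ k = 0.
Proof.
move=> /indecomposableP [mM d0 ind] hf.
have hfk k : is_hom M M (f ^+ k).
  elim: k => [|k IH]; first by rewrite expr0; apply: hom_id.
  by rewrite exprS; apply: hom_comp.
have [k kmin] : exists k, forall j, (\rank (f ^+ k.+1) <= \rank (f ^+ j.+1))%N.
  have : exists r, exists j, \rank (f ^+ j.+1) = r by exists (\rank (f ^+ 1)), 0%N.
  case=> r; elim/ltn_ind: r => r IH [j jr].
  have [mn|] := classic (forall i, (\rank (f ^+ j.+1) <= \rank (f ^+ i.+1))%N); first by exists j.
  move=> /not_all_ex_not [i /negP]; rewrite -ltnNge jr => lt.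
  by apply: (IH _ lt); exists i.
set g := f ^+ k.+1 in kmin.
have gg : \rank (g *m g) = \rank g.
  apply/eqP; rewrite eqn_leq mxrankM_maxl /=.
  by have := kmin (k.+1 + k)%N; rewrite -addnS exprD.
have cap0 : (g :&: kermx g)%MS = 0.
  apply/eqP; rewrite -mxrank_eq0; have := mxrank_mul_ker g g.
  by rewrite gg -{2}[\rank g]addn0 => /eqP; rewrite eqn_add2l.
have full : (1%:M <= g + kermx g)%MS.
  rewrite sub1mx /row_full; apply/eqP.
  have := mxrank_sum_cap g (kermx g); rewrite cap0 mxrank0 addn0 mxrank_ker => ->.
  by rewrite subnKC // rank_leq_row.
pose e := proj_mx g (kermx g).
have eg : (e <= g)%MS by have := proj_mx_sub g (kermx g) 1%:M; rewrite mul1mx.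
have ek : (1%:M - e <= kermx g)%MS.
  by have := proj_mx_compl_sub full; rewrite mul1mx.
have commE A : A *m f = f *m A -> A *m e = e *m A.
  move=> Af; have Ag : A *m g = g *m A.
    rewrite /g; elim: (k.+1) => [|l IH]; first by rewrite expr0 mul1mx mulmx1.
    by rewrite exprS mulmxA Af -mulmxA IH mulmxA.
  have eA : (e *m A <= g)%MS.
    by have /submxP [D ->] := eg; rewrite -mulmxA -Ag mulmxA submxMl.
  have kA : ((1%:M - e) *m A <= kermx g)%MS.
    apply/sub_kermxP; rewrite -mulmxA Ag mulmxA.
    by move/sub_kermxP: ek => ->; rewrite mul0mx.
  have := proj_mx_id cap0 eA; have := proj_mx_0 cap0 kA.
  by rewrite -/e mulmxBl mul1mx mulmxBl => /eqP; rewrite subr_eq0 => /eqP <-.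
have he : is_hom M M e.
  by case: hf => h1 h2; split=> i; apply: commE.
have ee : e *m e = e by apply: proj_mx_id.
have [e0|e1] := ind e he ee.
  right; exists k.+1; rewrite -/g; have := proj_mx_id cap0 (submx_refl g).
  by rewrite -/e e0 mulmx0 => <-.
have gu : g \in unitmx.
  rewrite -row_full_unit -sub1mx -e1; exact: eg.
by left; move: gu; rewrite /g exprS unitmx_mul => /andP[].
Qed.

(** If [f] is nilpotent then [g] is injective: a vector killed by [g] is fixed by [f], hence by all
    powers of [f]. *)
Lemma local_end M f g : indecomposable M -> is_hom M M f -> is_hom M M g ->
  f + g = 1%:M -> f \in unitmx \/ g \in unitmx.
Proof.
move=> indM hf hg fg; have [|[k fk]] := fitting indM hf; first by left.
right; rewrite -row_free_unit; apply/inj_row_free => v vg.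
have vf : v *m f = v by rewrite -[RHS]mulmx1 -fg mulmxDr vg addr0.
have: v *m f ^+ k = v.
  elim: (k) => [|l IH]; first by rewrite expr0 mulmx1.
  by rewrite exprS mulmxA vf IH.
by rewrite fk mulmx0.
Qed.

Lemma retract_unit M X (i : 'M_(rdim M, rdim X)) p :
  is_hom M X i -> is_hom X M p -> i *m p \in unitmx -> retract M X.
Proof.
move=> hi hp u; exists i, (p *m invmx (i *m p)); split=> //; split.
  apply: (hom_comp hp).
  by apply: (hom_inv (hom_comp hi hp)); rewrite ?mulmxV ?mulVmx.
by rewrite mulmxA mulmxV.
Qed.

Lemma retract_dim0 M N : retract M N -> rdim N = 0%N -> rdim M = 0%N.
Proof.
move=> [i [p [_ [_ ip]]]] N0; apply: mx10_dim.
by rewrite -ip -[i]mulmx1 (matrix_eq0_dim 1%:M N0) mulmx0 mul0mx.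
Qed.

(** The identity of [M] is the sum of two endomorphisms, one through each summand; by locality one
    of them is invertible. Members of [S] may be decomposable, so the conclusion is a retract and
    not an isomorphism. *)
Lemma krull_schmidt (S : rep F Q -> Prop) M N :
  indecomposable M -> sums S N -> retract M N -> exists2 X, S X & retract M X.
Proof.
move=> indM; elim=> [Z mZ Z0 /retract_dim0 /(_ Z0) M0|X Y SX _ IH [i [p [hi [hp ip]]]]].
  by have [_ [d0 _]] := indM; rewrite M0 in d0.
have hi1 := hom_comp hi (hom_prl _ _); have hi2 := hom_comp hi (hom_prr _ _).
have hp1 := hom_comp (hom_inl _ _) hp; have hp2 := hom_comp (hom_inr _ _) hp.
have [|u|u] := local_end indM (hom_comp hi1 hp1) (hom_comp hi2 hp2).
- rewrite !mulmxA -!(mulmxA i) -mulmxDr -mulmxDl !mul_col_row !mulmx0 !mul0mx !mulmx1.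
  by rewrite add_block_mx !addr0 !add0r -scalar_mx_block mul1mx.
- by exists X => //; apply: retract_unit u.
- by apply: IH; apply: retract_unit u.
Qed.

Definition zero_rep : rep F Q := @Rep F Q 0 (fun _ => 0) (fun _ => 0).

Lemma module_zero : is_module zero_rep.
Proof.
split=> [i j|]; first by rewrite mul0mx; case: eqP.
by split; [|split=> *]; apply/matrixP => -[].
Qed.

(** Existence of a decomposition into indecomposables, phrased as an induction principle by
    dimension; the last premise only concerns indecomposable summands of [M]. *)
Lemma decomp_ind (P : rep F Q -> Prop) M :
  (forall Z, is_module Z -> rdim Z = 0%N -> P Z) ->
  (forall X Y, is_module Y -> P X -> iso X Y -> P Y) ->
  (forall X Y, P X -> P Y -> P (dsum X Y)) ->
  is_module M -> (forall X, indecomposable X -> retract X M -> P X) -> P M.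
Proof.
move=> P0 Pi Pd; have [n] := ubnP (rdim M); elim: n M => // n IH M le mM indP.
have [M0|Mp] := posnP (rdim M); first exact: P0.
have [indM|nindM] := classic (indecomposable M); first exact: indP (retract_refl M).
have [X [Y [mX mY isoM X0 Y0]]] : exists X Y, [/\ is_module X, is_module Y,
    iso M (dsum X Y), rdim X <> 0%N & rdim Y <> 0%N].
  apply: NNPP => nex; apply: nindM; split=> //; split=> // X Y mX mY isoM.
  have [?|?] := eqVneq (rdim X) 0%N; first by left.
  have [?|?] := eqVneq (rdim Y) 0%N; first by right.
  by case: nex; exists X, Y; split=> //; apply/eqP.
have dM := iso_rdim isoM; rewrite /= in dM.
apply: (Pi (dsum X Y)) => //; last exact: iso_sym.
have rM := iso_retract (iso_sym isoM).
apply: Pd.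
  apply: IH => //; last by move=> Z iZ rZ; apply: indP (retract_trans rZ (retract_trans (retract_inl _ _) rM)).
  by rewrite dM in le; move: le Y0; case: (rdim Y) => // k; rewrite addnS !ltnS => le _; apply: leq_trans le; rewrite ltnS leq_addr.
apply: IH => //; last by move=> Z iZ rZ; apply: indP (retract_trans rZ (retract_trans (retract_inr _ _) rM)).
by rewrite dM in le; move: le X0; case: (rdim X) => // k; rewrite addSn !ltnS => le _; apply: leq_trans le; rewrite ltnS leq_addl.
Qed.

Lemma addP (S : rep F Q -> Prop) M : (forall X, S X -> is_module X) ->
  Defs.add S M <-> is_module M /\ exists2 N, sums S N & retract M N.
Proof.
move=> mS.
have ms N : sums S N -> is_module N by elim=> // X Y /mS mX _; apply: module_block.
split=> [[mM [K [N [mK [sN isoN]]]]]|[mM [N sN rN]]]; split=> //.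
  by exists N => //; apply: retract_trans (retract_inl _ K) (iso_retract isoN).
have [K [mK _ isoN]] := retract_iso_dsum (ms N sN) rN.
by exists K, N; split=> //; split=> //; apply: iso_sym.
Qed.

Lemma sums1 (S : rep F Q -> Prop) X : S X -> exists2 N, sums S N & retract X N.
Proof.
move=> SX; exists (dsum X zero_rep); last exact: retract_inl.
by apply: sumsS => //; apply: sums0 => //; apply: module_zero.
Qed.

(** An object of [sums] is a right-nested list of summands ending in a zero module, so a direct sum
    of two of them has to be reassociated, one summand at a time. *)
Lemma sums_dsum (S : rep F Q -> Prop) M1 M2 N1 N2 : sums S N1 -> sums S N2 ->
  retract M1 N1 -> retract M2 N2 -> exists2 N, sums S N & retract (dsum M1 M2) N.
Proof.
move=> s1 s2 r1 r2.
have [N sN rN] : exists2 N, sums S N & retract (dsum N1 N2) N.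
  elim: s1 {M1 r1} => [Z mZ Z0|X Y SX _ [N sN [i [p [hi [hp ip]]]]]].
    exists N2 => //; apply: (@retract_dsum _ _ _ 0 0 1%:M 1%:M); rewrite ?mul0mx ?mulmx0 ?mul1mx //.
    - exact: hom0.
    - exact: hom0.
    - exact: hom_id.
    - exact: hom_id.
    - by rewrite (matrix_eq0_dim 1%:M Z0).
  exists (dsum X N); first exact: sumsS.
  have hl := hom_inl Y N2; have hr := hom_inr Y N2.
  have kl := hom_prl Y N2; have kr := hom_prr Y N2.
  pose j1 := row_mx 1%:M 0 *m i; pose j2 := row_mx 0 1%:M *m i.
  pose q1 := p *m col_mx 1%:M 0; pose q2 := p *m col_mx 0 1%:M.
  have E a b : a *m i *m (p *m b) = a *m b by rewrite mulmxA -(mulmxA a) ip mulmx1.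
  have jq11 : j1 *m q1 = 1%:M by rewrite E mul_row_col mulmx1 mulmx0 addr0.
  have jq12 : j1 *m q2 = 0 by rewrite E mul_row_col mulmx0 mul0mx addr0.
  have jq21 : j2 *m q1 = 0 by rewrite E mul_row_col mulmx0 mul0mx addr0.
  have jq22 : j2 *m q2 = 1%:M by rewrite E mul_row_col mulmx1 mul0mx add0r.
  have hj1 : is_hom Y N j1 := hom_comp hl hi.
  have hj2 : is_hom N2 N j2 := hom_comp hr hi.
  have hq1 : is_hom N Y q1 := hom_comp hp kl.
  have hq2 : is_hom N N2 q2 := hom_comp hp kr.
  clearbody j1 j2 q1 q2.
  apply: (@retract_dsum (dsum X Y) N2 (dsum X N) (col_mx (row_mx 1%:M 0) (row_mx 0 j1)) (row_mx (col_mx 1%:M 0) (col_mx 0 q1))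
            (row_mx 0 j2) (col_mx 0 q2)).
  - apply: hom_col; first exact: hom_inl.
    by apply: hom_row => //; apply: hom0.
  - apply: hom_row; first exact: hom_prl.
    by apply: hom_col => //; apply: hom0.
  - by apply: hom_row => //; apply: hom0.
  - by apply: hom_col => //; apply: hom0.
  - rewrite mul_col_row !mul_row_col !mulmx0 !mul0mx !mul1mx !addr0 add0r jq11.
    by rewrite -scalar_mx_block.
  - by rewrite mul_row_col mulmx0 add0r.
  - by rewrite mul_col_mx !mul_row_col !mulmx0 !mul0mx !add0r jq12 col_mx0.
  - by rewrite mul_mx_row !mul_row_col !mulmx0 !mul0mx !add0r jq21 row_mx0.
move: r1 r2 rN => [i [p [hi [hp ip]]]] [j [q [hj [hq jq]]]] rN.
exists N => //; apply: retract_trans rN.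
apply: (@retract_dsum M1 M2 (dsum N1 N2) (i *m row_mx 1%:M 0) (col_mx 1%:M 0 *m p) (j *m row_mx 0 1%:M) (col_mx 0 1%:M *m q)).
- exact: hom_comp hi (hom_inl _ _).
- exact: hom_comp (hom_prl _ _) hp.
- exact: hom_comp hj (hom_inr _ _).
- exact: hom_comp (hom_prr _ _) hq.
- by rewrite mulmxA -(mulmxA i) mul_row_col mul1mx mul0mx addr0 mulmx1 ip.
- by rewrite mulmxA -(mulmxA j) mul_row_col mul1mx mul0mx add0r mulmx1 jq.
- by rewrite mulmxA -(mulmxA i) mul_row_col mulmx0 mul0mx add0r mulmx0 mul0mx.
- by rewrite mulmxA -(mulmxA j) mul_row_col mulmx0 mul0mx add0r mulmx0 mul0mx.
Qed.

Lemma add_subcat (S : rep F Q -> Prop) :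
  (forall X, S X -> is_module X) -> subcategory (Defs.add S).
Proof.
move=> mS; have ad := fun M => addP M mS.
split; first by move=> M [].
split.
  move=> M mM M0; apply/ad; split=> //; exists M; last exact: retract_refl.
  exact: sums0.
split.
  move=> M N /ad [mM [L sL rL]] mN isoMN; apply/ad; split=> //; exists L => //.
  exact: retract_trans (iso_retract (iso_sym isoMN)) rL.
split.
  move=> M N /ad [mM [L sL rL]] /ad [mN [K sK rK]]; apply/ad.
  by split; [apply: module_block | apply: sums_dsum sL sK rL rK].
move=> M N mM mN /ad [_ [L sL rL]]; apply/ad; split=> //; exists L => //.
exact: retract_trans (retract_inl _ _) rL.
Qed.

Lemma subcat_retract (C : rep F Q -> Prop) X M : subcategory C -> is_module X ->
  C M -> retract X M -> C X.
Proof.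
move=> [c1 [c2 [c3 [c4 c5]]]] mX CM rX.
have [K [mK _ isoM]] := retract_iso_dsum (c1 M CM) rX.
by apply: (c5 X K mX mK); apply: c3 isoM => //; apply: module_block.
Qed.

Lemma kermx_factor m n r (B : 'M[F]_(n, r)) (A : 'M_(n, m)) :
  kermx B *m A = 0 -> exists C, A = B *m C.
Proof.
move=> kA; exists (pinvmx B *m A); apply/eqP.
rewrite -subr_eq0 mulmxA -{1}[A]mul1mx -mulmxBl.
have /submxP [D ->] : (1%:M - B *m pinvmx B <= kermx B)%MS.
  by apply/sub_kermxP; rewrite mulmxBl mul1mx mulmxKpV // subrr.
by rewrite -mulmxA kA mulmx0.
Qed.

(** Universal property of the cokernel: the rank equation makes the image of [f] the whole kernel of
    [g]. *)
Lemma ses_factor X Y Z W (f : 'M_(rdim X, rdim Y)) (g : 'M_(rdim Y, rdim Z))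
    (h : 'M_(rdim Y, rdim W)) :
  is_hom Y Z g -> row_full g -> f *m g = 0 -> (\rank f + \rank g)%N = rdim Y ->
  is_hom Y W h -> f *m h = 0 -> exists2 k, is_hom Z W k & g *m k = h.
Proof.
move=> hg fg fg0 rk hh fh.
have kf : (kermx g <= f)%MS.
  have le : (f <= kermx g)%MS by apply/sub_kermxP.
  have [_ <-] := mxrank_leqif_sup le; by rewrite mxrank_ker; apply/eqP; have := congr1 (subn^~ (\rank g)) rk; rewrite addnK.
have kh : kermx g *m h = 0 by have /submxP [D ->] := kf; rewrite -mulmxA fh mulmx0.
have [k hk] := kermx_factor kh; have gk := esym hk.
exists k => //; case: hg hh => g1 g2 [h1 h2].
by split=> i; apply: (row_full_inj fg); rewrite !mulmxA -?g1 -?g2 gk -mulmxA gk.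
Qed.
End Rep.

(** * String modules *)

Section Words.
Variable Q : bquiver.
Implicit Types (w u v : word Q) (s p m q : seq (letter Q)) (l : letter Q).

Definition vtx w k := nth w.1 (w.1 :: [seq ltgt l | l <- w.2]) k.

(* The arrow a maps the basis vector b_i of the string module of s to b_j. *)
Definition step s (a : arr Q) i j :=
  ((j == i.+1) && (onth s i == Some (a, true))) || ((i == j.+1) && (onth s j == Some (a, false))).

Fixpoint walk (x : 'I_(nv Q)) s :=
  if s is l :: t then (x == lsrc l) && walk (ltgt l) t else true.

(** In terms of the string module: dimension at most one at every vertex. *)
Definition thin w := walk w.1 w.2 && uniq (w.1 :: [seq ltgt l | l <- w.2]).

Lemma walk_cat x p q : walk x (p ++ q) = walk x p && walk (endv (x, p)) q.
Proof. by elim: p x => [|l p IH] x //=; rewrite IH andbA. Qed.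

Lemma vtx0 w : vtx w 0 = w.1. Proof. by []. Qed.

Lemma vtx_last w : vtx w (size w.2) = endv w.
Proof.
by rewrite /vtx /endv -(size_map (@ltgt Q)) nth_last.
Qed.

Lemma vtx_cons x l s k : (k <= size s)%N -> vtx (x, l :: s) k.+1 = vtx (ltgt l, s) k.
Proof. by move=> ks; apply: set_nth_default; rewrite /= size_map. Qed.

Lemma vtx_cat x p m q k : (k <= size m)%N ->
  vtx (x, p ++ m ++ q) (size p + k) = vtx (endv (x, p), m) k.
Proof.
elim: p x => [|l p IH] x km; last first.
  rewrite /= addSn -[RHS](IH (ltgt l) km) /vtx /=.
  by apply: set_nth_default; rewrite /= size_map !size_cat; lia.
rewrite /vtx /= add0n; case: k km => //= k km.
by rewrite map_cat nth_cat size_map km.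
Qed.

Lemma endv_cat x p m : endv (x, p ++ m) = endv (endv (x, p), m).
Proof. by rewrite /endv /= map_cat last_cat. Qed.

Lemma endv_rcons x p l : endv (x, rcons p l) = ltgt l.
Proof. by rewrite /endv /= map_rcons last_rcons. Qed.

Lemma walk_onth x s k l : walk x s -> onth s k = Some l ->
  vtx (x, s) k = lsrc l /\ vtx (x, s) k.+1 = ltgt l.
Proof.
elim: s x k => [|l' s IH] x [|k] //= /andP [/eqP -> ws].
  by case=> <-.
move=> sk; have ks : (k < size s)%N by have := onthTE s k; rewrite sk.
by rewrite !vtx_cons ?(ltnW ks) //; apply: IH.
Qed.

Lemma onth_lt (T : Type) (s : seq T) k (l : T) : onth s k = Some l -> (k < size s)%N.
Proof. by move=> sk; have := onthTE s k; rewrite sk. Qed.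

Lemma thin_inj w i j : thin w -> (i <= size w.2)%N -> (j <= size w.2)%N ->
  vtx w i = vtx w j -> i = j.
Proof.
move=> /andP [_ un] si sj /eqP; rewrite /vtx nth_uniq //= ?size_map ?ltnS //.
by move/eqP.
Qed.

(** Occurrences with equal signs start at the same vertex. With opposite signs each would start
    where the other ends, which forces [i = j + 1] and [j = i + 1]. *)
Lemma thin_arrow w i j a b c : thin w -> onth w.2 i = Some (a, b) ->
  onth w.2 j = Some (a, c) -> i = j.
Proof.
move=> tw; have := tw; case: w tw => x s /= tw /andP [/= ws _] si sj.
have [i1 i2] := walk_onth ws si; have [j1 j2] := walk_onth ws sj.
have li := onth_lt si; have lj := onth_lt sj.
have [bc|bc] := eqVneq b c.
  apply: (thin_inj tw) => /=; rewrite ?(ltnW li) ?(ltnW lj) //.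
  by rewrite i1 j1 bc.
have e1 : i = j.+1.
  apply: (thin_inj tw); rewrite ?(ltnW li) //= i1 j2 /lsrc /ltgt /=.
  by case: b c bc {si sj i1 i2 j1 j2} => -[].
have e2 : i.+1 = j.
  apply: (thin_inj tw); rewrite ?(ltnW lj) //= i2 j1 /lsrc /ltgt /=.
  by case: b c bc {si sj i1 i2 j1 j2} => -[].
by move: e1 e2; lia.
Qed.

Lemma step_seg p m q a i j : (i <= size m)%N -> (j <= size m)%N ->
  step (p ++ m ++ q) a (size p + i) (size p + j) = step m a i j.
Proof.
move=> im jm; rewrite /step -!addnS !eqn_add2l.
rewrite !(onth_cat p) !ltnNge !leq_addr /= !addKn !onth_cat.
congr (_ || _); [have [ji|//] := eqVneq j i.+1 | have [ij|//] := eqVneq i j.+1].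
  by rewrite ifT // -ji.
by rewrite ifT // -ij.
Qed.

Lemma onth_mid p l q : onth (p ++ l :: q) (size p) = Some l.
Proof. by rewrite onth_cat ltnn subnn. Qed.

End Words.

(** * Matrices of string modules, and maps given by segments of positions *)

Section Mstr.
Variables (F : fieldType) (Q : bquiver).
Implicit Types (w u v : word Q) (s p m q : seq (letter Q)) (l : letter Q).
Local Notation M := (Mstr F).

Lemma has_zip_iota (T : Type) (P : nat -> T -> bool) k (s : seq T) :
  has (fun jl => P jl.1 jl.2) (zip (iota k (size s)) s) <->
  exists j (l : T), onth s j = Some l /\ P (k + j)%N l.
Proof.
elim: s k => [|l s IH] k /=.
  by split=> // -[j [l []]]; rewrite onth0n.
split=> [/orP [Pl|/IH [j [l' [sj Pl]]]]|[[|j] [l' [sj Pl]]]].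
- by exists 0%N, l; rewrite addn0.
- by exists j.+1, l'; rewrite addnS.
- by case: sj => ->; rewrite addn0 in Pl; rewrite Pl.
- by apply/orP; right; apply/IH; exists j, l'; rewrite addSnnS.
Qed.

Lemma ract_MstrE w a (i j : 'I_(size w.2).+1) :
  ract (M w) a i j = (step w.2 a i j)%:R :> F.
Proof.
rewrite mxE; set h := has _ _; suff -> : h = step w.2 a i j by case: step.
apply/idP/idP.
  move=> /(has_zip_iota (fun k l => (l == (a, true)) && (i == k :> nat) && (j == k.+1 :> nat)
         || (l == (a, false)) && (i == k.+1 :> nat) && (j == k :> nat)) 0) [k [l [sk]]].
  rewrite add0n /step => /orP [] /andP [/andP [/eqP lE /eqP ->] /eqP ->].
    by rewrite eqxx sk lE eqxx.
  by rewrite eqxx sk lE eqxx orbT.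
move=> st; apply/(has_zip_iota (fun k l => (l == (a, true)) && (i == k :> nat) && (j == k.+1 :> nat)
         || (l == (a, false)) && (i == k.+1 :> nat) && (j == k :> nat)) 0).
case/orP: st => /andP [/eqP ij /eqP sk].
  by exists i, (a, true); split=> //; rewrite add0n ij !eqxx.
by exists j, (a, false); split=> //; rewrite add0n ij !eqxx orbT.
Qed.

Lemma ridem_MstrE w (v : 'I_(nv Q)) (i j : 'I_(size w.2).+1) :
  ridem (M w) v i j = ((i == j) && (vtx w i == v))%:R :> F.
Proof. by rewrite mxE /vtx -val_eqE; case: (_ && _). Qed.

Lemma sum_delta n (f : 'I_n -> F) (i : 'I_n) (b : 'I_n -> bool) :
  (forall k, k != i -> ~~ b k) -> \sum_k (b k)%:R * f k = (b i)%:R * f i.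
Proof.
move=> bi; rewrite (bigD1 i) //= big1 ?addr0 // => k ki.
by rewrite (negbTE (bi k ki)) mul0r.
Qed.

Lemma mul_ridemE w (v : 'I_(nv Q)) r (A : 'M[F]_(_, r)) (i : 'I_(size w.2).+1) j :
  (ridem (M w) v *m A) i j = if vtx w i == v then A i j else 0.
Proof.
rewrite mxE (eq_bigr (fun k => ((i == k) && (vtx w i == v))%:R * A k j)); last first.
  by move=> k _; rewrite ridem_MstrE.
rewrite (@sum_delta _ (fun k => A k j) i (fun k => (i == k) && _)).
  by rewrite eqxx /=; case: eqP => _; rewrite ?mul1r ?mul0r.
by move=> k ki; rewrite eq_sym (negbTE ki).
Qed.

Lemma mulr_ridemE w (v : 'I_(nv Q)) r (A : 'M[F]_(r, _)) i (j : 'I_(size w.2).+1) :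
  (A *m ridem (M w) v) i j = if vtx w j == v then A i j else 0.
Proof.
rewrite mxE (eq_bigr (fun k => ((k == j) && (vtx w j == v))%:R * A i k)); last first.
  by move=> k _; rewrite ridem_MstrE mulrC; case: eqP => // ->.
rewrite (@sum_delta _ (fun k => A i k) j (fun k => (k == j) && _)).
  by rewrite eqxx /=; case: eqP => _; rewrite ?mul1r ?mul0r.
by move=> k ki; rewrite (negbTE ki).
Qed.

Lemma mul_deltaE n r (A : 'M[F]_(n, r)) (i j k : 'I_n) c :
  (delta_mx i j *m A) k c = if k == i then A j c else 0.
Proof.
rewrite mxE (bigD1 j) //= big1 ?addr0 => [|t tj]; last first.
  by rewrite mxE (negbTE tj) andbF mul0r.
by rewrite mxE eqxx andbT; case: eqP => _; rewrite ?mul1r ?mul0r.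
Qed.

Lemma mulr_deltaE n r (A : 'M[F]_(r, n)) (i j k : 'I_n) c :
  (A *m delta_mx i j) c k = if k == j then A c i else 0.
Proof.
rewrite mxE (bigD1 i) //= big1 ?addr0 => [|t ti]; last first.
  by rewrite mxE (negbTE ti) mulr0.
by rewrite mxE eqxx /=; case: eqP => _; rewrite ?mulr1 ?mulr0.
Qed.

Lemma onth_step_true w k a : thin w -> onth w.2 k = Some (a, true) ->
  ract (M w) a = delta_mx (inord k) (inord k.+1).
Proof.
move=> tw sk; apply/matrixP => i j; have lk := onth_lt sk.
rewrite ract_MstrE mxE /step -!val_eqE /= !inordK ?ltnS ?(ltnW lk) //; congr (_%:R).
congr nat_of_bool.
apply/orP/andP => [[] /andP [/eqP ij /eqP si]|[/eqP -> /eqP ->]].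
- by rewrite ij (thin_arrow tw si sk).
- by have e := thin_arrow tw si sk; move: si; rewrite e sk.
- by left; rewrite eqxx sk eqxx.
Qed.

Lemma onth_step_false w k a : thin w -> onth w.2 k = Some (a, false) ->
  ract (M w) a = delta_mx (inord k.+1) (inord k).
Proof.
move=> tw sk; apply/matrixP => i j; have lk := onth_lt sk.
rewrite ract_MstrE mxE /step -!val_eqE /= !inordK ?ltnS ?(ltnW lk) //; congr (_%:R).
congr nat_of_bool.
apply/orP/andP => [[] /andP [/eqP ij /eqP si]|[/eqP -> /eqP ->]].
- by have e := thin_arrow tw si sk; move: si; rewrite e sk.
- by rewrite ij (thin_arrow tw si sk).
- by right; rewrite eqxx sk eqxx.
Qed.

Lemma onth_step_none w a : a \notin [seq l.1 | l <- w.2] -> ract (M w) a = 0.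
Proof.
move=> na; apply/matrixP => i j; rewrite ract_MstrE mxE /step.
have no k b : (onth w.2 k == Some (a, b)) = false.
  apply/negP => /eqP sk; case/negP: na; apply/mapP; exists (a, b) => //.
  by apply/onthP; exists k.
by rewrite !no !andbF.
Qed.

(** The vertex idempotents make [f] diagonal, and each letter, acting by a matrix unit, equates the
    diagonal entries at its two ends. *)
Lemma thin_end_scalar w f : thin w -> is_hom (M w) (M w) f -> f = (f ord0 ord0)%:M.
Proof.
move=> tw [h1 h2]; have dg i j : i != j -> f i j = 0.
  move=> ij; have /matrixP /(_ i j) := h1 (vtx w i).
  rewrite mul_ridemE mulr_ridemE eqxx; case: eqP => // /(thin_inj tw) e _.
  by case/eqP: ij; apply/val_inj; rewrite /= e // -ltnS.
have eqd k : (k <= size w.2)%N -> f (inord k) (inord k) = f ord0 ord0.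
  elim: k => [|k IH] lk; first by rewrite (_ : inord 0 = ord0) //; apply/val_inj; rewrite /= inordK.
  rewrite -IH ?(ltnW lk) //.
  have [[a b] sk] : exists l, onth w.2 k = Some l.
    by have := onthTE w.2 k; rewrite lk; case: onth => // l _; exists l.
  case: b sk => sk.
    have /matrixP /(_ (inord k) (inord k.+1)) := h2 a.
    by rewrite (onth_step_true tw sk) mul_deltaE mulr_deltaE !eqxx.
  have /matrixP /(_ (inord k.+1) (inord k)) := h2 a.
  by rewrite (onth_step_false tw sk) mul_deltaE mulr_deltaE !eqxx => ->.
apply/matrixP => i j; rewrite mxE; have [->|ij] := eqVneq i j; last by rewrite dg.
by rewrite -{1 2}(inord_val j) eqd ?mulr1n // -ltnS.
Qed.

Lemma thin_indec w : thin w -> is_module (M w) -> indecomposable (M w).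
Proof.
move=> tw mw; apply/indecomposableP; split=> // e he ee.
rewrite (thin_end_scalar tw he) in ee *; set c := e _ _ in ee *.
move/matrixP: ee => /(_ ord0 ord0); rewrite -scalar_mxM !mxE eqxx !mulr1n => cc.
have [->|c0] := eqVneq c 0; first by left; rewrite raddf0.
by right; congr (_%:M); apply: (mulfI c0); rewrite cc mulr1.
Qed.

(** Inclusion of the positions [k, ..., k + m] among [0, ..., n]; its transpose is the projection
    onto them. *)
Definition shiftmx (k m n : nat) : 'M[F]_(m.+1, n.+1) := \matrix_(i, j) (j == k + i :> nat)%N%:R.

Lemma shiftmxE (k m n : nat) r (A : 'M[F]_(n.+1, r)) (i : 'I_m.+1) j : (k + m <= n)%N ->
  (shiftmx k m n *m A) i j = A (inord (k + i)) j.
Proof.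
move=> kmn; rewrite mxE (eq_bigr (fun t : 'I__ => (t == k + i :> nat)%N%:R * A t j)); last first.
  by move=> t _; rewrite mxE.
have il := ltn_ord i; have v : (inord (k + i) : 'I_n.+1) = (k + i)%N :> nat.
  by rewrite inordK; lia.
rewrite (@sum_delta _ (fun t => A t j) (inord (k + i)) (fun t => t == k + i :> nat)%N).
  by rewrite v eqxx mul1r.
by move=> t; apply: contra => /eqP e; apply/eqP/val_inj; rewrite /= v.
Qed.

Lemma shiftmxrE (k m n : nat) r (A : 'M[F]_(r, n.+1)) i (j : 'I_m.+1) : (k + m <= n)%N ->
  (A *m (shiftmx k m n)^T) i j = A i (inord (k + j)).
Proof.
move=> kmn; have := shiftmxE A^T j i kmn.
by rewrite -{1}[shiftmx _ _ _]trmxK -trmx_mul [LHS]mxE [RHS]mxE.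
Qed.

Lemma shiftmxK (k m n : nat) : (k + m <= n)%N -> shiftmx k m n *m (shiftmx k m n)^T = 1%:M.
Proof.
move=> kmn; apply/matrixP => i j; rewrite shiftmxE // !mxE -val_eqE /=.
by have := ltn_ord i; rewrite ltnS => il; rewrite inordK ?eqn_add2l //; lia.
Qed.

Lemma shiftmx_disj (k m k' m' n : nat) : (k + m <= n)%N -> (k' + m' <= n)%N ->
  (k + m < k')%N || (k' + m' < k)%N -> shiftmx k m n *m (shiftmx k' m' n)^T = 0.
Proof.
move=> kmn kmn' dj; apply/matrixP => i j; rewrite shiftmxE // !mxE.
have := ltn_ord i; have := ltn_ord j; rewrite !ltnS => il jl.
by rewrite inordK; [case: eqP => //|]; lia.
Qed.

Lemma rank_shiftmx (k m n : nat) : (k + m <= n)%N -> \rank (shiftmx k m n) = m.+1.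
Proof. by move=> kmn; apply/eqP/row_freeP; exists (shiftmx k m n)^T; rewrite shiftmxK. Qed.

Section Segment.
Variables (w : word Q) (p m q : seq (letter Q)).
Hypothesis wE : w.2 = p ++ m ++ q.
Let u : word Q := (endv (w.1, p), m).
Let k := size p.
Let inc := shiftmx k (size m) (size w.2).

Lemma seg_le : (k + size m <= size w.2)%N.
Proof. by rewrite wE !size_cat; lia. Qed.

Lemma seg_vtx i : (i <= size m)%N -> vtx w (k + i) = vtx u i.
Proof. by move=> im; rewrite -(vtx_cat _ _ q im) -wE; case: (w). Qed.

(** Equivariance can fail only through an arrow entering the segment from outside, and only the two
    letters next to the segment can carry one. The defaults of [last] and [head] make the condition
    empty at an end of the word. *)
Lemma seg_proj (W : rep F Q) (g : 'M_(rdim W, rdim (M w))) :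
  is_hom W (M w) g ->
  (last false (map snd p) -> forall i, g i (inord k.-1) = 0) ->
  (~~ head true (map snd q) -> forall i, g i (inord (k + size m).+1) = 0) ->
  is_hom W (M u) (g *m inc^T).
Proof.
move=> [g1 g2] gl gr; have le := seg_le.
have inK j : (j <= size m)%N -> (inord (k + j) : 'I_(size w.2).+1) = (k + j)%N :> nat.
  by move=> jm; rewrite inordK //; lia.
split=> [v|a].
  rewrite mulmxA g1; apply/matrixP => i j; have jm : ((j : 'I_(size m).+1) <= size m)%N by rewrite -ltnS ltn_ord.
  by rewrite mulr_ridemE !shiftmxrE // mulr_ridemE inK // seg_vtx.
rewrite mulmxA g2; apply/matrixP => i j; have jm : ((j : 'I_(size m).+1) <= size m)%N by rewrite -ltnS ltn_ord.
rewrite shiftmxrE // [RHS]mxE.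
rewrite (eq_bigr (fun t : 'I__ => g i (inord (k + t)) * (step m a t j)%:R)); last first.
  by move=> t _; rewrite shiftmxrE // ract_MstrE.
rewrite mxE (eq_bigr (fun t : 'I__ => g i t * (step w.2 a t (k + j)%N)%:R)); last first.
  by move=> t _; rewrite ract_MstrE inK.
pose inn (t : 'I_(size w.2).+1) := (k <= t <= k + size m)%N.
(* An outside position that steps into the segment is the one just before it or just after it, and
   there [g] vanishes. *)
rewrite (bigID inn) /= [X in _ + X]big1 ?addr0; last first.
  move=> t; rewrite /inn => nt; case st: (step _ _ _ _); rewrite ?mulr0 //.
  move: st nt; rewrite /step => /orP [] /andP [/eqP e /eqP lt] nt.
    have tk : t = k.-1 :> nat by lia.
    have kp : (0 < k)%N by lia.
    have -> : t = inord k.-1 by apply/val_inj; rewrite /= inordK // -?tk.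
    rewrite gl ?mul0r //; move: lt; rewrite tk wE; move: kp; rewrite /k.
    case/lastP: (p) => // p' l _; rewrite size_rcons cat_rcons onth_mid map_rcons last_rcons.
    by case=> ->.
  have tk : t = (k + size m).+1 :> nat by lia.
  have -> : t = inord (k + size m).+1 by apply/val_inj; rewrite /= inordK // -?tk.
  rewrite gr ?mul0r //; have [jE] := etrans (esym e) tk.
  move: lt; rewrite jE wE catA /k -size_cat onth_cat ltnn subnn.
  by case: (q) => //= l q' [->].
rewrite (reindex_onto (fun t : 'I_(size m).+1 => inord (k + t)) (fun t => inord (t - k))) /=; last first.
  move=> t /andP [t1 t2]; apply/val_inj => /=; rewrite !inordK //; lia.
apply: eq_big => [t|t _].
  have tm := ltn_ord t; rewrite ltnS in tm.
  by rewrite /inn inK // leq_addr leq_add2l tm addKn inord_val eqxx.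
have tm := ltn_ord t; rewrite ltnS in tm.
rewrite inK //; have -> // : step w.2 a (k + t)%N (k + j)%N = step m a t j.
by rewrite wE; apply: step_seg.
Qed.

(** Dual to [seg_proj]: here [h] must vanish at an outside neighbour that an arrow reaches from the
    segment. *)
Lemma seg_inc (W : rep F Q) (h : 'M_(rdim (M w), rdim W)) :
  is_hom (M w) W h ->
  (~~ last true (map snd p) -> forall i, h (inord k.-1) i = 0) ->
  (head false (map snd q) -> forall i, h (inord (k + size m).+1) i = 0) ->
  is_hom (M u) W (inc *m h).
Proof.
move=> [g1 g2] gl gr; have le := seg_le.
have inK j : (j <= size m)%N -> (inord (k + j) : 'I_(size w.2).+1) = (k + j)%N :> nat.
  by move=> jm; rewrite inordK //; lia.
split=> [v|a].
  rewrite -mulmxA -g1; apply/matrixP => j i; have jm : ((j : 'I_(size m).+1) <= size m)%N by rewrite -ltnS ltn_ord.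
  by rewrite mul_ridemE !shiftmxE // mul_ridemE inK // seg_vtx.
rewrite -mulmxA -g2; apply/matrixP => j i; have jm : ((j : 'I_(size m).+1) <= size m)%N by rewrite -ltnS ltn_ord.
rewrite [RHS]shiftmxE // mxE.
rewrite (eq_bigr (fun t : 'I__ => (step m a j t)%:R * h (inord (k + t)) i)); last first.
  by move=> t _; rewrite shiftmxE // ract_MstrE.
rewrite mxE [RHS](eq_bigr (fun t : 'I__ => (step w.2 a (k + j)%N t)%:R * h t i)); last first.
  by move=> t _; rewrite ract_MstrE inK.
pose inn (t : 'I_(size w.2).+1) := (k <= t <= k + size m)%N.
rewrite [RHS](bigID inn) /= [X in _ + X]big1 ?addr0; last first.
  move=> t; rewrite /inn => nt; case st: (step _ _ _ _); rewrite ?mul0r //.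
  move: st nt; rewrite /step => /orP [] /andP [/eqP e /eqP lt] nt; last first.
    have tk : t = k.-1 :> nat by lia.
    have kp : (0 < k)%N by lia.
    have -> : t = inord k.-1 by apply/val_inj; rewrite /= inordK // -?tk.
    rewrite gl ?mulr0 //; move: lt; rewrite tk wE; move: kp; rewrite /k.
    case/lastP: (p) => // p' l _; rewrite size_rcons cat_rcons onth_mid map_rcons last_rcons.
    by case=> ->.
  have tk : t = (k + size m).+1 :> nat by lia.
  have -> : t = inord (k + size m).+1 by apply/val_inj; rewrite /= inordK // -?tk.
  rewrite gr ?mulr0 //; have [jE] := etrans (esym e) tk.
  move: lt; rewrite jE wE catA /k -size_cat onth_cat ltnn subnn.
  by case: (q) => //= l q' [->].
rewrite [RHS](reindex_onto (fun t : 'I_(size m).+1 => inord (k + t)) (fun t => inord (t - k))) /=; last first.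
  move=> t /andP [t1 t2]; apply/val_inj => /=; rewrite !inordK //; lia.
apply: eq_big => [t|t _].
  have tm := ltn_ord t; rewrite ltnS in tm.
  by rewrite /inn inK // leq_addr leq_add2l tm addKn inord_val eqxx.
have tm := ltn_ord t; rewrite ltnS in tm.
rewrite inK //; have -> // : step w.2 a (k + j)%N (k + t)%N = step m a j t.
by rewrite wE; apply: step_seg.
Qed.
End Segment.
End Mstr.

(** * Inversion of words, and rigidity of thin words *)

Section StringWords.
Variable Q : bquiver.
Implicit Types (w u v : word Q) (s p m q : seq (letter Q)) (l : letter Q).

Definition linv l : letter Q := (l.1, ~~ l.2).

Lemma linvK l : linv (linv l) = l.
Proof. by case: l => a b; rewrite /linv /= negbK. Qed.
Lemma lsrc_inv l : lsrc (linv l) = ltgt l.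
Proof. by case: l => a []. Qed.
Lemma ltgt_inv l : ltgt (linv l) = lsrc l.
Proof. by case: l => a []. Qed.

Definition arrows w := [seq l.1 | l <- w.2].
Definition verts w := w.1 :: [seq ltgt l | l <- w.2].

Lemma verts_winv w : walk w.1 w.2 -> verts (winv w) = rev (verts w).
Proof.
case: w => x s /=; elim: s x => [|l s IH] x //= /andP [/eqP xl ws].
have := IH _ ws; rewrite /verts /winv /= (rev_cons (l.1, ~~ l.2)) map_rcons (rev_cons x) => <- /=.
by rewrite -/(linv l) ltgt_inv xl.
Qed.

Lemma endv_winv w : walk w.1 w.2 -> endv (winv w) = w.1.
Proof.
move=> ww; have := verts_winv ww; rewrite /verts => /(congr1 (last w.1)) /=.
by rewrite rev_cons last_rcons.
Qed.

Lemma walk_winv w : walk w.1 w.2 -> walk (winv w).1 (winv w).2.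
Proof.
case: w => x s /=; elim: s x => [|l s IH] x //= /andP [/eqP xl ws].
rewrite rev_cons -cats1 walk_cat; have /= -> := IH _ ws.
have /= := @endv_winv (ltgt l, s) ws; rewrite /winv /= => ->.
by rewrite -/(linv l) lsrc_inv eqxx.
Qed.

Lemma thin_winv w : thin w -> thin (winv w).
Proof.
move=> /andP [ww un]; apply/andP; split; first exact: walk_winv.
by rewrite -/(verts _) verts_winv // rev_uniq.
Qed.

Lemma size_winv w : size (winv w).2 = size w.2.
Proof. by rewrite size_rev size_map. Qed.

Lemma vtx_winv w i : walk w.1 w.2 -> (i <= size w.2)%N ->
  vtx (winv w) i = vtx w (size w.2 - i).
Proof.
move=> ww il; rewrite /vtx -/(verts _) verts_winv // nth_rev /= size_map ?ltnS //.
by rewrite subSS; apply: set_nth_default; rewrite /= size_map ltnS leq_subr.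
Qed.

Lemma onth_winv w i : (i < size w.2)%N ->
  onth (winv w).2 i = omap linv (onth w.2 (size w.2 - i.+1)).
Proof.
case: w => x s /= il; case sE: (onth s _) => [l|] /=; last first.
  by have := onthTE s (size s - i.+1); rewrite sE /=; case: ltnP => //; lia.
have x0 := l.
have := onthTE (rev [seq (l.1, ~~ l.2) | l <- s]) i; rewrite size_rev size_map il.
case rE : (onth _ i) => [l'|] // _; congr Some.
rewrite -(onth_nth l _ _ _ rE) nth_rev ?size_map // (nth_map l); last by lia.
by rewrite (onth_nth l _ _ _ sE).
Qed.

Lemma step_winv w a i j : (i <= size w.2)%N -> (j <= size w.2)%N ->
  step (winv w).2 a i j = step w.2 a (size w.2 - i)%N (size w.2 - j)%N.
Proof.
move=> il jl; rewrite /step orbC; congr (_ || _).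
  have [->|ij] := eqVneq i j.+1; last first.
    by rewrite /=; symmetry; apply/negbTE/negP => /andP [/eqP e _]; move: ij e; lia.
  have [jj|jn] := ltnP j (size w.2); last first.
    have -> : j = size w.2 by lia.
    rewrite /= onth_default ?size_winv //=; symmetry; apply/negbTE/negP => /andP [/eqP]; lia.
  rewrite onth_winv // /= -(_ : (size w.2 - j.+1).+1 = size w.2 - j)%N; last by lia.
  by rewrite eqxx /=; case: onth => //= -[b []].
have [->|ij] := eqVneq j i.+1; last first.
  by rewrite /=; symmetry; apply/negbTE/negP => /andP [/eqP e _]; move: ij e; lia.
have [ii|jn] := ltnP i (size w.2); last first.
  have -> : i = size w.2 by lia.
  rewrite /= onth_default ?size_winv //=; symmetry; apply/negbTE/negP => /andP [/eqP]; lia.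
rewrite onth_winv // /= -(_ : (size w.2 - i.+1).+1 = size w.2 - i)%N; last by lia.
by rewrite eqxx /=; case: onth => //= -[b []].
Qed.

Lemma thin_incident w i j l : thin w -> onth w.2 j = Some l -> (i <= size w.2)%N ->
  (lsrc l == vtx w i) || (ltgt l == vtx w i) -> i = j \/ i = j.+1.
Proof.
move=> tw sj il; have := onth_lt sj; have /andP [ww _] := tw.
have := @walk_onth _ w.1 w.2 j l ww sj; rewrite -surjective_pairing => -[<- <-] jl.
case/orP => /eqP e; [left|right]; apply: (thin_inj tw) => //; exact: ltnW.
Qed.

Lemma thin_cat x p m q : thin (x, p ++ m ++ q) -> thin (endv (x, p), m).
Proof.
rewrite /thin !walk_cat => /andP [/and3P [_ -> _] un].
apply: (@subseq_uniq _ _ (endv (x, p) :: [seq ltgt l | l <- m] ++ [seq ltgt l | l <- q])).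
  by rewrite -cat_cons; apply: prefix_subseq.
move: un; case/lastP: p => [|p l]; rewrite !map_cat //.
rewrite endv_rcons map_rcons cons_uniq [X in _ && uniq X]cat_rcons cat_uniq.
by case/andP => _ /and3P [].
Qed.

(** The first arrow of one word occurs in the other and touches its start, so both words begin with
    the same arrow. Opposite signs would make it a loop, which a thin word excludes. *)
Lemma thin_arrows_eq x s t : thin (x, s) -> thin (x, t) ->
  arrows (x, s) =i arrows (x, t) -> s = t.
Proof.
elim: s x t => [|l s IH] x [|l' t] tu tw /= eqa.
- by [].
- by have := eqa l'.1; rewrite !inE eqxx.
- by have := eqa l.1; rewrite !inE eqxx.
have [wu wt] : x = lsrc l /\ x = lsrc l' by move: tu tw => /andP [/= /andP [/eqP ? _] _] /andP [/= /andP [/eqP ? _] _].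
have e1 : l'.1 = l.1.
  have : l'.1 \in arrows (x, l :: s) by rewrite eqa inE eqxx.
  case/mapP => r /onthP [j sj] e.
  have rx : (lsrc r == vtx (x, l :: s) 0) || (ltgt r == vtx (x, l :: s) 0).
    by rewrite vtx0 /= wt /lsrc /ltgt e; case: (r.2); case: (l'.2); rewrite eqxx ?orbT.
  have [j0|//] := thin_incident tu sj (leq0n _) rx.
  by move: sj; rewrite -j0 e => -[<-].
have ll : l = l'.
  move: l l' {eqa IH} tu tw wu wt e1 => [a b] [a' b'] /= tu tw wu wt e1; subst a'.
  congr (_, _); case/andP: tu => _ /=; rewrite inE negb_or wu /lsrc /ltgt /=.
  by move: wt; rewrite wu /lsrc /=; case: b {tw wu}; case: b' => //= ->; rewrite eqxx.
subst l'; congr (_ :: _); have tc r : thin (x, l :: r) -> thin (ltgt l, r).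
  by move=> tr; have := @thin_cat x [:: l] r [::]; rewrite cats0; apply.
apply: (IH (ltgt l)); try exact: tc.
have nin r : thin (x, l :: r) -> l.1 \notin [seq l.1 | l <- r].
  move=> tr; apply/negP => /mapP [l' /onthP [j rj] e].
  have := @thin_arrow _ _ 0 j.+1 l.1 l.2 l'.2 tr; rewrite /= -surjective_pairing e -surjective_pairing.
  by move=> /(_ erefl rj).
move=> a; have := eqa a; rewrite /arrows /= !inE; have [->|//] := eqVneq a l.1.
by rewrite (negbTE (nin _ tu)) (negbTE (nin _ tw)).
Qed.

(** The start of [u] must be an end of [w]: at an interior position of [w] two letters meet, and the
    first letter of [u] would have to carry both of their arrows. *)
Lemma thin_rigid u w : thin u -> thin w -> arrows u =i arrows w -> verts u =i verts w ->
  u = w \/ u = winv w.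
Proof.
move=> tu tw ea ev.
have ux : u.1 \in verts w by rewrite -ev inE eqxx.
have [k kl uk] : exists2 k, (k <= size w.2)%N & u.1 = vtx w k.
  exists (index u.1 (verts w)); last by rewrite /vtx nth_index.
  by rewrite -index_mem /= size_map ltnS in ux *.
have st z : thin z -> arrows z =i arrows u -> z.1 = u.1 -> u = z.
  move=> tz ez z1; case: u z z1 tu tz ez {ea ev ux uk} => [x s] [y t] /= -> tu tz ez.
  by congr (_, _); apply: thin_arrows_eq tu tz _ => a; rewrite ez.
case: (posnP k) => [k0|k0]; first by left; apply: st; rewrite ?uk ?k0.
have [kn|kn] := eqVneq k (size w.2).
  right; apply: st => [|a|]; first exact: thin_winv.
    by rewrite ea /arrows /= map_rev mem_rev -map_comp.
  by rewrite uk kn; case: (w) => x s; rewrite vtx_last.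
have [l1 s1] : exists l, onth w.2 k.-1 = Some l.
  by have := onthTE w.2 k.-1; case: onth => [l|]; [exists l | case: ltnP => //; lia].
have [l2 s2] : exists l, onth w.2 k = Some l.
  by have := onthTE w.2 k; case: onth => [l|]; [exists l | case: ltnP => //; lia].
have /andP [ww _] := tw.
have v1 : vtx w k = ltgt l1.
  have := @walk_onth _ w.1 w.2 k.-1 l1 ww s1; rewrite -surjective_pairing prednK //.
  by case.
have v2 : vtx w k = lsrc l2.
  have := @walk_onth _ w.1 w.2 k l2 ww s2; rewrite -surjective_pairing.
  by case.
have inc l : l \in w.2 -> (lsrc l == u.1) || (ltgt l == u.1) ->
    exists b, onth u.2 0 = Some (l.1, b).
  move=> lw lu; have : l.1 \in arrows u by rewrite ea; apply/mapP; exists l.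
  case/mapP => r /onthP [j uj] e.
  have ru : (lsrc r == vtx u 0) || (ltgt r == vtx u 0).
    by rewrite vtx0; move: lu; rewrite /lsrc /ltgt e; case: (r.2); case: (l.2) => //; rewrite orbC.
  have [j0|//] := thin_incident tu uj (leq0n _) ru.
  by exists r.2; rewrite e j0 uj -surjective_pairing.
have [b1 u1] : exists b, onth u.2 0 = Some (l1.1, b).
  by apply: inc; [apply/onthP; exists k.-1 | rewrite uk v1 eqxx orbT].
have [b2 u2] : exists b, onth u.2 0 = Some (l2.1, b).
  by apply: inc; [apply/onthP; exists k | rewrite uk v2 eqxx].
move: u2 s2; rewrite u1 => -[e _]; rewrite (surjective_pairing l2) -e => s2.
rewrite (surjective_pairing l1) in s1; have := thin_arrow tw s1 s2; lia.
Qed.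
End StringWords.

(** * Strings of quadratic algebras as a condition on consecutive letters *)

Lemma consecP (T : Type) (P : T -> T -> Prop) (e : rel T) (s : seq T) :
  (forall x y, P x y <-> e x y) -> consec P s <-> sorted e s.
Proof.
move=> Pe; elim: s => [|x s IH]; first by split=> // _ [|? ?] ? ? ? //.
split=> [cs|].
  have : sorted e s by apply/IH => s1 y z s2 e1; apply: (cs (x :: s1) _ _ s2); rewrite e1.
  case: s cs {IH} => [|y s] cs //= ->; rewrite andbT; apply/Pe; exact: (cs [::]).
move=> ss [|z s1] y y' s2 /= [e1 e2]; subst s.
  by apply/Pe; move: ss => /= /andP []; rewrite e1.
subst z; apply: (IH.2 _ s1 y y' s2) => //.
by move: ss; case: (s1) => [|? ?] /= /andP [].
Qed.

Section Strings.
Variable Q : bquiver.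
Implicit Types (w u v : word Q) (s p m q : seq (letter Q)) (l : letter Q).

Definition quadratic := forall r, r \in rels Q -> exists a b : arr Q, r = [:: a; b].

(* In a quadratic algebra a walk is a string iff any two consecutive letters pass
   this test. *)
Definition okpair l1 l2 :=
  [&& ~~ ((l1.1 == l2.1) && (l1.2 != l2.2)),
      ~~ [&& l1.2, l2.2 & [:: l1.1; l2.1] \in rels Q] &
      ~~ [&& ~~ l1.2, ~~ l2.2 & [:: l2.1; l1.1] \in rels Q]].

Definition stringb w := walk w.1 w.2 && sorted okpair w.2.

Lemma walkP w : walk w.1 w.2 <->
  (match w.2 with [::] => True | l :: _ => w.1 = lsrc l end) /\
  consec (fun l1 l2 => ltgt l1 = lsrc l2) w.2.
Proof.
case: w => x s; rewrite (@consecP _ _ (fun l1 l2 => ltgt l1 == lsrc l2)); last first.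
  by move=> l1 l2; split => [->|/eqP].
elim: s x => [|l s IH] x //=; split=> [/andP [/eqP -> /IH [h1 h2]]|[-> pt]].
  by split=> //; case: s h1 h2 {IH} => //= l' s -> ->; rewrite eqxx.
rewrite eqxx; apply/IH => /=; case: s pt {IH} => //= l' s /andP [/eqP -> ->] //.
Qed.

Lemma is_stringP w : quadratic -> is_string w <-> stringb w.
Proof.
move=> r2; split=> [[s1 [s2 [s3 s4]]]|/andP [/walkP [s1 s2] ss]].
  apply/andP; split; first exact/walkP.
  apply/(@consecP _ (fun l1 l2 => okpair l1 l2)) => // t1 x y t2 e.
  rewrite /okpair; apply/and3P; split.
  - by apply/negP => /andP [/eqP xy /eqP nxy]; apply: (s3 t1 x y t2 e).
  - apply/negP => /and3P [x2 y2 /s4 [[]]]; exists t1, t2.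
    by rewrite e /=; case: x x2 {e} => a [] // _; case: y y2 => b [].
  - apply/negP => /and3P [x2 y2 /s4 [_ []]]; exists t1, t2.
    by rewrite e /= /rev /=; case: x x2 {e} => a [] // _; case: y y2 => b [].
have cs := (@consecP _ (fun l1 l2 => okpair l1 l2) okpair w.2 (fun _ _ => iff_refl _)).2 ss.
split=> //; split=> //; split.
  move=> t1 x y t2 e [xy nxy]; have /and3P [/negP k _ _] := cs t1 x y t2 e.
  by apply: k; rewrite xy eqxx; apply/eqP.
move=> r rR; have [a [b re]] := r2 r rR; subst r; split=> -[t1 [t2 e]].
  have /and3P [_ /negP k _] := cs _ _ _ _ e; exact: k.
have /and3P [_ _ /negP k] := cs _ _ _ _ e; exact: k.
Qed.

Lemma okpair_inv l1 l2 : okpair (linv l2) (linv l1) = okpair l1 l2.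
Proof.
rewrite /okpair /= !negbK [l2.1 == l1.1]eq_sym.
case: l1 l2 => a b [c d] /=; congr (_ && _); first by case: b; case: d.
by case: b; case: d => //=; rewrite ?andbT ?andbF.
Qed.

Lemma stringb_winv w : stringb w -> stringb (winv w).
Proof.
case/andP => ww ss; rewrite /stringb walk_winv //= rev_sorted sorted_map.
by apply: sub_sorted ss => l1 l2 /=; rewrite -(okpair_inv l1 l2).
Qed.

Lemma stringb_cat x p m q : stringb (x, p ++ m ++ q) -> stringb (endv (x, p), m).
Proof.
rewrite /stringb /= !walk_cat => /andP [/and3P [_ -> _] ss] /=.
by have := cat_sorted2 (cat_sorted2 ss).2 => -[].
Qed.

Lemma winv_cat x p l q : walk x (p ++ l :: q) ->
  (winv (x, p ++ l :: q)) = (endv (x, p ++ l :: q),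
    (winv (ltgt l, q)).2 ++ linv l :: (winv (x, p)).2).
Proof. by move=> ww; rewrite /winv /= map_cat rev_cat /= rev_cons cat_rcons. Qed.
End Strings.

(** * String modules and their quotients and submodules given by segments *)

Section StringModules.
Variables (F : fieldType) (Q : bquiver).
Implicit Types (w u v : word Q) (s p m q : seq (letter Q)) (l : letter Q) (X Z : rep F Q).
Local Notation M := (Mstr F).

Lemma step_vtx w a i j : walk w.1 w.2 -> step w.2 a i j ->
  vtx w i = src a /\ vtx w j = tgt a.
Proof.
by case: w => x s ws /orP [] /andP [/eqP -> /eqP /(walk_onth ws) []].
Qed.

Lemma Mstr_module w : quadratic Q -> is_string w -> is_module (M w).
Proof.
move=> r2 /(is_stringP _ r2) /andP [ww ss]; split.
  move=> i j; apply/matrixP => p q; rewrite mul_ridemE ridem_MstrE.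
  have [<-|ij] := eqVneq i j.
    by rewrite ridem_MstrE; case: (vtx w p == i); rewrite ?andbF.
  rewrite mxE; case: (vtx w p =P i) => // ->.
  by rewrite (negbTE ij) andbF.
split.
  apply/matrixP => p q; rewrite summxE mxE (bigD1 (vtx w p)) //= big1 ?addr0.
    by rewrite ridem_MstrE eqxx andbT.
  by move=> i /negbTE ip; rewrite ridem_MstrE [_ == i]eq_sym ip andbF.
split.
  move=> a; apply/matrixP => p q; rewrite mulr_ridemE mul_ridemE ract_MstrE.
  case st: (step _ _ _ _); last by case: ifP => // _; case: ifP.
  by have [-> ->] := step_vtx ww st; rewrite !eqxx.
move=> r rR; have [a [b re]] := r2 r rR; subst r; rewrite /pathmx /= mul1mx.
apply/matrixP => p q; rewrite !mxE big1 // => t _; rewrite !ract_MstrE.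
case s1 : (step _ _ p t); last by rewrite mul0r.
case s2 : (step _ _ t q); last by rewrite mulr0.
have cs := (@consecP _ (fun l1 l2 => okpair l1 l2) (@okpair Q) w.2 (fun _ _ => iff_refl _)).2 ss.
have split2 k l l' : onth w.2 k = Some l -> onth w.2 k.+1 = Some l' -> okpair l l'.
  move=> e1 e2; apply: (cs (take k w.2) l l' (drop k.+2 w.2)).
  have k2 := onth_lt e2.
  rewrite -{1}(cat_take_drop k w.2) (drop_nth l) ?(ltnW k2) //.
  by rewrite (onth_nth l _ _ _ e1) (drop_nth l) // (onth_nth l _ _ _ e2).
(* Two steps in the same sense use consecutive letters, where [okpair] excludes the relation; a
   change of sense would use one letter with both signs. *)
case/orP: s1 => /andP [/eqP e1 /eqP o1]; case/orP: s2 => /andP [/eqP e2 /eqP o2].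
- by have := split2 _ _ _ o1; rewrite -e1 => /(_ _ o2) /and3P [_ /negP k _]; case: k.
- move: o1; have [->] : p = q :> nat by move: e1 e2; lia.
  by rewrite o2.
- by move: o2; rewrite o1.
- by have := split2 _ _ _ o2; rewrite -e2 => /(_ _ o1) /and3P [_ _ /negP k]; case: k.
Qed.

Lemma winv_iso w : walk w.1 w.2 -> iso (M w) (M (winv w)).
Proof.
move=> ww; pose f : 'M[F]_(rdim (M w), rdim (M (winv w))) :=
  \matrix_(i, j) (i + j == size w.2)%N%:R.
have sw := size_winv w.
have rv (i : 'I_(size w.2).+1) : (size w.2 - i < (size (winv w).2).+1)%N by rewrite sw ltnS leq_subr.
have rv' (j : 'I_(size (winv w).2).+1) : (size w.2 - j < (size w.2).+1)%N by rewrite ltnS leq_subr.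
have fE1 r (A : 'M_(_, r)) (i : 'I_(size w.2).+1) j : (f *m A) i j = A (Ordinal (rv i)) j.
  rewrite mxE (eq_bigr (fun t : 'I_(size (winv w).2).+1 => (i + t == size w.2)%N%:R * A t j)); last first.
    by move=> t _; rewrite mxE.
  have il := ltn_ord i; rewrite ltnS in il.
  rewrite (@sum_delta _ _ (fun t => A t j) (Ordinal (rv i)) (fun t => i + t == size w.2)%N) /=.
    by rewrite subnKC // eqxx mul1r.
  move=> t; apply: contra => /eqP e; apply/eqP/val_inj => /=; lia.
have fE2 r (A : 'M_(r, _)) i (j : 'I_(size (winv w).2).+1) : (A *m f) i j = A i (Ordinal (rv' j)).
  rewrite mxE (eq_bigr (fun t : 'I_(size w.2).+1 => (t + j == size w.2)%N%:R * A i t)); last first.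
    by move=> t _; rewrite mxE mulrC.
  have jl : (j <= size w.2)%N by rewrite -ltnS -sw; apply: ltn_ord.
  rewrite (@sum_delta _ _ (fun t => A i t) (Ordinal (rv' j)) (fun t => t + j == size w.2)%N) /=.
    by rewrite subnK // eqxx mul1r.
  move=> t; apply: contra => /eqP e; apply/eqP/val_inj => /=; lia.
have hf : is_hom (M w) (M (winv w)) f.
  split=> [v|a]; apply/matrixP => i j; move: i j;
    refine (fun (i : 'I_(size w.2).+1) (j : 'I_(size (winv w).2).+1) => _); rewrite fE1 fE2.
    rewrite !ridem_MstrE -!val_eqE /=; congr ((nat_of_bool _)%:R).
    have il : (i <= size w.2)%N by rewrite -ltnS; apply: ltn_ord.
  have jl : (j <= size w.2)%N by rewrite -ltnS -sw; apply: ltn_ord.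
    have -> : (i == size w.2 - j :> nat)%N = (size w.2 - i == j)%N by lia.
    case: eqP => //= e; rewrite vtx_winv ?e //.
    by congr (vtx w _ == v); lia.
  rewrite !ract_MstrE /=; congr ((nat_of_bool _)%:R).
  have il : (i <= size w.2)%N by rewrite -ltnS; apply: ltn_ord.
  have jl : (j <= size w.2)%N by rewrite -ltnS -sw; apply: ltn_ord.
  by rewrite step_winv ?leq_subr // subKn.
have f1 : f *m f^T = 1%:M.
  apply/matrixP => i j; move: i j; refine (fun (i j : 'I_(size w.2).+1) => _).
  rewrite fE1 !mxE -val_eqE /=; congr ((nat_of_bool _)%:R).
  have il : (i <= size w.2)%N by rewrite -ltnS; apply: ltn_ord.
  have jl : (j <= size w.2)%N by rewrite -ltnS; apply: ltn_ord.
  by lia.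
have f2 : f^T *m f = 1%:M.
  apply/matrixP => i j; move: i j; refine (fun (i j : 'I_(size (winv w).2).+1) => _).
  rewrite fE2 !mxE -val_eqE /=; congr ((nat_of_bool _)%:R).
  have il : (i <= size w.2)%N by rewrite -ltnS -sw; apply: ltn_ord.
  have jl : (j <= size w.2)%N by rewrite -ltnS -sw; apply: ltn_ord.
  have arith (x y n : nat) : (x <= n -> y <= n -> (n - y + x == n) = (x == y))%N by lia.
  exact: arith.
by exists f, f^T; split=> //; split=> //; apply: hom_inv f2.
Qed.

(* For a word p ++ m ++ q: both letters adjacent to m point away from m, so that
   M(m) is a quotient of M(p ++ m ++ q); dually for issub. *)
Definition isfact p q := ~~ last false (map snd p) && head true (map snd q : seq bool).
Definition issub p q := last true (map snd p) && ~~ head false (map snd q : seq bool).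

Lemma fact_hom w p m q : w.2 = p ++ m ++ q -> isfact p q ->
  is_hom (M w) (M (endv (w.1, p), m)) (shiftmx F (size p) (size m) (size w.2))^T.
Proof.
move=> wE /andP [p1 q1]; rewrite -[X in is_hom _ _ X]mul1mx.
by apply: (seg_proj wE (hom_id _)) => h; [rewrite h in p1|rewrite q1 in h].
Qed.

Lemma sub_hom w p m q : w.2 = p ++ m ++ q -> issub p q ->
  is_hom (M (endv (w.1, p), m)) (M w) (shiftmx F (size p) (size m) (size w.2)).
Proof.
move=> wE /andP [p1 q1]; rewrite -[X in is_hom _ _ X]mulmx1.
by apply: (seg_inc wE (hom_id _)) => h; [rewrite p1 in h|rewrite h in q1].
Qed.

Lemma full_shiftmxT (k m n : nat) : (k + m <= n)%N -> row_full (shiftmx F k m n)^T.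
Proof. by move=> kmn; apply/row_fullP; exists (shiftmx F k m n); apply: shiftmxK. Qed.

Lemma free_shiftmx (k m n : nat) : (k + m <= n)%N -> row_free (shiftmx F k m n).
Proof. by move=> kmn; apply/row_freeP; exists (shiftmx F k m n)^T; apply: shiftmxK. Qed.

(** A letter pointing forward sends the last position of [p] to the first of [q], so the part after
    the letter is a submodule; a backward letter exchanges the roles. *)
Lemma ses_concat w p l q : w.2 = p ++ l :: q ->
  if l.2 then ses (M (ltgt l, q)) (M w) (M (w.1, p)) else ses (M (w.1, p)) (M w) (M (ltgt l, q)).
Proof.
move=> wE; have wE1 : w.2 = [::] ++ p ++ (l :: q) by [].
have wE2 : w.2 = rcons p l ++ q ++ [::] by rewrite cats0 cat_rcons.
have h1 := seg_le wE1; have h2 := seg_le wE2; rewrite size_rcons in h2.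
have sz : size w.2 = (size p + size q).+1 by rewrite wE size_cat /= addnS.
case lb: l.2.
  exists (shiftmx F (size p).+1 (size q) (size w.2)), (shiftmx F 0 (size p) (size w.2))^T.
  split.
    by have := @sub_hom w _ _ _ wE2; rewrite endv_rcons size_rcons; apply; rewrite /issub map_rcons last_rcons lb.
  split; first by apply: (fact_hom wE1); rewrite /isfact /= lb.
  split; first exact: free_shiftmx.
  split; first exact: full_shiftmxT.
  split; first by apply: shiftmx_disj => //; rewrite ltnS leqnn orbT.
  by rewrite mxrank_tr !rank_shiftmx //= sz; lia.
exists (shiftmx F 0 (size p) (size w.2)), (shiftmx F (size p).+1 (size q) (size w.2))^T.
split; first by apply: (sub_hom wE1); rewrite /issub /= lb.
split.
  by have := @fact_hom w _ _ _ wE2; rewrite endv_rcons size_rcons; apply; rewrite /isfact map_rcons last_rcons lb.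
split; first exact: free_shiftmx.
split; first exact: full_shiftmxT.
split; first by apply: shiftmx_disj => //; rewrite ltnS leqnn.
by rewrite mxrank_tr !rank_shiftmx //= sz; lia.
Qed.

(** An isomorphism preserves which arrows and which vertex idempotents act by nonzero matrices, and
    these determine a thin word up to inversion by [thin_rigid]. *)
Lemma Mstr_rigid u w : thin u -> thin w -> iso (M u) (M w) -> u = w \/ u = winv w.
Proof.
move=> tu tw [f [g [[hf1 hf2] [[hg1 hg2] [fg gf]]]]].
have act_neq0 z a : thin z -> (a \in arrows z) = (ract (M z) a != 0).
  have nz i j : delta_mx i j != 0 :> 'M[F]_((size z.2).+1).
    by apply/eqP => /matrixP /(_ i j) /eqP; rewrite !mxE !eqxx oner_eq0.
  move=> tz; apply/idP/idP => [/mapP [[a' b] /onthP [k zk] e]|].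
    have ae : a = a' := e; rewrite ae {e ae}; case: b zk => zk.
      by rewrite (onth_step_true _ tz zk) nz.
    by rewrite (onth_step_false _ tz zk) nz.
  by apply: contraR => na; rewrite onth_step_none.
apply: thin_rigid => // x.
  rewrite !act_neq0 //; congr (~~ _); apply/eqP/eqP => e.
    by rewrite -[ract _ _]mul1mx -gf -mulmxA -hf2 e mul0mx mulmx0.
  by rewrite -[ract _ _]mul1mx -fg -mulmxA -hg2 e mul0mx mulmx0.
have id_neq0 z : (x \in verts z) = (ridem (M z) x != 0).
  apply/idP/idP => [xz|].
    have kl : (index x (verts z) < (size z.2).+1)%N by rewrite -index_mem /= size_map in xz.
    apply/eqP => /matrixP /(_ (Ordinal kl) (Ordinal kl)); rewrite ridem_MstrE eqxx /= mxE.
    by rewrite /vtx -/(verts z) nth_index // eqxx => /eqP; rewrite oner_eq0.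
  apply: contraR => next_arrow; apply/eqP/matrixP => i j; rewrite ridem_MstrE mxE.
  case: eqP => //= _; case: eqP => // e; case/negP: next_arrow; rewrite -e /vtx -/(verts z) mem_nth //=.
  by rewrite size_map.
rewrite !id_neq0 //; congr (~~ _); apply/eqP/eqP => e.
  by rewrite -[ridem _ _]mul1mx -gf -mulmxA -hf1 e mul0mx mulmx0.
by rewrite -[ridem _ _]mul1mx -fg -mulmxA -hg1 e mul0mx mulmx0.
Qed.
End StringModules.

(** * Submodules of thin string modules *)

Section Runs.
Variable Q : bquiver.
Implicit Types (w u v : word Q) (s p m q : seq (letter Q)) (l : letter Q).

(* m covers a maximal block of positions with constant colour b. *)
Definition is_run (c : nat -> bool) p m q b :=
  [/\ forall i, (i <= size m)%N -> c (size p + i)%N = b,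
      (0 < size p)%N -> c (size p).-1 = ~~ b &
      (0 < size q)%N -> c (size p + size m).+1 = ~~ b].

Lemma run_left (c : nat -> bool) t : exists2 i, (i <= t)%N &
  (forall j, (i <= j <= t)%N -> c j = c t) /\ ((0 < i)%N -> c i.-1 = ~~ c t).
Proof.
elim: t => [|t [i it [h1 h2]]].
  by exists 0%N => //; split=> // j /andP [_]; rewrite leqn0 => /eqP ->.
have [e|ne] := eqVneq (c t) (c t.+1).
  exists i; first lia; split; last by move=> i0; rewrite h2 // e.
  by move=> j jt; have [->|jn] := eqVneq j t.+1; rewrite // h1 //; lia.
exists t.+1 => //; split=> [j jt|_]; first by congr c; lia.
by move: ne; rewrite /=; case: (c t); case: (c t.+1).
Qed.

Lemma run_right (c : nat -> bool) n t : (t <= n)%N -> exists2 j, (t <= j <= n)%N &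
  (forall i, (t <= i <= j)%N -> c i = c t) /\ ((j < n)%N -> c j.+1 = ~~ c t).
Proof.
move=> tn; elim: n tn => [|n IH] tn.
  by exists 0%N; [lia | split=> // i it; congr c; lia].
have [->|tn'] := eqVneq t n.+1.
  exists n.+1; first lia; split=> [i it|]; [congr c; lia | by rewrite ltnn].
have [|j jn [h1 h2]] := IH; first lia.
have [jn'|jn'] := ltnP j n; first by exists j; [lia | split=> // _; apply: h2].
have jE : j = n by lia.
have [e|ne] := eqVneq (c n.+1) (c t).
  exists n.+1; first lia; split; last by rewrite ltnn.
  by move=> i it; have [->|iN] := eqVneq i n.+1; rewrite // h1 //; lia.
exists j; first lia; split=> // _; rewrite jE.
by move: ne; case: (c t); case: (c n.+1).
Qed.

Lemma cut3 (T : Type) (s : seq T) i j : (i <= j)%N -> (j <= size s)%N ->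
  s = take i s ++ take (j - i) (drop i s) ++ drop j s.
Proof.
move=> ij js; rewrite -{1}(cat_take_drop i s); congr (_ ++ _).
by rewrite -{1}(cat_take_drop (j - i) (drop i s)) drop_drop subnK.
Qed.

Lemma run_at s c t : (t <= size s)%N -> exists p m q,
  [/\ s = p ++ m ++ q, (size p <= t <= size p + size m)%N & is_run c p m q (c t)].
Proof.
move=> ts; have [i it [l1 l2]] := run_left c t; have [j jt [r1 r2]] := run_right c ts.
exists (take i s), (take (j - i) (drop i s)), (drop j s).
have si : size (take i s) = i by rewrite size_takel //; lia.
have sm : size (take (j - i) (drop i s)) = (j - i)%N by rewrite size_takel // size_drop; lia.
split; first by apply: cut3; lia.
  by rewrite si sm; lia.
split; rewrite si ?sm ?size_drop //.
  move=> k kj; have [kt|kt] := leqP (i + k) t; [rewrite l1|rewrite r1] => //; lia.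
by move=> jn; rewrite (_ : i + (j - i) = j)%N; [apply: r2; lia | lia].
Qed.

(** Induction over the prefixes that end at a colour change: the last run is split off, and the
    letter in front of it joins it to a shorter prefix of the same kind. *)
Lemma runs_concat (Y : word Q -> Prop) x s c :
  (forall p m q b, s = p ++ m ++ q -> is_run c p m q b -> Y (endv (x, p), m)) ->
  (forall p l m q, s = p ++ l :: m ++ q -> Y (x, p) -> Y (ltgt l, m) -> Y (x, p ++ l :: m)) ->
  Y (x, s).
Proof.
move=> Yr Yc; suff H t : (t <= size s)%N -> ((t < size s)%N -> c t.+1 = ~~ c t) -> Y (x, take t s).
  by have := H (size s); rewrite take_size ltnn; apply.
elim/ltn_ind: t => t IH ts ct.
have [i it [l1 l2]] := run_left c t.
set m := take (t - i) (drop i s).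
have si : size (take i s) = i by rewrite size_takel //; lia.
have sm : size m = (t - i)%N by rewrite size_takel // size_drop; lia.
have sE : s = take i s ++ m ++ drop t s by apply: cut3; lia.
have tE : take t s = take i s ++ m.
  by rewrite {1}sE catA take_size_cat // size_cat si sm; lia.
have Ym : Y (endv (x, take i s), m).
  apply: (Yr _ _ _ (c t) sE); split; rewrite ?si ?sm ?size_drop //.
    by move=> k kt; apply: l1; lia.
  by move=> nt; rewrite (_ : i + (t - i) = t)%N; [apply: ct; lia | lia].
case: (posnP i) => [i0|i0].
  by move: Ym; rewrite tE i0 take0.
have [l spec_letter] : exists l, onth s i.-1 = Some l.
  by have := onthTE s i.-1; case: onth => [l|]; [exists l | case: ltnP => //; lia].
have iE : take i s = rcons (take i.-1 s) l.
  rewrite -{1}(prednK i0) (take_nth l); last by lia.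
  by rewrite (onth_nth l _ _ _ spec_letter).
rewrite tE iE cat_rcons; apply: (Yc _ _ _ (drop t s)).
- by rewrite -cat_rcons -iE; exact: sE.
- apply: IH; [lia | lia |] => _; rewrite prednK // l2 // negbK; apply: l1; lia.
- by move: Ym; rewrite iE endv_rcons.
Qed.

Lemma last_snd p b : last b (map snd p) != b -> exists p' l, p = rcons p' l /\ l.2 = ~~ b.
Proof.
case/lastP: p => [|p l] /=; first by rewrite eqxx.
by rewrite map_rcons last_rcons => h; exists p, l; split=> //; move: h; case: (l.2); case: b.
Qed.

Lemma head_snd p b : head b (map snd p) != b -> exists l p', p = l :: p' /\ l.2 = ~~ b.
Proof.
case: p => [|l p] /=; first by rewrite eqxx.
by move=> h; exists l, p; split=> //; move: h; case: (l.2); case: b.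
Qed.
End Runs.

(** * The image of a map into a thin string module *)

Section Color.
Variables (F : fieldType) (Q : bquiver).
Implicit Types (w u v : word Q) (s p m q : seq (letter Q)) (l : letter Q) (X Y Z : rep F Q).
Local Notation M := (Mstr F).

Section ThinTarget.
Variables (w : word Q) (X : rep F Q) (f : 'M[F]_(rdim X, rdim (M w))).
Hypotheses (tw : thin w) (hf : is_hom X (M w) f).

(* Since w is thin, position k is coloured iff b_k lies in the image of f. *)
Definition color (k : nat) : bool := [exists i, f i (inord k) != 0].

Lemma color0 k i : ~~ color k -> f i (inord k) = 0.
Proof. by rewrite /color negb_exists => /forallP /(_ i) /negPn /eqP. Qed.

(** By thinness the idempotent at the vertex of position [k] isolates the coordinate [k] of a vector
    in the image. *)
Lemma color_sub k : (k <= size w.2)%N -> color k ->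
  ((delta_mx 0 (inord k) : 'rV_(size w.2).+1) <= f)%MS.
Proof.
move=> kn /existsP [i fi]; have [h1 _] := hf.
have e : row i (f *m ridem (M w) (vtx w k)) = f i (inord k) *: delta_mx 0 (inord k).
  apply/rowP => j; rewrite [LHS]mxE mulr_ridemE !mxE eqxx /=.
  case: (vtx w j =P vtx w k) => [e|ne].
    have -> : j = inord k.
      apply/val_inj; rewrite /= inordK ?ltnS //; apply: (thin_inj tw) => //.
      by rewrite -ltnS ltn_ord.
    by rewrite eqxx mulr1.
  case: (j =P inord k) => [e|_]; last by rewrite mulr0.
  by case: ne; rewrite e inordK.
have : (row i (f *m ridem (M w) (vtx w k)) <= f)%MS.
  by apply: submx_trans (row_sub _ _) _; rewrite -h1 submxMl.
by rewrite e (eqmx_scale _ fi).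
Qed.

Lemma color_step i j a : (i <= size w.2)%N -> (j <= size w.2)%N ->
  step w.2 a i j -> color i -> color j.
Proof.
move=> il jl st ci; have [_ h2] := hf.
have : ((delta_mx 0 (inord i) : 'rV_(size w.2).+1) *m ract (M w) a <= f)%MS.
  apply: submx_trans (submxMr _ (color_sub il ci)) _.
  by rewrite -h2 submxMl.
have -> : delta_mx 0 (inord i) *m ract (M w) a = delta_mx 0 (inord j) :> 'rV_(size w.2).+1.
  apply/rowP => k; rewrite -rowE mxE ract_MstrE mxE /= inordK // -val_eqE /= [in RHS]inordK //.
  congr (_%:R); congr nat_of_bool; apply/idP/eqP => [st'|-> //].
  move: st st'; rewrite /step => /orP [] /andP [/eqP e /eqP s1] /orP [] /andP [/eqP e' /eqP s2];
    first [lia | by have := thin_arrow tw s1 s2; move: s1 s2; first [move=> + + z; rewrite z => -> //|lia]].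
case/submxP => D e; rewrite /color; apply/existsP; apply: NNPP => nex.
have /rowP /(_ (inord j)) := e; rewrite mxE !eqxx /= mxE big1 => [/eqP|k _].
  by rewrite oner_eq0.
by case: (f k (inord j) =P 0) => [->|/eqP ne]; [rewrite mulr0 | case: nex; exists k].
Qed.

Section ARun.
Variables (p m q : seq (letter Q)).
Hypothesis wE : w.2 = p ++ m ++ q.
Let u : word Q := (endv (w.1, p), m).
Let inc := shiftmx F (size p) (size m) (size w.2).

(** The positions next to a coloured run are uncoloured, so [f] vanishes there as [seg_proj]
    requires. *)
Lemma run_true_hom : is_run color p m q true -> is_hom X (M u) (f *m inc^T).
Proof.
move=> [_ r2 r3]; apply: (seg_proj wE hf) => h i; apply: color0.
  by rewrite r2 //; case: (p) h.
by rewrite r3 //; case: (q) h.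
Qed.

Lemma run_true_sub : is_run color p m q true -> (inc <= f)%MS.
Proof.
move=> [r1 _ _]; have le := seg_le wE; apply/row_subP => i; rewrite rowE.
have il := ltn_ord i; rewrite ltnS in il.
have -> : delta_mx 0 i *m inc = delta_mx 0 (inord (size p + i)) :> 'rV_(size w.2).+1.
  apply/rowP => j; rewrite -rowE !mxE eqxx /= -val_eqE /= inordK //; lia.
by apply: color_sub; [lia | apply: r1].
Qed.

Lemma run_true_full : is_run color p m q true -> row_full (f *m inc^T).
Proof.
move=> r; have le := seg_le wE; have /submxP [D e] := run_true_sub r.
by apply/row_fullP; exists D; rewrite mulmxA -e shiftmxK.
Qed.

Lemma step_before p' l : p = rcons p' l ->
  step w.2 l.1 (if l.2 then (size p).-1 else size p) (if l.2 then size p else (size p).-1).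
Proof.
move=> pE; have o : onth w.2 (size p).-1 = Some l.
  by rewrite wE pE size_rcons cat_rcons onth_mid.
have sp : (size p).-1.+1 = size p by rewrite pE size_rcons.
by case: l o {pE} => a [] o; rewrite /step /= o sp !eqxx ?orbT.
Qed.

Lemma step_after l q' : q = l :: q' ->
  let k := (size p + size m)%N in
  step w.2 l.1 (if l.2 then k else k.+1) (if l.2 then k.+1 else k).
Proof.
move=> qE; set k := (size p + size m)%N; rewrite /=; have o : onth w.2 k = Some l.
  by rewrite wE qE catA /k -size_cat onth_mid.
by case: l o {qE} => a [] o; rewrite /step /= o !eqxx ?orbT.
Qed.

(** A letter pointing into the run would carry the colour of its outer neighbour into the run, by
    [color_step]. *)
Lemma run_false_fact : is_run color p m q false -> isfact p q.
Proof.
move=> [r1 r2 r3]; have le := seg_le wE; apply/andP; split.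
  apply/negP => /negPf lp; have [|p' [l [pE lb]]] := @last_snd _ p false; first by case: last lp.
  have sp : size p = (size p').+1 by rewrite pE size_rcons.
  have st := step_before pE; rewrite lb in st.
  have i1 : ((size p).-1 <= size w.2)%N by lia.
  have i2 : (size p <= size w.2)%N by lia.
  have p0 : (0 < size p)%N by rewrite sp.
  have := color_step i1 i2 st; rewrite r2 //.
  by have := r1 0%N isT; rewrite addn0 => -> /(_ isT).
apply/negPn/negP => lq; have [|l [q' [qE lb]]] := @head_snd _ q true; first by case: head lq.
have sz : size w.2 = (size p + size m + (size q').+1)%N by rewrite wE qE !size_cat /=; lia.
have := step_after qE; rewrite lb => st.
have i1 : (size p + size m <= size w.2)%N by lia.
have i2 : ((size p + size m).+1 <= size w.2)%N by lia.
have q0 : (0 < size q)%N by rewrite qE.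
by have := color_step i2 i1 st; rewrite r1 // r3 // => /(_ isT).
Qed.

Lemma run_true_issub : is_run color p m q true -> issub p q.
Proof.
move=> [r1 r2 r3]; have le := seg_le wE; apply/andP; split.
  apply/negPn/negP => lp; have [|p' [l [pE lb]]] := @last_snd _ p true; first by case: last lp.
  have sp : size p = (size p').+1 by rewrite pE size_rcons.
  have st := step_before pE; rewrite lb in st.
  have i1 : ((size p).-1 <= size w.2)%N by lia.
  have i2 : (size p <= size w.2)%N by lia.
  have p0 : (0 < size p)%N by rewrite sp.
  have := color_step i2 i1 st; rewrite r2 //.
  by have := r1 0%N isT; rewrite addn0 => -> /(_ isT).
apply/negP => lq; have [|l [q' [qE lb]]] := @head_snd _ q false; first by case: head lq.
have sz : size w.2 = (size p + size m + (size q').+1)%N by rewrite wE qE !size_cat /=; lia.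
have := step_after qE; rewrite lb => st.
have i1 : (size p + size m <= size w.2)%N by lia.
have i2 : ((size p + size m).+1 <= size w.2)%N by lia.
have q0 : (0 < size q)%N by rewrite qE.
by have := color_step i1 i2 st; rewrite r1 // r3 // => /(_ isT).
Qed.

Lemma run_false_zero : is_run color p m q false -> f *m inc^T = 0.
Proof.
move=> [r1 _ _]; have le := seg_le wE; apply/matrixP => i j; have jl := ltn_ord j; rewrite ltnS in jl.
by rewrite shiftmxrE // mxE color0 // r1.
Qed.

(** [D] lifts the inclusion of the run through the injective [f]; injectivity also makes [D] a
    homomorphism. Projecting [f] to the run gives the retraction. *)
Lemma run_true_retract : row_free f -> is_run color p m q true -> retract (M u) X.
Proof.
move=> ff r; have le := seg_le wE.
have /submxP [D e] := run_true_sub r.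
have hi := sub_hom F wE (run_true_issub r).
exists D, (f *m inc^T); split; last first.
  by split; [exact: run_true_hom | rewrite mulmxA -e shiftmxK].
case: hi hf => i1 i2 [h1 h2].
by split=> v; apply: (row_free_inj ff); rewrite -[LHS]mulmxA -[RHS]mulmxA -e ?h1 ?h2 [RHS]mulmxA -e; [apply: i1|apply: i2].
Qed.
End ARun.
End ThinTarget.
End Color.

(** * Exact sequences and surjections involving thin string modules *)

Section Ses.
Variables (F : fieldType) (Q : bquiver).
Implicit Types (w u v : word Q) (s p m q : seq (letter Q)) (l : letter Q) (X Y Z : rep F Q).
Local Notation M := (Mstr F).

Lemma row_full_comp a b c (A : 'M[F]_(a, b)) (B : 'M[F]_(b, c)) :
  row_full A -> row_full B -> row_full (A *m B).
Proof.
move=> /row_fullP [A' hA] /row_fullP [B' hB]; apply/row_fullP; exists (B' *m A').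
by rewrite mulmxA -(mulmxA B') hA mulmx1.
Qed.

Lemma row_full_right a b c (A : 'M[F]_(a, b)) (B : 'M[F]_(b, c)) :
  row_full (A *m B) -> row_full B.
Proof.
by move=> /row_fullP [D e]; apply/row_fullP; exists (D *m A); rewrite -mulmxA.
Qed.

(** The colouring records the image of [X] in [M w]. A coloured run is a quotient of [X]; on an
    uncoloured one [X] vanishes, so the projection factors through [Z]. *)
Lemma ext_run w X Y Z (f : 'M_(rdim X, rdim Y)) (g : 'M_(rdim Y, rdim Z))
    (h : 'M_(rdim Y, rdim (M w))) p m q b :
  thin w -> is_hom X Y f -> is_hom Y Z g -> row_full g -> f *m g = 0 ->
  (\rank f + \rank g)%N = rdim Y -> is_hom Y (M w) h -> row_full h ->
  w.2 = p ++ m ++ q -> is_run (color (f *m h)) p m q b ->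
  exists k : 'M_(rdim (if b then X else Z), rdim (M (endv (w.1, p), m))),
    is_hom (if b then X else Z) (M (endv (w.1, p), m)) k /\ row_full k.
Proof.
move=> tw hf hg fg fg0 rk hh fh wE; have hfh := hom_comp hf hh.
case: b => run.
  exists (f *m h *m (shiftmx F (size p) (size m) (size w.2))^T).
  by split; [apply: (run_true_hom hfh wE run) | apply: (run_true_full tw hfh wE run)].
have fa := fact_hom F wE (run_false_fact tw hfh wE run).
have z := run_false_zero wE run; rewrite -mulmxA in z.
have [k hk gk] := ses_factor hg fg fg0 rk (hom_comp hh fa) z.
exists k; split=> //; apply: (@row_full_right _ _ _ g); rewrite gk.
by apply: row_full_comp fh (full_shiftmxT F (seg_le wE)).
Qed.

Lemma color_zero w X Z (f : 'M_(rdim X, rdim (M w))) (g : 'M_(rdim (M w), rdim Z)) k j :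
  thin w -> is_hom X (M w) f -> f *m g = 0 -> (k <= size w.2)%N -> color f k ->
  g (inord k) j = 0.
Proof.
move=> tw hf fg kl ck; have /submxP [D e] := color_sub tw hf kl ck.
have := rowE (inord k) g; rewrite e -mulmxA fg mulmx0 => /rowP /(_ j).
by rewrite !mxE.
Qed.

(** The inclusion of the run becomes a homomorphism after composing with [g]: its coloured
    neighbours lie in the image of [f], which [g] kills. *)
Lemma run_false_retract w X Z (f : 'M_(rdim X, rdim (M w))) (g : 'M_(rdim (M w), rdim Z)) p m q :
  thin w -> is_hom X (M w) f -> is_hom (M w) Z g -> row_full g -> f *m g = 0 ->
  (\rank f + \rank g)%N = rdim (M w) ->
  w.2 = p ++ m ++ q -> is_run (color f) p m q false -> retract (M (endv (w.1, p), m)) Z.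
Proof.
move=> tw hf hg fg fg0 rk wE run; have le := seg_le wE.
have fa := fact_hom F wE (run_false_fact tw hf wE run).
have [k hk gk] := ses_factor hg fg fg0 rk fa (run_false_zero wE run).
have [_ r2 r3] := run.
exists (shiftmx F (size p) (size m) (size w.2) *m g), k; split.
  apply: (seg_inc wE hg) => h i; apply: (color_zero i tw hf fg0).
  - by move: le; case: (size p) => //=; lia.
  - by rewrite r2 //; case: (p) h.
  - by rewrite wE; case: (q) h => //= l q' _; rewrite !size_cat /=; lia.
  - by rewrite r3 //; case: (q) h.
by split=> //; rewrite -mulmxA gk shiftmxK.
Qed.

(** Both ends are nonzero, so the colour changes somewhere. The two runs meeting there are retracts
    of the indecomposable ends, hence isomorphic to them, and by dimension they fill the whole
    word. *)
Lemma ses_thin w X Z : thin w -> indecomposable X -> indecomposable Z -> ses X (M w) Z ->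
  exists p l q, w.2 = p ++ l :: q /\
    ((iso X (M (w.1, p)) /\ iso Z (M (ltgt l, q))) \/
     (iso X (M (ltgt l, q)) /\ iso Z (M (w.1, p)))).
Proof.
move=> tw iX iZ [f [g [hf [hg [ff [fg [fg0 rk]]]]]]].
set c := color f; set n := size w.2.
have [[_ [dX _]] [_ [dZ _]]] := (iX, iZ).
have rN : (rdim X + rdim Z)%N = n.+1.
  by move: rk; rewrite (eqP (ff : \rank f == _)) (eqP (fg : \rank g == _)).
have [t tn ct] : exists2 t, (t < n)%N & c t != c t.+1.
  apply: NNPP => nex; have cc t : (t <= n)%N -> c t = c 0%N.
    elim: t => // t IH tn; rewrite -IH ?(ltnW tn) //.
    have [//|ne] := eqVneq (c t.+1) (c t).
    by case: nex; exists t => //; rewrite eq_sym.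
  case c0: (c 0%N) cc => cc.
    have g0 : g = 0.
      apply/matrixP => i j; have il := ltn_ord i; rewrite ltnS in il.
      by rewrite -(inord_val i) (color_zero j tw hf fg0) ?mxE // -/c cc.
    by move: fg dZ; rewrite /row_full g0 mxrank0 => /eqP <-.
  have f0 : f = 0.
    apply/matrixP => i j; have jl := ltn_ord j; rewrite ltnS in jl.
    by rewrite -(inord_val j) color0 ?mxE // -/c cc.
  by move: ff dX; rewrite /row_free f0 mxrank0 => /eqP <-.
have [p1 [m1 [q1 [wE1 t1 run1]]]] := run_at c (ltnW tn : (t <= size w.2)%N).
have [p2 [m2 [q2 [wE2 t2 run2]]]] := run_at c (tn : (t.+1 <= size w.2)%N).
have rR b p m q : w.2 = p ++ m ++ q -> is_run c p m q b ->
    iso (if b then X else Z) (M (endv (w.1, p), m)) /\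
    rdim (if b then X else Z) = (size m).+1.
  move=> wE run; suff r : retract (M (endv (w.1, p), m)) (if b then X else Z).
    have i : iso (if b then X else Z) (M (endv (w.1, p), m)).
      by apply: iso_sym; case: (b) r => r; apply: indec_retract_iso r _.
    by split=> //; rewrite (iso_rdim i).
  case: b run => run; first exact: (run_true_retract tw hf wE ff run).
  exact: (run_false_retract tw hf hg fg fg0 rk wE run).
have [i1 d1] := rR _ _ _ _ wE1 run1; have [i2 d2] := rR _ _ _ _ wE2 run2.
have tE : t = (size p1 + size m1)%N.
  have [lt|] := ltnP t (size p1 + size m1)%N; last by lia.
  have [r _ _] := run1; have le : (t.+1 - size p1 <= size m1)%N by lia.
  have := r _ le; rewrite subnKC; last by lia.
  by move=> e; rewrite e eqxx in ct.
have t2E : t.+1 = size p2.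
  have [lt|] := ltnP (size p2) t.+1; last by lia.
  have [r _ _] := run2; have le : (t - size p2 <= size m2)%N by lia.
  have := r _ le; rewrite subnKC; last by lia.
  by move=> e; rewrite e eqxx in ct.
have dd : ((size m1).+1 + (size m2).+1 = n.+1)%N.
  by rewrite -d1 -d2 -rN; move: ct; case: (c t); case: (c t.+1) => //= _; rewrite addnC.
have n1 : n = (size p1 + size m1 + size q1)%N by rewrite /n wE1 !size_cat addnA.
have n2 : n = (size p2 + size m2 + size q2)%N by rewrite /n wE2 !size_cat addnA.
have p10 : p1 = [::] by apply: size0nil; lia.
have q20 : q2 = [::] by apply: size0nil; lia.
subst p1 q2; rewrite cats0 in wE2; rewrite /= in wE1.
case: q1 n1 wE1 {run1} => [|l q1] n1 wE1; first by move: n1 => /=; lia.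
have [p2E q1E] : rcons m1 l = p2 /\ q1 = m2.
  have : rcons m1 l ++ q1 = p2 ++ m2 by rewrite cat_rcons -wE1.
  move/eqP; rewrite eqseq_cat ?size_rcons; last by rewrite -t2E tE.
  by case/andP => /eqP -> /eqP ->.
exists m1, l, m2; split; first by rewrite wE1 q1E.
rewrite -p2E endv_rcons in i2.
by move: ct i1 i2; case: (c t); case: (c t.+1) => //= _; [left|right].
Qed.
End Ses.

Section Surj.
Variables (F : fieldType) (Q : bquiver).
Implicit Types (w u v : word Q) (X Y Z : rep F Q).
Local Notation M := (Mstr F).

(** The action of [Y] restricted to a basis of the kernel; the homomorphism and the rank equation
    are the input for colouring arguments. *)
Lemma kernel_rep Y Z (g : 'M_(rdim Y, rdim Z)) : is_hom Y Z g ->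
  exists (K : rep F Q) (f : 'M_(rdim K, rdim Y)),
    [/\ is_hom K Y f, f *m g = 0 & (\rank f + \rank g)%N = rdim Y].
Proof.
move=> [g1 g2]; pose i := row_base (kermx g).
have ik : (i <= kermx g)%MS by rewrite eq_row_base.
have ig : i *m g = 0 by apply/sub_kermxP.
exists (@Rep F Q (\rank (kermx g)) (fun k => i *m ridem Y k *m pinvmx i)
  (fun a => i *m ract Y a *m pinvmx i)), i.
have st A B : A *m g = g *m B -> i *m A *m pinvmx i *m i = i *m A.
  move=> AB; apply: mulmxKpV; rewrite eq_row_base; apply/sub_kermxP.
  by rewrite -mulmxA AB mulmxA ig mul0mx.
split=> //; first by split=> k; [apply: st (g1 k) | apply: st (g2 k)].
by rewrite eq_row_base mxrank_ker subnK // rank_leq_row.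
Qed.

(** Colour [w] by the kernel. Some position is uncoloured since [f] is nonzero; its run is a
    quotient string and a retract of the indecomposable [M u], hence isomorphic to it. *)
Lemma surj_fact w u f : thin w -> thin u -> is_module (M u) ->
  is_hom (M w) (M u) f -> row_full f -> exists p m q,
  [/\ w.2 = p ++ m ++ q, isfact p q &
      u = (endv (w.1, p), m) \/ u = winv (endv (w.1, p), m)].
Proof.
move=> tw tu mu hf ff; have [K [i [hi iz rk]]] := kernel_rep hf.
have [t tn ct] : exists2 t, (t <= size w.2)%N & color i t = false.
  apply: NNPP => nex; have fi : f = 0.
    apply/matrixP => a b; have al := ltn_ord a; rewrite ltnS in al.
    rewrite -(inord_val a) (color_zero b tw hi iz) ?mxE //.
    by case ct : (color i a) => //; case: nex; exists a.
  by move: ff; rewrite /row_full fi mxrank0.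
have [p [m [q [wE _ run]]]] := run_at (color i) tn; rewrite ct in run.
exists p, m, q; split=> //; first exact: (run_false_fact tw hi wE run).
have r := run_false_retract tw hi hf ff iz rk wE run.
have tm : thin (endv (w.1, p), m).
  by apply: (@thin_cat _ w.1 p m q); rewrite -wE -surjective_pairing.
apply: Mstr_rigid => //; apply: iso_sym; apply: indec_retract_iso r _ => //.
exact: thin_indec.
Qed.
End Surj.

(** * Torsion classes over Pi(A) and biclosed sets *)

Section Spec.
Variable A : bquiver.
Hypothesis r2 : quadratic A.

Definition spec_letter (l : letter (Pi A)) : letter A :=
  match l.1 with inl a => (a, l.2) | inr a => (a, ~~ l.2) end.
(* The lift of the letter l whose arrow points forward iff c. *)
Definition lift_letter (c : bool) (l : letter A) : letter (Pi A) :=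
  if l.2 == c then (inl l.1, c) else (inr l.1, c).

Lemma lift_letterK c l : spec_letter (lift_letter c l) = l.
Proof. by case: l => a b; rewrite /spec_letter /lift_letter /=; case: eqP => /= [->|] //; case: b; case: c. Qed.
Lemma lift_letter_dir c l : (lift_letter c l).2 = c.
Proof. by rewrite /lift_letter; case: eqP. Qed.
Lemma spec_letterK (l : letter (Pi A)) : lift_letter l.2 (spec_letter l) = l.
Proof. by case: l => [[a|a] []]. Qed.

Lemma ltgt_spec_letter (l : letter (Pi A)) : ltgt (spec_letter l) = ltgt l. Proof. by case: l => [[a|a] []]. Qed.
Lemma lsrc_spec_letter (l : letter (Pi A)) : lsrc (spec_letter l) = lsrc l. Proof. by case: l => [[a|a] []]. Qed.
Lemma spec_letter_inv (l : letter (Pi A)) : spec_letter (linv l) = linv (spec_letter l). Proof. by case: l => [[a|a] []]. Qed.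

Lemma specE (w : word (Pi A)) : spec w = (w.1, [seq spec_letter l | l <- w.2]).
Proof. by []. Qed.

Lemma verts_spec (w : word (Pi A)) : verts (spec w) = verts w.
Proof.
case: w => x s; rewrite specE /verts /= -map_comp.
by congr (_ :: _); apply: eq_map => l /=; apply: ltgt_spec_letter.
Qed.

Lemma endv_spec (w : word (Pi A)) : endv (spec w) = endv w.
Proof. exact: (congr1 (last w.1) (verts_spec w)). Qed.

Lemma walk_spec x (s : seq (letter (Pi A))) : walk x [seq spec_letter l | l <- s] = @walk (Pi A) x s.
Proof. by elim: s x => //= l s IH x; rewrite IH lsrc_spec_letter ltgt_spec_letter. Qed.

Lemma thin_spec (w : word (Pi A)) : thin (spec w) = thin w.
Proof. by rewrite /thin -!/(verts _) verts_spec -walk_spec. Qed.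

Lemma spec_winv (w : word (Pi A)) : spec (winv w) = winv (spec w).
Proof.
rewrite [RHS]/winv endv_spec; case: w => x s; rewrite specE /=; congr (_, _).
by rewrite map_rev -!map_comp; congr rev; apply: eq_map => l /=; apply: spec_letter_inv.
Qed.

Lemma quadratic_Pi : quadratic (Pi A).
Proof.
move=> r; rewrite mem_cat => /orP [] /mapP [r' r'R ->]; have [a [b ->]] := r2 r'R.
  by exists (inl a), (inl b).
by exists (inr b), (inr a).
Qed.

(** A relation of [Pi A] involves two unstarred or two starred arrows, so it specializes to a
    relation of [A] read forward or backward. *)
Lemma okpair_spec_letter (l1 l2 : letter (Pi A)) : okpair (spec_letter l1) (spec_letter l2) -> okpair l1 l2.
Proof.
have R x y : [:: x; y] \in rels (Pi A) -> match x, y with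
    | inl a, inl b => [:: a; b] \in rels A
    | inr b, inr a => [:: a; b] \in rels A | _, _ => false end.
  rewrite mem_cat => /orP [] /mapP [r' r'R]; have [a [b rE]] := r2 r'R; move: r'R; rewrite rE.
    by move=> ab [-> ->].
  by move=> ab [-> ->].
move=> /and3P [o1 o2 o3]; apply/and3P; split.
- apply: contra o1 => /andP [/eqP e]; rewrite /spec_letter e.
  by case: l2 {o2 o3 e} => -[a|a] b /=; rewrite eqxx //; case: b; case: (l1.2).
- apply/negP => /and3P [b1 b2 /R].
  case: l1 l2 b1 b2 o1 o2 o3 => [[a|a] [] // [[b|b] [] //]] _ _ /=.
    by rewrite /spec_letter /= => _ /negP.
  by rewrite /spec_letter /= => _ _ /negP.
apply/negP => /and3P [b1 b2 /R].
case: l1 l2 b1 b2 o1 o2 o3 => [[a|a] [] // [[b|b] [] //]] _ _ /=.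
  by rewrite /spec_letter /= => _ _ /negP.
by rewrite /spec_letter /= => _ /negP.
Qed.

(** Because [okpair] passes from a specialization to its lift, the directions of the letters of a
    lift are free; the constructions below exploit this. *)
Lemma tilde_stringP (w : word (Pi A)) : tilde_string w <-> is_string (spec w).
Proof.
split=> [[]//|s]; split=> //; apply/(is_stringP w quadratic_Pi).
have /(is_stringP _ r2) /andP [ww ss] := s.
apply/andP; split; first by rewrite -walk_spec.
by move: ss; rewrite specE /= sorted_map; apply: sub_sorted => l1 l2; apply: okpair_spec_letter.
Qed.

Lemma tilde_cat x (p m q : seq (letter (Pi A))) : tilde_string (x, p ++ m ++ q) -> tilde_string (endv (x, p), m).
Proof.
move=> /tilde_stringP /(is_stringP _ r2); rewrite specE /= !map_cat => /stringb_cat s.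
apply/tilde_stringP/(is_stringP _ r2); rewrite specE /= -(endv_spec (x, p)); exact: s.
Qed.

Lemma tilde_winv (w : word (Pi A)) : tilde_string w -> tilde_string (winv w).
Proof.
move=> /tilde_stringP /(is_stringP _ r2) s; apply/tilde_stringP/(is_stringP _ r2).
by rewrite spec_winv; apply: stringb_winv.
Qed.

Lemma tilde_walk (w : word (Pi A)) : tilde_string w -> walk w.1 w.2.
Proof. by move=> [/(is_stringP _ quadratic_Pi) /andP []]. Qed.
End Spec.

(** * Torsion classes from biclosed sets, and biclosed sets from torsion classes *)

Section Torsion.
Variables (F : fieldType) (A : bquiver).
Hypotheses (r2 : quadratic A) (thinA : forall w : word A, is_string w -> thin w).
Local Notation M := (Mstr F).

Lemma tilde_thin (w : word (Pi A)) : tilde_string w -> thin w.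
Proof. by move=> /(tilde_stringP r2) /thinA; rewrite thin_spec. Qed.

Lemma tilde_module (w : word (Pi A)) : tilde_string w -> is_module (M w).
Proof. by move=> [s _]; apply: Mstr_module (quadratic_Pi r2) s. Qed.

(** Imposed on all modules over [Pi A], not just on [calM], since a torsion class has to be closed
    under quotients and extensions there. *)
Definition torsion_of (X : word A -> Prop) (N : rep F (Pi A)) :=
  is_module N /\ forall u f, tilde_string u -> is_hom N (M u) f -> row_full f -> X (spec u).

Lemma iso_full (Q : bquiver) (N N' : rep F Q) : iso N N' ->
  exists2 f, is_hom N N' f & row_full f.
Proof.
by move=> [f [g [hf [_ [_ gf]]]]]; exists f => //; apply/row_fullP; exists g.
Qed.

Lemma torsion_of_torsion X : biclosed_set X -> torsion_class (torsion_of X).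
Proof.
move=> [_ [_ [Xc _]]]; split; first by move=> N [].
split.
  move=> N mN N0; split=> // u f _ _ /row_fullP [D e]; exfalso.
  have : (size u.2).+1 = 0%N; last by [].
  by apply: (@mx10_dim F); rewrite -e -[D]mulmx1 (matrix_eq0_dim 1%:M N0) mulmx0 mul0mx.
split.
  move=> N N' [mN tN] mN' /iso_full [g hg fg]; split=> // u f tu hf ff.
  by apply: tN tu (hom_comp hg hf) (row_full_comp fg ff).
split.
  move=> N N' g [mN tN] mN' hg fg; split=> // u f tu hf ff.
  by apply: tN tu (hom_comp hg hf) (row_full_comp fg ff).
move=> N1 N N2 [m1 t1] [m2 t2] mN [f [g [hf [hg [_ [fg [fg0 rk]]]]]]].
split=> // u h tu hh fh.
rewrite (surjective_pairing u) in tu *.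
(* Each run of [u] is a quotient of an end of the extension; closedness of [X] then rejoins the
   runs. *)
apply: (@runs_concat _ (fun v => X (spec v)) u.1 u.2 (color (f *m h))).
  move=> p m q b uE run; have tm := tu; rewrite uE in tm.
  have ts := tilde_cat r2 tm.
  rewrite -surjective_pairing in tu.
  have [k [hk fk]] := ext_run (tilde_thin tu) hf hg fg fg0 rk hh fh uE run.
  by case: b run k hk fk => run k hk fk; [apply: (t1 _ k)|apply: (t2 _ k)].
move=> p l m q uE Xp Xm; have tm := tu; rewrite uE in tm.
have tpm : tilde_string (u.1, p ++ l :: m).
  by apply: (@tilde_cat _ r2 u.1 [::] (p ++ l :: m) q); rewrite /= -catA.
have := Xc (spec (u.1, p)) (spec (ltgt l, m)) (spec_letter l) Xp Xm.
rewrite !specE /= map_cat /=; apply.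
- have e := endv_spec (u.1, p); rewrite specE in e; rewrite e lsrc_spec_letter.
  by have := tilde_walk r2 tpm; rewrite /= walk_cat /= => /and3P [_ /eqP].
- by rewrite ltgt_spec_letter.
- by have [_] := tpm; rewrite specE /= map_cat.
Qed.

Lemma torsion_quot (Q : bquiver) (T : rep F Q -> Prop) (X Y Z : rep F Q) :
  torsion_class T -> ses X Y Z -> T Y -> is_module Z -> T Z.
Proof.
move=> [_ [_ [_ [Tq _]]]] [f [g [_ [hg [_ [fg _]]]]]] TY mZ; exact: (Tq Y Z g).
Qed.

Section FromTorsion.
Variable T : rep F (Pi A) -> Prop.
Hypothesis tT : torsion_class T.

Definition shadow (w : word A) := exists u, [/\ tilde_string u, T (M u) & w = spec u].

Lemma tilde_prefix x p (l : letter (Pi A)) q : tilde_string (x, p ++ l :: q) -> tilde_string (x, p).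
Proof. exact: (@tilde_cat _ r2 x [::] p (l :: q)). Qed.

Lemma tilde_suffix x p (l : letter (Pi A)) q : tilde_string (x, p ++ l :: q) -> tilde_string (ltgt l, q).
Proof.
move=> t; have := @tilde_cat _ r2 x (rcons p l) q [::]; rewrite cats0 cat_rcons endv_rcons.
exact.
Qed.

(** For a concatenation, any lift of the joining letter makes the module an extension of the two
    given ones. Conversely a lift of a concatenation has a lift of one of the two pieces as a
    quotient, so that piece lies in the shadow as well. *)
Lemma shadow_biclosed : biclosed_set shadow.
Proof.
have [Tm [T0 [Ti [Tq Te]]]] := tT.
split; first by move=> w [u [[_ su] _ ->]].
split.
  move=> w [u [tu Tu ->]]; exists (winv u); split; first exact: tilde_winv.
    apply: Ti Tu _ (winv_iso _ (tilde_walk r2 tu)).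
    by apply: tilde_module; apply: tilde_winv.
  by rewrite spec_winv.
split.
  move=> _ _ l [u [tu Tu ->]] [v [tv Tv ->]] e1 e2 sw.
  have tw : tilde_string (u.1, u.2 ++ lift_letter true l :: v.2).
    by apply/(tilde_stringP r2); rewrite specE /= map_cat /= lift_letterK.
  exists (u.1, u.2 ++ lift_letter true l :: v.2); split=> //; last by rewrite !specE /= map_cat /= lift_letterK.
  have := @ses_concat F _ (u.1, u.2 ++ lift_letter true l :: v.2) u.2 (lift_letter true l) v.2 erefl.
  rewrite lift_letter_dir -(ltgt_spec_letter (lift_letter true l)) lift_letterK e2 /= -!surjective_pairing.
  by move=> ss; apply: Te Tv Tu _ ss; apply: tilde_module.
move=> u v l [su nu] [sv nv] e1 e2 sw; split=> // -[w [tw Tw wE]].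
have [x s] : word (Pi A) := w; case: w tw Tw wE => {x s} x s tw Tw [xE sE].
pose p := take (size u.2) s; pose l' := head (lift_letter true l) (drop (size u.2) s).
pose q := drop (size u.2).+1 s.
have ss : size s = (size u.2 + (size v.2).+1)%N.
  by have := congr1 size sE; rewrite size_cat size_map.
have {}sE : u.2 ++ l :: v.2 = [seq spec_letter l | l <- s] by [].
have pE : s = p ++ l' :: q.
  rewrite -{1}(cat_take_drop (size u.2) s) -/p; congr (_ ++ _).
  rewrite /l' /q (drop_nth (lift_letter true l)) //; lia.
have : [seq spec_letter l | l <- p] ++ spec_letter l' :: [seq spec_letter l | l <- q] = u.2 ++ l :: v.2.
  by rewrite sE pE map_cat.
move/eqP; rewrite eqseq_cat; last by rewrite size_map size_takel //; lia.
case/andP => /eqP up; rewrite eqseq_cons => /andP [/eqP ll /eqP vq].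
rewrite pE in tw Tw.
have := @ses_concat F _ (x, p ++ l' :: q) p l' q erefl.
have tp := tilde_prefix tw; have tq := tilde_suffix tw.
case: (l'.2) => ses1.
  apply: nu; exists (x, p); split=> //.
    by apply: torsion_quot tT ses1 Tw _; apply: tilde_module.
  by rewrite specE /= up -xE -surjective_pairing.
apply: nv; exists (ltgt l', q); split=> //.
  by apply: torsion_quot tT ses1 Tw _; apply: tilde_module.
by rewrite specE /= vq -ltgt_spec_letter ll e2 -surjective_pairing.
Qed.
End FromTorsion.
End Torsion.

(** Quotient strings of quotient strings are quotient strings. *)
Lemma isfact_cat (Q : bquiver) (p p' q q' : seq (letter Q)) :
  isfact p q -> isfact p' q' -> isfact (p ++ p') (q' ++ q).
Proof.
rewrite /isfact !map_cat last_cat => /andP [h1 h2] /andP [h3 h4]; apply/andP; split.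
  by case/lastP: p' h3 => [|p' l] //=; rewrite map_rcons !last_rcons.
by case: q' h4.
Qed.

(* s and s' lift the same word; m is a stretch where they agree, a submodule string
   for s and a quotient string for s'. *)
Lemma sink_segment (A : bquiver) (s s' : seq (letter (Pi A))) :
  [seq spec_letter l | l <- s] = [seq spec_letter l | l <- s'] ->
  exists p m q p' q', [/\ s = p ++ m ++ q, s' = p' ++ m ++ q',
    [seq spec_letter l | l <- p] = [seq spec_letter l | l <- p'], issub p q & isfact p' q'].
Proof.
elim: s s' => [|l s IH] [|l' s'] //=; first by exists [::], [::], [::], [::], [::].
move=> [ll /IH [p [m [q [p' [q' [-> -> pp sb fa]]]]]]].
have flip : l'.2 <> l.2 -> l'.2 = ~~ l.2 by case: (l'.2); case: (l.2).
case: p p' pp sb fa => [|x p] [|x' p'] //= pp sb fa; last first.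
  by exists (l :: x :: p), m, q, (l' :: x' :: p'), q'; split=> //=; rewrite ll pp.
have [e|ne] := eqVneq l'.2 l.2.
  have le : l' = l by rewrite -(spec_letterK l') e -ll spec_letterK.
  by exists [::], (l :: m), q, [::], q'; split=> //; rewrite le.
have {}ne := flip (elimN eqP ne).
case lb : l.2 ne => /= ne.
  exists [:: l], m, q, [:: l'], q'; split=> //=; first by rewrite ll.
    by move: sb; rewrite /issub /= lb.
  by move: fa; rewrite /isfact /= ne.
(* Here [l] points back to the start and [l'] away from it, so the first position alone serves as
   the segment. *)
exists [::], [::], (l :: m ++ q), [::], (l' :: m ++ q'); split=> //.
  by rewrite /issub /= lb.
Qed.

Lemma torsion_dsum (F : fieldType) (Q : bquiver) (T : rep F Q -> Prop) X Y :
  torsion_class T -> T X -> T Y -> T (dsum X Y).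
Proof.
move=> [Tm [_ [_ [_ Te]]]] TX TY; apply: (Te X _ Y) => //.
  by apply: module_block; apply: Tm.
have e1 : (row_mx 1%:M 0 : 'M[F]_(rdim X, rdim X + rdim Y)) *m col_mx 1%:M 0 = 1%:M.
  by rewrite mul_row_col mulmx1 mulmx0 addr0.
have e2 : (row_mx 0 1%:M : 'M[F]_(rdim Y, rdim X + rdim Y)) *m col_mx 0 1%:M = 1%:M.
  by rewrite mul_row_col mulmx1 mulmx0 add0r.
have f1 : row_free (row_mx 1%:M 0 : 'M[F]_(rdim X, rdim X + rdim Y)).
  by apply/row_freeP; exists (col_mx 1%:M 0).
have f2 : row_full (col_mx 0 1%:M : 'M[F]_(rdim X + rdim Y, rdim Y)).
  by apply/row_fullP; exists (row_mx 0 1%:M).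
exists (row_mx 1%:M 0), (col_mx 0 1%:M); split; first exact: hom_inl.
split; first exact: hom_prr.
split=> //; split=> //; split; first by rewrite mul_row_col mulmx0 mul0mx addr0.
by rewrite (eqP (f1 : \rank _ == _)) (eqP (f2 : \rank _ == _)).
Qed.

(** * The correspondence between biclosed sets and torsion shadows *)

Section Shadow.
Variables (F : fieldType) (A : bquiver).
Hypotheses (r2 : quadratic A) (thinA : forall w : word A, is_string w -> thin w).
Local Notation M := (Mstr F).

Lemma calM_Mstr (w : word (Pi A)) : tilde_string w -> calM (M w).
Proof.
have md (X : rep F (Pi A)) : (exists w, tilde_string w /\ X = M w) -> is_module X.
  by move=> [u [tu ->]]; apply: tilde_module.
move=> tw; apply/(addP _ md); split; first by apply: md; exists w.
by apply: sums1; exists w.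
Qed.

Section Lift.
Variable X : word A -> Prop.
Hypothesis bX : biclosed_set X.

(* t makes each letter point forward iff the prefix before it is in X. *)
Lemma good_lift x s : exists t : seq (letter (Pi A)), [seq spec_letter l | l <- t] = s /\
  forall p l q, t = p ++ l :: q -> (l.2 <-> X (x, [seq spec_letter l | l <- p])).
Proof.
elim/last_ind: s => [|s l [t [tE tP]]]; first by exists [::]; split=> // -[].
have [c cP] : exists c : bool, c <-> X (x, s).
  by have [h|h] := classic (X (x, s)); [exists true|exists false].
exists (rcons t (lift_letter c l)); split; first by rewrite map_rcons tE lift_letterK.
move=> p l' q; case/lastP: q => [|q r].
  by rewrite cats1 => /eqP; rewrite eqseq_rcons => /andP [/eqP <- /eqP <-]; rewrite lift_letter_dir tE.
by rewrite -rcons_cons -rcons_cat => /eqP; rewrite eqseq_rcons => /andP [/eqP /tP].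
Qed.

(** A letter before the quotient string points back, so the prefix before that letter is not in [X];
    a letter after it points forward, so the prefix ending with the quotient string is in [X]. Were
    the quotient string outside [X], co-closedness would exclude that longer prefix. *)
Lemma good_lift_fact x (t : seq (letter (Pi A))) :
  tilde_string (x, t) -> X (spec (x, t)) ->
  (forall p l q, t = p ++ l :: q -> (l.2 <-> X (x, [seq spec_letter l | l <- p]))) ->
  forall p m q, t = p ++ m ++ q -> isfact p q -> X (spec (endv (x, p), m)).
Proof.
have [Xs [Xi [Xc Xcc]]] := bX.
move=> tt Xt tP p m q tE /andP [hp hq].
have Xpm : X (spec (x, p ++ m)).
  case: q hq tE => [|l q] hq tE; first by rewrite cats0 in tE; rewrite -tE.
  by have := tP (p ++ m) l q; rewrite -catA => /(_ tE) <-.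
case/lastP: p hp tE Xpm => [|p l] hp tE Xpm //.
rewrite map_rcons last_rcons in hp.
rewrite cat_rcons in tE; have := tP _ _ _ tE; rewrite (negbTE hp) => -[_ nXp].
rewrite cat_rcons in Xpm; apply: NNPP => nXm.
have tpm : tilde_string (x, p ++ l :: m).
  by apply: (@tilde_cat _ r2 x [::] (p ++ l :: m) q); rewrite /= -catA /= -tE.
have str1 : is_string (spec (x, p)) by have [] := tilde_prefix r2 tpm.
have str2 : is_string (spec (endv (x, rcons p l), m)).
  by rewrite endv_rcons; have [] := tilde_suffix r2 tpm.
have [|||||_] := Xcc (spec (x, p)) (spec (endv (x, rcons p l), m)) (spec_letter l).
- by split=> // Xp; have := nXp Xp.
- by [].
- rewrite endv_spec lsrc_spec_letter.
  by have := tilde_walk r2 tpm; rewrite /= walk_cat /= => /and3P [_ /eqP].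
- by rewrite ltgt_spec_letter endv_rcons.
- by have [_] := tpm; rewrite !specE /= map_cat.
by apply; move: Xpm; rewrite !specE /= map_cat.
Qed.

(** By [surj_fact] the string quotients of [M w] are its quotient segments up to inversion, under
    which [X] is stable. *)
Lemma torsion_of_string (w : word (Pi A)) : tilde_string w ->
  (forall p m q, w.2 = p ++ m ++ q -> isfact p q -> X (spec (endv (w.1, p), m))) ->
  torsion_of X (M w).
Proof.
move=> tw Xf; split; first exact: tilde_module.
move=> u f tu hf ff; have [p [m [q [wE fa uE]]]] :=
  surj_fact (tilde_thin r2 thinA tw) (tilde_thin r2 thinA tu) (tilde_module F r2 tu) hf ff.
have Xm := Xf _ _ _ wE fa; case: uE => ->; first exact: Xm.
by rewrite spec_winv; have [_ [Xi _]] := bX; apply: Xi.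
Qed.

Lemma torsion_of_self (w : word (Pi A)) : tilde_string w -> torsion_of X (M w) -> X (spec w).
Proof.
move=> tw [_ /(_ w 1%:M tw (hom_id _))]; apply.
by rewrite row_full_unit unitmx1.
Qed.

Lemma lift_torsion_of w : X w -> exists u, [/\ tilde_string u, spec u = w & torsion_of X (M u)].
Proof.
case: w => x s Xw; have [t [tE tP]] := good_lift x s.
have tt : tilde_string (x, t).
  by apply/(tilde_stringP r2); rewrite specE /= tE; have [Xs _] := bX; apply: Xs.
exists (x, t); split=> //; first by rewrite specE /= tE.
apply: torsion_of_string => // p m q; apply: good_lift_fact => //.
by rewrite specE /= tE.
Qed.

Definition Phi (N : rep F (Pi A)) := calM N /\ torsion_of X N.

Lemma Phi_torshad : torshad Phi.
Proof.
exists (torsion_of X); split; first exact: torsion_of_torsion.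
by move=> N; split=> -[].
Qed.
End Lift.

Lemma Phi_le X Y : biclosed_set X -> biclosed_set Y ->
  (forall w, X w -> Y w) <-> (forall N, Phi X N -> Phi Y N).
Proof.
move=> bX bY; split=> [XY N [cN [mN sN]]|XY w /(lift_torsion_of bX) [u [tu <- su]]].
  by split=> //; split=> // u f tu hf ff; apply: XY; apply: sN hf ff.
by apply: torsion_of_self => //; have [|_] := XY (M u) => //; split=> //; apply: calM_Mstr.
Qed.

Section FromTorsion.
Variable T : rep F (Pi A) -> Prop.
Hypothesis tT : torsion_class T.

Lemma torsion_string (w : word (Pi A)) : tilde_string w ->
  (forall p m q, w.2 = p ++ m ++ q -> isfact p q -> shadow T (spec (endv (w.1, p), m))) ->
  T (M w).
Proof.
have [Tm [T0 [Ti [Tq Te]]]] := tT.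
have [n] := ubnP (size w.2); elim: n w => // n IH [x s] /= le tw fw.
have [w' [tw' Tw' wE]] : shadow T (spec (x, s)).
  by apply: (fw [::] s [::]); rewrite ?cats0.
case: w' tw' Tw' wE => x' s' tw' Tw' [xE sE]; rewrite -xE in tw' Tw'.
have [p [m [q [p' [q' [E E' pp sb fa]]]]]] := sink_segment (sE : map (@spec_letter A) s = map (@spec_letter A) s').
have ee : endv (x, p) = endv (x, p').
  by rewrite -(endv_spec (x, p)) -(endv_spec (x, p')) !specE /= pp.
(* A shorter quotient string inherits the hypothesis by [isfact_cat], so the induction applies to
   it. *)
have IHfact p1 m1 q1 : s = p1 ++ m1 ++ q1 -> isfact p1 q1 -> (size m1 < size s)%N ->
    T (M (endv (x, p1), m1)).
  move=> sE1 fa1 lt; apply: IH => /=; first by lia.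
    by apply: (@tilde_cat _ r2 x p1 m1 q1); rewrite -sE1.
  move=> p2 m2 q2 mE fa2; rewrite -endv_cat; apply: (fw _ _ (q2 ++ q1)).
    by rewrite sE1 mE -!catA.
  exact: isfact_cat.
have Tmid : T (M (endv (x, p), m)).
  rewrite ee; have := @fact_hom F _ (x, s') _ _ _ E' fa => /= hf.
  apply: Tq Tw' _ hf _; last by apply: full_shiftmxT; apply: (@seg_le _ (x, s') p' m q').
  by apply: tilde_module => //; apply: (@tilde_cat _ r2 x p' m q'); rewrite -E'.
have twE := tw; rewrite E in twE.
have tmq : tilde_string (endv (x, p), m ++ q).
  by apply: (@tilde_cat _ r2 x p (m ++ q) [::]); rewrite cats0.
case/andP: sb => hp hq.
(* The letter after [m] points back to it, so the segment is a submodule here, and the quotient is a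
   shorter quotient string of the whole word. *)
have Tmq : T (M (endv (x, p), m ++ q)).
  case: q hq E tmq {twE} => [|l q] hq E tmq; first by rewrite cats0.
  have := @ses_concat F _ (endv (x, p), m ++ l :: q) m l q erefl.
  rewrite /= in hq; rewrite (negbTE hq); apply: Te => //; last exact: tilde_module.
  have Eq : s = (rcons (p ++ m) l) ++ q ++ [::] by rewrite cats0 cat_rcons -catA.
  have := IHfact _ _ _ Eq; rewrite endv_rcons; apply.
    by rewrite /isfact map_rcons last_rcons hq.
  by rewrite E !size_cat /=; lia.
(* The same on the left, with [m ++ q] as the submodule. If [p] is empty, [m ++ q] is already the
   whole word. *)
case/lastP: p hp E Tmq {pp ee IH Tmid twE tmq} => [|p l] hp E Tmq; first by rewrite /= in E; rewrite E.
rewrite map_rcons last_rcons in hp; rewrite cat_rcons in E.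
rewrite endv_rcons in Tmq.
have := @ses_concat F _ (x, s) p l (m ++ q) E.
rewrite hp; apply: Te => //; last exact: tilde_module.
apply: (IHfact [::] p (l :: m ++ q)) => //.
by rewrite E size_cat /=; lia.
Qed.

(** For the converse, [N] is decomposed into indecomposables, which are string modules by
    Krull-Schmidt; their string quotients are quotients of [N], so [torsion_string] applies to
    each. *)
Lemma torsion_calM N : calM N -> T N <-> torsion_of (shadow T) N.
Proof.
have [Tm [T0 [Ti [Tq Te]]]] := tT.
have md (X : rep F (Pi A)) : (exists w, tilde_string w /\ X = M w) -> is_module X.
  by move=> [u [tu ->]]; apply: tilde_module.
move=> /(addP _ md) [mN [L sL rL]]; split=> [TN|sN].
  split=> // u f tu hf ff; exists u; split=> //.
  by apply: Tq TN _ hf ff; apply: tilde_module.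
apply: decomp_ind => //; first by move=> X Y mY TX iXY; apply: (Ti X).
  by move=> X Y; apply: torsion_dsum.
move=> X iX rX; have [_ [w [tw ->]] rXw] := krull_schmidt iX sL (retract_trans rX rL).
have iw : indecomposable (M w) by apply: thin_indec (tilde_thin r2 thinA tw) (tilde_module F r2 tw).
have [mX [dX _]] := iX; have isoX := indec_retract_iso iw rXw dX.
apply: Ti _ mX (iso_sym isoX).
have [h hh fh] : exists2 h, is_hom N (M w) h & row_full h.
  have [i [p [_ [hp ip]]]] := rX; have [g hg fg] := iso_full isoX.
  exists (p *m g); first exact: hom_comp hp hg.
  by apply: row_full_comp fg; apply/row_fullP; exists i.
have [_ sN2] := sN; apply: (torsion_string (tw)) => p m q wE fa.
apply: (sN2 (endv (w.1, p), m) (h *m (shiftmx F (size p) (size m) (size w.2))^T)).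
- by apply: (@tilde_cat _ r2 w.1 p m q); rewrite -wE -surjective_pairing.
- exact: hom_comp hh (fact_hom F wE fa).
- by apply: row_full_comp fh _; apply: full_shiftmxT; apply: seg_le wE.
Qed.
End FromTorsion.

Lemma torshad_Phi S : torshad S ->
  exists2 X, biclosed_set X & forall N, S N <-> Phi X N.
Proof.
move=> [T [tT ST]]; exists (shadow T); first exact: shadow_biclosed.
move=> N; rewrite ST; split=> [[TN cN]|[cN sN]]; split=> //; exact/(torsion_calM tT cN).
Qed.

Definition addX (X : word A -> Prop) : rep F A -> Prop :=
  Defs.add (fun N => exists w, X w /\ N = M w).

Lemma add_iff (Q : bquiver) (S S' : rep F Q -> Prop) : (forall N, S N <-> S' N) ->
  forall N, Defs.add S N <-> Defs.add S' N.
Proof.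
move=> SS N; have ss L (S1 S2 : rep F Q -> Prop) : (forall N, S1 N -> S2 N) -> sums S1 L -> sums S2 L.
  move=> S12; elim=> [Z mZ Z0|Z Y SZ _ sY]; first exact: sums0.
  by apply: sumsS => //; apply: S12.
by split=> -[mN [K [L [mK [sL iL]]]]]; split=> //; exists K, L; split=> //; split=> //;
  apply: ss sL => Y /SS.
Qed.

(** A module [M u] in the shadow puts [spec u] in [X] through its identity map; conversely
    [lift_torsion_of] supplies a lift for every element of [X]. *)
Lemma frakT_Phi X S : biclosed_set X -> (forall N, S N <-> Phi X N) ->
  forall N, frakT S N <-> addX X N.
Proof.
move=> bX SX; apply: add_iff => N; split.
  move=> [u [tu [/SX [_ su] ->]]]; exists (spec u); split=> //; exact: torsion_of_self.
move=> [w [/(lift_torsion_of bX) [u [tu uE su]] ->]]; exists u; split=> //; split; last by rewrite uE.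
by apply/SX; split=> //; apply: calM_Mstr.
Qed.
End Shadow.

(** * Strings of brick gentle algebras have distinct vertices *)

Section Brick.
Variables (F : fieldType) (Q : bquiver).
Hypothesis r2 : quadratic Q.
Hypothesis brick : forall X : rep F Q, indecomposable X -> end_division X.
Implicit Types (w u v : word Q) (s p m q : seq (letter Q)) (l : letter Q).
Local Notation M := (Mstr F).

(* The nilpotent endomorphism is M(w) -> M(s1) -> M(s2) -> M(w).  The arrow z acts
   through a single matrix unit, which forces any endomorphism of M(w) to be a
   scalar plus a square-zero map, so M(w) is indecomposable. *)
Lemma nonbrick w s1 z s2 (h : 'M_(rdim (M (w.1, s1)), rdim (M (tgt z, s2)))) :
  stringb w -> w.2 = s1 ++ (z, true) :: s2 ->
  thin (w.1, s1) -> thin (tgt z, s2) ->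
  z \notin arrows (w.1, s1) -> z \notin arrows (tgt z, s2) ->
  is_hom (M (w.1, s1)) (M (tgt z, s2)) h -> h != 0 ->
  (forall g, is_hom (M (tgt z, s2)) (M (w.1, s1)) g -> g ord0 ord0 = 0 -> g = 0) -> False.
Proof.
move=> sw wE tL tR zL zR hh h0 g0.
set n := size w.2; set d := size s1.
have nE : n = (d + size s2).+1 by rewrite /n wE size_cat /= addnS.
have wE1 : w.2 = [::] ++ s1 ++ (z, true) :: s2 by [].
have wE2 : w.2 = rcons s1 (z, true) ++ s2 ++ [::] by rewrite cats0 cat_rcons.
set iL := shiftmx F 0 d n; set iR := shiftmx F d.+1 (size s2) n.
have lL : (0 + d <= n)%N by rewrite nE; lia.
have lR : (d.+1 + size s2 <= n)%N by rewrite nE; lia.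
have hL : is_hom (M w) (M (w.1, s1)) iL^T by apply: (fact_hom F wE1).
have hR : is_hom (M (tgt z, s2)) (M w) iR.
  have := @sub_hom F _ w _ _ _ wE2; rewrite endv_rcons size_rcons; apply.
  by rewrite /issub map_rcons last_rcons.
have LL : iL *m iL^T = 1%:M by apply: shiftmxK.
have RR : iR *m iR^T = 1%:M by apply: shiftmxK.
have RL : iR *m iL^T = 0 by apply: shiftmx_disj => //; rewrite ltnS leqnn orbT.
have LR : iL *m iR^T = 0 by apply: shiftmx_disj => //; rewrite ltnS leqnn.
have one : iL^T *m iL + iR^T *m iR = 1%:M.
  have u1 : row_mx iL^T iR^T *m col_mx iL iR = iL^T *m iL + iR^T *m iR by rewrite mul_row_col.
  have u2 : col_mx iL iR *m row_mx iL^T iR^T = 1%:M.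
    by rewrite mul_col_row LL RR LR RL -scalar_mx_block.
  rewrite -u1; have e : (d.+1 + (size s2).+1)%N = n.+1 by rewrite nE addSn addnS.
  move: (row_mx _ _) (col_mx _ _) u2 {u1}; rewrite e => a b ba; exact: mulmx1C ba.
have inR r (A B : 'M[F]_(r, _)) : A *m iR = B *m iR -> A = B.
  by move=> e; rewrite -[A]mulmx1 -[B]mulmx1 -RR !mulmxA e.
have inL r (A B : 'M[F]_(_, r)) : iL^T *m A = iL^T *m B -> A = B.
  by move=> e; rewrite -[A]mul1mx -[B]mul1mx -LL -!mulmxA e.
have actz : ract (M w) z = delta_mx (inord d) (inord d.+1) :> 'M_n.+1.
  have od k b : onth w.2 k = Some (z, b) -> k = d /\ b = true.
    rewrite wE onth_cat -/d; case: ltnP => [_|dk].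
      by move=> e; case/negP: zL; apply/mapP; exists (z, b) => //; apply/onthP; exists k.
    case kd : (k - d)%N => [|k'] /=; first by case=> <-; split=> //; lia.
    by move=> e; case/negP: zR; apply/mapP; exists (z, b) => //; apply/onthP; exists k'.
  have odd : onth w.2 d = Some (z, true) by rewrite wE onth_mid.
  apply/matrixP => i j; rewrite ract_MstrE mxE -!val_eqE /= !inordK; [|lia|lia].
  congr (_%:R); congr nat_of_bool; rewrite /step.
  apply/orP/andP => [[] /andP [/eqP ij /eqP /od [e b]]|[/eqP -> /eqP ->]] //.
    by rewrite ij e.
  by left; rewrite eqxx odd eqxx.
have indw : indecomposable (M w).
  apply/indecomposableP; split=> //; first by apply: Mstr_module => //; apply/(is_stringP w r2).
  move=> f hf ff.
  have fd (q : 'I_n.+1) : f (inord d.+1) q = if q == inord d.+1 then f (inord d) (inord d) else 0.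
    have [_ /(_ z)] := hf; rewrite actz => /matrixP /(_ (inord d) q).
    by rewrite mul_deltaE mulr_deltaE eqxx.
  (* The corner entry of the component from the submodule to the quotient is the entry of [f] at
     [d + 1] and [0], which vanishes by [fd]; so [f] is block triangular. *)
  have g00 : iR *m f *m iL^T = 0.
    apply: g0; first exact: hom_comp (hom_comp hR hf) hL.
    rewrite shiftmxrE // shiftmxE // addn0 fd; case: eqP => // e.
    by have := congr1 (@nat_of_ord n.+1) e; rewrite addn0 !inordK //; lia.
  have fR : iR *m f = iR *m f *m iR^T *m iR.
    by rewrite -[LHS]mulmx1 -one mulmxDr !mulmxA g00 mul0mx add0r.
  have fL : f *m iL^T = iL^T *m (iL *m f *m iL^T).
    rewrite -[LHS]mul1mx -one mulmxDl -!mulmxA (mulmxA iR) g00 mulmx0 addr0.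
    by rewrite !mulmxA.
  set f1 := iL *m f *m iL^T in fL; set f2 := iR *m f *m iR^T in fR.
  have h1 : is_hom (M (w.1, s1)) (M (w.1, s1)) f1.
    have [a1 a2] := hf; have [b1 b2] := hL; clearbody f1; split=> k; apply: inL.
      by rewrite mulmxA -b1 -mulmxA -fL mulmxA a1 -mulmxA b1 mulmxA fL mulmxA.
    by rewrite mulmxA -b2 -mulmxA -fL mulmxA a2 -mulmxA b2 mulmxA fL mulmxA.
  have h2 : is_hom (M (tgt z, s2)) (M (tgt z, s2)) f2.
    have [a1 a2] := hf; have [b1 b2] := hR; clearbody f2; split=> k; apply: inR.
      by rewrite -mulmxA -fR mulmxA b1 -mulmxA a1 mulmxA fR -mulmxA -b1 mulmxA.
    by rewrite -mulmxA -fR mulmxA b2 -mulmxA a2 mulmxA fR -mulmxA -b2 mulmxA.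
  have e1 := thin_end_scalar tL h1; have e2 := thin_end_scalar tR h2.
  set c1 := f1 _ _ in e1; set c2 := f2 _ _ in e2.
  (* The positions [d] and [d + 1], last of the first block and first of the second, are linked by
     [z]. *)
  have c12 : c1 = c2.
    have : f1 ord_max ord_max = f2 ord0 ord0.
      rewrite !shiftmxrE // !shiftmxE // addn0 add0n fd eqxx //.
    by rewrite {1}e1 {1}e2 !mxE !eqxx !mulr1n.
  rewrite -c12 in e2; rewrite {}e1 mul_mx_scalar in fL; rewrite {}e2 mul_scalar_mx in fR.
  set c := c1 in fL fR.
  (* [nn] kills the submodule and takes its values in it, so its square is zero. *)
  pose nn := f - c%:M.
  have Rn : iR *m nn = 0 by rewrite mulmxBr fR mul_mx_scalar subrr.
  have nL : nn *m iL^T = 0 by rewrite mulmxBl fL mul_scalar_mx subrr.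
  have fE : f = c%:M + nn by rewrite addrC subrK.
  clearbody nn.
  have n2 : nn *m nn = 0.
    have -> : nn *m nn = nn *m (iL^T *m iL + iR^T *m iR) *m nn by rewrite one mulmx1.
    by rewrite mulmxDr !mulmxA nL mul0mx add0r -mulmxA Rn mulmx0.
  have cc : c * c = c.
    have : (c * c) *: iR = c *: iR by rewrite -scalerA -fR scalemxAl -fR -mulmxA ff.
    move/(congr1 (fun A => (A *m iR^T) ord0 ord0)); rewrite -!scalemxAl RR !mxE eqxx.
    by rewrite !mulr1.
  have [c0|c0] := eqVneq c 0.
    by left; rewrite -ff fE c0 raddf0 add0r n2.
  have c1' : c = 1 by apply: (mulfI c0); rewrite cc mulr1.
  right; move: ff; rewrite fE c1' mulmxDl !mulmxDr !mul1mx mulmx1 n2 addr0.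
  move=> e; have -> : nn = 0 by apply: (addrI (1%:M + nn)); rewrite addr0.
  by rewrite addr0.
have := brick indw; pose e := iL^T *m h *m iR.
have he : is_hom (M w) (M w) e := hom_comp (hom_comp hL hh) hR.
have ee : e *m e = 0.
  by rewrite /e !mulmxA -(mulmxA _ iR) RL mulmx0 !mul0mx.
have en : e != 0.
  apply: contra h0 => /eqP e0; have : iL *m e *m iR^T = h.
    by rewrite /e !mulmxA LL mul1mx -mulmxA RR mulmx1.
  by rewrite e0 mulmx0 mul0mx => <-.
move=> /(_ e he en) [g [_ [eg _]]]; case/eqP: en.
by rewrite -[e]mulmx1 -eg mulmxA ee mul0mx.
Qed.
End Brick.

Section BrickThin.
Variables (F : fieldType) (Q : bquiver).
Hypothesis r2 : quadratic Q.
Hypothesis brick : forall X : rep F Q, indecomposable X -> end_division X.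
Implicit Types (w u v : word Q) (s p m q : seq (letter Q)) (l : letter Q).
Local Notation M := (Mstr F).

(** [M(s)] is both the quotient and the submodule in [nonbrick], and [h] is the identity;
    endomorphisms of the thin [M(s)] are scalars, hence determined by the corner entry. *)
Lemma no_return_direct y s l : l.2 -> ltgt l = y -> stringb (y, s ++ l :: s) -> thin (y, s) ->
  l.1 \notin arrows (y, s) -> False.
Proof.
case: l => z b /= bt; rewrite bt => <- st ts zn.
apply: (@nonbrick F Q r2 brick (tgt z, s ++ (z, true) :: s) s z s 1%:M) => //.
- exact: hom_id.
- by apply/eqP => /mx10_dim.
by move=> g hg g0; rewrite (thin_end_scalar ts hg) g0 raddf0.
Qed.

Lemma no_return_band y s l : ltgt l = y -> stringb (y, s ++ l :: s) -> thin (y, s) ->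
  l.1 \notin arrows (y, s) -> False.
Proof.
move=> ly st ts ln; case lb : l.2; first exact: no_return_direct lb ly st ts ln.
have ww : walk y (s ++ l :: s) by have /andP [] := st.
have yE : lsrc l = endv (y, s) by move: ww; rewrite walk_cat /= => /and3P [_ /eqP <-].
have eE : endv (y, s ++ l :: s) = endv (y, s) by rewrite -cat_rcons endv_cat endv_rcons ly.
have := stringb_winv st; rewrite winv_cat // ly eE => st'.
apply: (@no_return_direct (endv (y, s)) (winv (y, s)).2 (linv l)) => //.
- by rewrite /= lb.
- by rewrite ltgt_inv.
- by have := thin_winv ts.
- by apply: contra ln; rewrite /arrows /= map_rev mem_rev -map_comp.
Qed.

(** [l1] points away from the start, so [M(l1 s)] has the simple module at [x] as a quotient, and
    [h] is this projection; the last position spans the same simple module. A map back lands in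
    position [0], the only one at vertex [x]. *)
Lemma no_return_path x l1 s l : l1.2 -> l.2 -> ltgt l = x -> stringb (x, rcons (l1 :: s) l) ->
  thin (x, l1 :: s) -> l.1 \notin arrows (x, l1 :: s) -> False.
Proof.
case: l => z b /= b1 bt; rewrite bt => <- st ts zn; set x0 := ltgt _ in st ts zn.
have E1 : (x0, l1 :: s).2 = [::] ++ [::] ++ (l1 :: s) by [].
have fa : isfact [::] (l1 :: s) by rewrite /isfact /= b1.
have hf := fact_hom F E1 fa.
apply: (@nonbrick F Q r2 brick (x0, rcons (l1 :: s) (z, true)) (l1 :: s) z [::] _ st _ ts _ zn _ hf).
- by rewrite -cats1.
- by [].
- by [].
- apply/eqP => e; have := full_shiftmxT F (seg_le E1).
  by rewrite /row_full e mxrank0.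
move=> g [hg _] g0; apply/matrixP => i j.
have /matrixP /(_ i j) := hg x0; rewrite mul_ridemE mulr_ridemE.
have i0 : i = ord0 by apply/val_inj; case: i => -[].
rewrite i0 vtx0 eqxx mxE => ->; case: eqP => // e.
suff -> : j = ord0 by [].
apply/val_inj => /=; apply: (thin_inj ts) => //.
by have := ltn_ord j; rewrite ltnS.
Qed.

(* A shortest closed string is s followed by l.  If l can be followed by the first
   letter of s, then s l s is a string with s as both a quotient and a submodule
   string; otherwise l and the first letter point in the same direction, and the
   base point of s l plays this role. *)
Lemma string_thin w : stringb w -> thin w.
Proof.
move=> sw; apply: NNPP => nt.
(* Take a suffix that is not thin while its tail is: its starting vertex recurs, and the word is cut
   at the first return. *)
have [x [s0 [l [st lx un]]]] : exists x s l, [/\ stringb (x, rcons s l), ltgt l = x &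
    uniq [seq ltgt l | l <- rcons s l]].
  case: w sw nt => x s; elim: s x => [|l s IH] x sw nt.
    by case: nt; rewrite /thin.
  have sw' : stringb (ltgt l, s).
    by have := @stringb_cat _ x [:: l] s [::]; rewrite cats0; apply.
  have [ts|nts] := classic (thin (ltgt l, s)); last exact: IH sw' nts.
  have /andP [ws us] := ts.
  have xin : x \in [seq ltgt l | l <- l :: s].
    have /andP [wls _] := sw; apply: NNPP => next_arrow; case: nt.
    by rewrite /thin wls /= -/(x \notin _) (negbTE (introN idP next_arrow)) /=.
  set r := [seq _ | _ <- _] in xin; set k := index x r.
  have kl : (k < size (l :: s))%N by rewrite -(size_map (@ltgt Q)) index_mem.
  exists x, (take k (l :: s)), (nth l (l :: s) k); rewrite -take_nth //; split.
  - by apply: (@stringb_cat _ x [::] _ (drop k.+1 (l :: s))); rewrite /= cat_take_drop.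
  - by rewrite -(nth_map l x (@ltgt Q)) // nth_index.
  by rewrite map_take; apply: take_uniq.
have /andP [wx sx] := st.
move: wx; rewrite -cats1 walk_cat => /andP [/= ws0 /andP [/eqP le _]].
have ts0 : thin (x, s0).
  apply/andP; split=> //; rewrite -lx; move: un; rewrite map_rcons rcons_uniq => /andP [a b].
  by rewrite /= a.
(* The arrow of [l] would touch both ends of the thin [s0], so [s0] would consist of one letter with
   that arrow. The opposite sign is excluded by [okpair], the same sign by the distinctness of the
   targets. *)
have ln : l.1 \notin arrows (x, s0).
  apply/negP => /mapP [r /onthP [j sj] e].
  have jl := onth_lt sj; rewrite /= in sj jl.
  have inc i : vtx (x, s0) i = lsrc l \/ vtx (x, s0) i = ltgt l ->
      (lsrc r == vtx (x, s0) i) || (ltgt r == vtx (x, s0) i).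
    rewrite /lsrc /ltgt -e; case: (r.2); case: (l.2); case=> ->; by rewrite eqxx ?orbT.
  have [j0|//] := thin_incident ts0 sj (leq0n _) (inc 0%N (or_intror (esym lx))).
  have end0 : vtx (x, s0) (size s0) = lsrc l by rewrite -le -(vtx_last (x, s0)).
  have := thin_incident ts0 sj (leqnn _) (inc _ (or_introl end0)); rewrite -j0 /=.
  case=> [s00|s01]; first by rewrite s00 in jl.
  case: s0 s01 {sx jl inc end0} st ws0 le ts0 sj un => [|l1 [|]] //= _ st ws0 le ts0.
  rewrite -j0 => -[re] un; subst r.
  have /andP [_] := st; rewrite /= andbT => /and3P [/negP o _ _].
  have bb : l1.2 = l.2 by apply/eqP/negPn/negP => ne; apply: o; rewrite e eqxx.
  have le1 : l1 = l by rewrite (surjective_pairing l1) bb -e -surjective_pairing.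
  by move: un; rewrite le1 inE eqxx.
have ls : lsrc l = endv (x, s0) by rewrite -le.
have [ok|nok] := boolP ((s0 == [::]) || okpair l (head l s0)).
  apply: (no_return_band lx _ ts0 ln); apply/andP; split.
    by rewrite /= walk_cat ws0 /= le eqxx lx.
  rewrite -cat_rcons /=; move: sx => /=; case: s0 ok {st ws0 le ts0 ln un ls} => [|l1 s] //= ok.
  by rewrite cat_path last_rcons => p; rewrite p /= ok; move: p; rewrite rcons_path => /andP [].
case: s0 nok st sx un ws0 le ts0 ln ls => [|l1 s] //= nok st sx un ws0 le ts0 ln ls.
have l1n : l.1 != l1.1 by move: ln; rewrite inE negb_or => /andP [].
(* For distinct arrows [okpair] can only fail between letters of equal direction. *)
have [b1 b2] : l1.2 = l.2 /\ True.
  split=> //; move: nok; rewrite /okpair (negbTE l1n) /=.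
  by case: (l.2); case: (l1.2).
case lb : l.2 in b1; first exact: no_return_path b1 lb lx st ts0 ln.
(* Both letters point backward: pass to the inverse closed word. *)
have wn := stringb_winv st.
have wE : winv (x, rcons (l1 :: s) l) =
    (x, rcons (linv l :: (winv (ltgt l1, s)).2) (linv l1)).
  rewrite /winv -cats1 endv_cat /= {1}/endv /= lx; congr (_, _).
  by rewrite map_cat rev_cons rev_cat.
have tl : thin (ltgt l1, rcons s l).
  apply/andP; split; last by [].
  by move: (andP st).1 => /= /andP [].
rewrite wE in wn.
apply: (no_return_path (l1 := linv l) (l := linv l1) _ _ _ wn) => //=.
- by rewrite lb.
- by rewrite b1.
- by rewrite ltgt_inv; case/andP: ws0 => /eqP.
- have := thin_winv tl; rewrite /winv -cats1 endv_cat /= {1}/endv /= lx.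
  by rewrite map_cat rev_cat /=.
- rewrite inE negb_or eq_sym l1n /=.
  change (l1.1 \notin [seq l0.1 | l0 <- rev [seq (l0.1, ~~ l0.2) | l0 <- s]]).
  rewrite map_rev mem_rev -map_comp.
  apply/negP => /mapP [r rs e]; have /onthP [j sj] := rs.
  have o0 : onth (x, l1 :: s).2 0 = Some (l1.1, l1.2) by rewrite /= -surjective_pairing.
  have oj : onth (x, l1 :: s).2 j.+1 = Some (l1.1, r.2) by have e1 : l1.1 = r.1 := e; rewrite /= sj e1 -surjective_pairing.
  by have := thin_arrow ts0 o0 oj.
Qed.
End BrickThin.

(** * Classification of the indecomposable modules *)

Section Gentle.
Variable Q : bquiver.
Hypothesis gQ : gentle Q.

Lemma gentle_quadratic : quadratic Q.
Proof. by have [_ [_ [_ [g _]]]] := gQ; move=> r /g [a [b [-> _]]]; exists a, b. Qed.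

(* The letters leaving a vertex fall into two sides; letters that can be joined
   through the vertex lie on different sides. *)
Definition no_triple := forall p q r : letter Q,
  lsrc p = lsrc q -> lsrc p = lsrc r ->
  okpair (linv p) q -> okpair (linv p) r -> okpair (linv q) r -> False.

Lemma set3_le2 (T : finType) (A : {set T}) x y z : (#|A| <= 2)%N ->
  x \in A -> y \in A -> z \in A -> x != y -> x != z -> y != z -> False.
Proof.
move=> A2 xA yA zA xy xz yz; suff : (3 <= #|A|)%N by lia.
rewrite (cardD1 x) xA (cardD1 y) !inE eq_sym xy yA (cardD1 z) !inE.
by rewrite ![z == _]eq_sym xz yz zA.
Qed.

(** Three letters of one direction would be three distinct arrows out of, or into, a vertex. With
    mixed directions, two distinct arrows would both have a nonzero composition with the third on
    the same side. *)
Lemma gentle_no_triple : no_triple.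
Proof.
have [_ [_ [_ [_ [gc [gb [ga _]]]]]]] := gQ.
move=> [a b] [a' b'] [a'' b'']; rewrite /okpair /lsrc /=.
case: b; case: b'; case: b'' => /= e1 e2; rewrite ?andbT ?andbF /= ?andbT.
- move=> n1 n2 n3; apply: (@set3_le2 _ [set c | src c == src a] a a' a'') => //.
  + by have [_] := gc (src a).
  + by rewrite inE.
  + by rewrite inE e1.
  + by rewrite inE e2.
- by move=> n1 n2 n3; case/eqP: n1; apply: (ga a'') => //; rewrite -?e1 -?e2.
- by move=> n1 n2 n3; case/eqP: n2; apply: (ga a') => //; rewrite -?e2 -?e1.
- by move=> n1 n2 n3; case/eqP: n3; apply: (gb a) => //; rewrite -?e1 -?e2.
- by move=> n1 n2 n3; case/eqP: n3; apply: (ga a) => //; rewrite -?e1 -?e2.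
- by move=> n1 n2 n3; case/eqP: n2; apply: (gb a') => //; rewrite -?e2 -?e1.
- by move=> n1 n2 n3; case/eqP: n1; apply: (gb a'') => //; rewrite -?e1 -?e2.
move=> n1 n2 n3; apply: (@set3_le2 _ [set c | tgt c == tgt a] a a' a'') => //.
+ by have [] := gc (tgt a).
+ by rewrite inE.
+ by rewrite inE e1.
+ by rewrite inE e2.
Qed.
End Gentle.

(* For eps = true, X consists of row vectors and families describe the images of the
   basis vectors under maps M(w) -> M; for eps = false, X consists of column vectors
   and families describe the coordinates of maps M -> M(w), so all arrows act
   backwards. *)
Section Families.
Variable Q : bquiver.
Hypothesis no3 : no_triple Q.
Variables (eps : bool) (X : Type) (x0 : X) (st : arr Q -> X -> X).
Hypothesis st0 : forall a b m, lsrc (b, eps) = ltgt (a, eps) -> ~~ okpair (a, eps) (b, eps) ->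
  st b (st a m) = x0.
Implicit Types (w : word Q) (s : seq (letter Q)) (l p : letter Q) (ms : nat -> X).

Definition rel_along p m m' := if p.2 == eps then st p.1 m = m' else st p.1 m' = m.

Lemma rel_along_inv p m m' : rel_along p m m' -> rel_along (linv p) m' m.
Proof. by rewrite /rel_along /=; case: p.2; case: eps. Qed.

(** If [p] has direction [eps], its arrow differs from [a], and the inverse of [p] can be followed
    by [a]. Otherwise [m] is an image under the arrow of [p], and [a] kills it unless the two arrows
    compose. *)
Lemma rel_along_zero p m m' a : rel_along p m m' -> lsrc p = lsrc (a, eps) -> p != (a, eps) ->
  st a m = x0 \/ okpair (linv p) (a, eps).
Proof.
case: p => c b; rewrite /rel_along /=; have [->|be] := eqVneq b eps => r e ne.
  right; rewrite /okpair /linv /=; have ca : c != a by apply: contra ne => /eqP ->.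
  by rewrite (negbTE ca) /=; case: eps.
have {be} be : b = ~~ eps by case: b eps be {r e ne} => -[].
have [ok|nok] := boolP (okpair (linv (c, b)) (a, eps)); [by right | left].
rewrite -r; apply: st0; last by move: nok; rewrite /linv /= be negbK.
by rewrite -e be; case: eps.
Qed.

Definition family s ms := forall i l, onth s i = Some l -> rel_along l (ms i) (ms i.+1).

(* The position to which the arrow a, acting in direction eps, moves position i. *)
Definition neighbour s a i : option nat :=
  if onth s i == Some (a, eps) then Some i.+1
  else if (0 < i)%N && (onth s i.-1 == Some (a, ~~ eps)) then Some i.-1 else None.

(** At an interior position, an arrow that is not carried by a neighbouring letter and acts
    nontrivially would be joinable with both neighbouring letters, against [no_triple]. At the ends
    the vanishing is a hypothesis. *)
Lemma family_step w ms a i l0 : stringb w -> family w.2 ms -> w.2 != [::] -> (i <= size w.2)%N ->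
  (forall b, lsrc (b, eps) = w.1 -> okpair (linv (head l0 w.2)) (b, eps) -> st b (ms 0%N) = x0) ->
  (forall b, lsrc (b, eps) = endv w -> okpair (last l0 w.2) (b, eps) -> st b (ms (size w.2)) = x0) ->
  lsrc (a, eps) = vtx w i ->
  st a (ms i) = if neighbour w.2 a i is Some j then ms j else x0.
Proof.
move=> /andP [ww ss] fm ne il hs he ai; rewrite /neighbour.
case: eqP => [/fm|no1]; first by rewrite /rel_along /= eqxx.
case: andP => [[i0 /eqP /fm]|no2].
  by rewrite prednK // /rel_along /=; case: eps.
have nxt : (i < size w.2)%N -> exists p, [/\ onth w.2 i = Some p, lsrc p = vtx w i & p != (a, eps)].
  move=> lt; have := onthTE w.2 i; rewrite lt; case o : (onth w.2 i) => [p|] // _; exists p; split=> //.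
    by have := @walk_onth _ w.1 w.2 i p ww o; rewrite -surjective_pairing => -[].
  by apply/eqP => pE; apply: no1; rewrite o pE.
have prv : (0 < i)%N -> exists p, [/\ onth w.2 i.-1 = Some p, ltgt p = vtx w i & linv p != (a, eps)].
  move=> i0; have := onthTE w.2 i.-1; rewrite prednK // il; case o : (onth w.2 i.-1) => [p|] // _; exists p; split=> //.
    by have := @walk_onth _ w.1 w.2 i.-1 p ww o; rewrite -surjective_pairing prednK // => -[].
  by apply/eqP => pE; apply: no2; split=> //; rewrite o -(linvK p) pE.
case: (posnP i) => [i0|i0].
  have [|p [o pv pn]] := nxt; first by rewrite i0; case: (w.2) ne.
  have [//|ok] := rel_along_zero (fm _ _ o) (etrans pv (esym ai)) pn.
  rewrite i0 in o ai *; apply: hs; first by rewrite ai.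
  by move: o ok; case: (w.2) => //= q s [->].
have [q [oq qv qn]] := prv i0.
have rq := rel_along_inv (fm _ _ oq); rewrite prednK // in rq.
have qv' : lsrc (linv q) = vtx w i by rewrite lsrc_inv.
have [//|okq] := rel_along_zero rq (etrans qv' (esym ai)) qn; rewrite linvK in okq.
have [lt|ge] := ltnP i (size w.2); last first.
  have iE : i = size w.2 by lia.
  rewrite iE; apply: he; first by rewrite ai iE; case: (w) => x s; rewrite vtx_last.
  rewrite -(nth_last l0); move: oq; rewrite iE => /(onth_nth l0) ->; exact: okq.
have [p [op pv pn]] := nxt lt.
have [//|okp] := rel_along_zero (fm _ _ op) (etrans pv (esym ai)) pn.
have okqp : okpair q p.
  have cs := (@consecP _ (fun l1 l2 => okpair l1 l2) (@okpair Q) w.2 (fun _ _ => iff_refl _)).2 ss.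
  apply: (cs (take i.-1 w.2) q p (drop i.+1 w.2)).
  rewrite -{1}(cat_take_drop i.-1 w.2) (drop_nth q); last by lia.
  rewrite (onth_nth q _ _ _ oq) prednK // (drop_nth q) //.
  by rewrite (onth_nth q _ _ _ op).
exfalso; apply: (no3 (p := linv q) (q := p) (r := (a, eps))).
- by rewrite qv' pv.
- by rewrite qv' ai.
- by rewrite linvK.
- by rewrite linvK.
- exact: okp.
Qed.

(** The two families start at the two ends of [l] and are joined along the inverse of [s1], then
    [l], then [s2]; position [size s1] is the source of [l]. *)
Lemma family_glue x s1 l s2 ms1 ms2 : walk x s1 -> family s1 ms1 -> family s2 ms2 ->
  rel_along l (ms1 0%N) (ms2 0%N) ->
  let ms i := if (i <= size s1)%N then ms1 (size s1 - i)%N else ms2 (i - (size s1).+1)%N in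
  family ((winv (x, s1)).2 ++ l :: s2) ms.
Proof.
move=> ws f1 f2 rl ms i p; rewrite onth_cat size_winv [(x, s1).2]/= /ms.
case: ltnP => [lt|ge].
  rewrite onth_winv //=; case o : (onth s1 _) => [r|] //= [<-].
  rewrite (ltnW lt); apply: rel_along_inv.
  by have := f1 _ _ o; rewrite (_ : (size s1 - i.+1).+1 = size s1 - i)%N //; lia.
case d : (i - size s1)%N => [|k] /=.
  have -> : i = size s1 by lia.
  by case=> <-; rewrite leqnn !subnn.
move=> /f2; have -> : (i <= size s1)%N = false by lia.
by rewrite subSS d (_ : i - (size s1).+1 = k)%N //; lia.
Qed.

Lemma family_cons p s m ms : rel_along p m (ms 0%N) -> family s ms ->
  family (p :: s) (fun i => if i is j.+1 then ms j else m).
Proof. by move=> r f [|i] l /=; [case=> <- | apply: f]. Qed.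
End Families.

Section Nb.
Variables (Q : bquiver) (w : word Q).
Hypothesis tw : thin w.

Lemma step_neighbour_true a i j : step w.2 a i j = (neighbour true w.2 a i == Some j).
Proof.
rewrite /step /neighbour; case: (onth w.2 i =P Some (a, true)) => [o|no].
  apply/idP/eqP => [|[<-]]; last by rewrite eqxx ?orbT.
  case/orP => [/andP [/eqP -> _] //|/andP [_ /eqP o']].
  by have k := thin_arrow tw o o'; move: o; rewrite k o'.
apply/idP/idP.
  by case/orP => [/andP [_ //]|/andP [/eqP ij /eqP o']]; rewrite ij /= o' eqxx.
case: ifP => // /andP [i0 /eqP o] /eqP [<-]; apply/orP; right.
by rewrite prednK // o !eqxx.
Qed.

Lemma step_neighbour_false a i j : step w.2 a j i = (neighbour false w.2 a i == Some j).
Proof.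
rewrite /step /neighbour; case: (onth w.2 i =P Some (a, false)) => [o|no].
  apply/idP/eqP => [|[<-]]; last by rewrite eqxx ?orbT.
  case/orP => [/andP [_ /eqP o']|/andP [/eqP -> _] //].
  by have k := thin_arrow tw o o'; move: o; rewrite k o'.
apply/idP/idP.
  by case/orP => [/andP [/eqP ij /eqP o']|/andP [_ //]]; rewrite ij /= o' eqxx.
case: ifP => // /andP [i0 /eqP o] /eqP [<-]; apply/orP; left.
by rewrite prednK // o !eqxx.
Qed.

End Nb.

(** * Functorial filtrations, and splitting off a string module *)

Section Classification.
Variables (F : fieldType) (Q : bquiver).
Hypotheses (r2 : quadratic Q) (no3 : no_triple Q) (thinQ : forall w : word Q, stringb w -> thin w).
Variable M : rep F Q.
Hypothesis mM : is_module M.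
Implicit Types (w : word Q) (s t : seq (letter Q)) (l p : letter Q).
Let d := rdim M.
Let V i : 'M[F]_d := ridem M i.
Let act a : 'M[F]_d := ract M a.

Lemma V_idem i : V i *m V i = V i.
Proof. by have [m1 _] := mM; rewrite /V m1 eqxx. Qed.

Lemma V_orth i j : i != j -> V i *m V j = 0.
Proof. by move=> ij; have [m1 _] := mM; rewrite /V m1 (negbTE ij). Qed.

Lemma act_V a : act a *m V (tgt a) = act a.
Proof. by have [_ [_ [m3 _]]] := mM; rewrite /act {1}m3 -[LHS]mulmxA [X in _ *m X]V_idem -m3. Qed.

Lemma V_act a : V (src a) *m act a = act a.
Proof. by have [_ [_ [m3 _]]] := mM; rewrite /act {1}m3 !mulmxA [X in X *m _ *m _]V_idem -m3. Qed.

Lemma act_sub a : (act a <= V (tgt a))%MS.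
Proof. by rewrite -act_V submxMl. Qed.

Lemma sub_V n (A : 'M_(n, d)) i : (A <= V i)%MS -> A *m V i = A.
Proof. by case/submxP => D ->; rewrite -mulmxA V_idem. Qed.

Lemma act_rel a b : [:: a; b] \in rels Q -> act a *m act b = 0.
Proof. by have [_ [_ [_ m4]]] := mM; move=> /m4; rewrite /pathmx /= mul1mx. Qed.

(** The choice made by [pick] is immaterial: [no_triple] leaves at most one candidate. *)
Definition next_arrow l b := [pick a | (lsrc (a, b) == ltgt l) && okpair l (a, b)].

Lemma next_arrow_some l b a : next_arrow l b = Some a -> lsrc (a, b) = ltgt l /\ okpair l (a, b).
Proof. by rewrite /next_arrow; case: pickP => // x /andP [/eqP e o] [<-]. Qed.

Lemma next_arrow_uniq l b a : lsrc (a, b) = ltgt l -> okpair l (a, b) -> next_arrow l b = Some a.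
Proof.
move=> e o; rewrite /next_arrow; case: pickP => [x /andP [/eqP ex ox]|/(_ a)]; last by rewrite e eqxx o.
have [->//|ne] := eqVneq x a; exfalso.
apply: (no3 (p := linv l) (q := (x, b)) (r := (a, b))); rewrite ?lsrc_inv ?linvK //.
by rewrite /okpair /= (negbTE ne) /=; case: b {e o ex ox}.
Qed.

Definition preimage a (U : 'M[F]_d) : 'M[F]_d := (V (src a) :&: kermx (act a *m cokermx U))%MS.

Lemma preimageP a U (v : 'rV_d) : (v <= preimage a U)%MS = (v <= V (src a))%MS && (v *m act a <= U)%MS.
Proof.
by rewrite sub_capmx sub_kermx mulmxA; congr (_ && _); rewrite [RHS]submxE.
Qed.

Fixpoint chain (c : letter Q -> 'M[F]_d) l s : 'M[F]_d :=
  if s is p :: t then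
    if p.2 then preimage p.1 (chain c p t) else chain c p t *m act p.1
  else c l.

(* lower and upper are the subspaces C^- and C^+ of the functorial filtration at the
   end of l attached to the half-string s starting after l. *)
Definition lower := chain (fun l => if next_arrow l false is Some a then act a else 0).
Definition upper := chain (fun l =>
  if next_arrow l true is Some a then (V (ltgt l) :&: kermx (act a))%MS else V (ltgt l)).

Lemma lower_cons l p s :
  lower l (p :: s) = if p.2 then preimage p.1 (lower p s) else lower p s *m act p.1.
Proof. by []. Qed.

Lemma upper_cons l p s :
  upper l (p :: s) = if p.2 then preimage p.1 (upper p s) else upper p s *m act p.1.
Proof. by []. Qed.

Lemma upper_nil l : upper l [::] =
  if next_arrow l true is Some a then (V (ltgt l) :&: kermx (act a))%MS else V (ltgt l).
Proof. by []. Qed.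

Definition follows l s := path (fun l1 l2 => okpair l1 l2) l s && walk (ltgt l) s.

Lemma follows_cons l p s : follows l (p :: s) = [&& okpair l p, ltgt l == lsrc p & follows p s].
Proof. by rewrite /follows /=; case: (okpair _ _); case: (_ == _); rewrite ?andbF. Qed.

Lemma chain_sub c l s : (forall l, c l <= V (ltgt l))%MS -> follows l s ->
  (chain c l s <= V (ltgt l))%MS.
Proof.
move=> cV; elim: s l => [|p s IH] l /=; first by rewrite cV.
rewrite follows_cons => /and3P [_ /eqP -> _].
case: p => a [] /=; first exact: capmxSl.
by apply: submx_trans (act_sub a); apply: submxMl.
Qed.

Lemma lower_sub l s : follows l s -> (lower l s <= V (ltgt l))%MS.
Proof.
apply: chain_sub => {}l; case e : (next_arrow l false) => [a|]; last exact: sub0mx.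
by have [<- _] := next_arrow_some e; apply: act_sub.
Qed.

Lemma upper_sub l s : follows l s -> (upper l s <= V (ltgt l))%MS.
Proof. by apply: chain_sub => {}l; case: next_arrow => [a|]; rewrite ?capmxSl. Qed.

(** At the end of the half-string this says that the next incoming arrow followed by the next
    outgoing one is zero: otherwise the two letters and the inverse of [l] would contradict
    [no_triple]. *)
Lemma lower_upper l s : follows l s -> (lower l s <= upper l s)%MS.
Proof.
elim: s l => [|p s IH] l.
  move=> _; rewrite /lower /upper /=.
  case e : (next_arrow l false) => [a|]; last exact: sub0mx.
  have [ea oa] := next_arrow_some e; case e' : (next_arrow l true) => [b|]; last by rewrite -ea act_sub.
  have [eb ob] := next_arrow_some e'; rewrite sub_capmx -{1}ea act_sub /=.
  apply/sub_kermxP; have [ab|nab] := boolP (okpair (a, true) (b, true)); last first.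
    by apply: act_rel; move: nab; rewrite /okpair /= andbF /= andbT negbK.
  exfalso; apply: (no3 (p := linv l) (q := (a, false)) (r := (b, true)));
    by rewrite ?lsrc_inv ?linvK.
rewrite follows_cons lower_cons upper_cons => /and3P [_ _ /IH sub]; case: (p.2).
  apply/rV_subP => v; rewrite !preimageP => /andP [-> /=] h; exact: submx_trans sub.
exact: submxMr.
Qed.

Lemma rV_notsub m n (A : 'M[F]_(m, d)) (B : 'M[F]_(n, d)) : ~~ (A <= B)%MS ->
  exists v : 'rV_d, (v <= A)%MS /\ ~~ (v <= B)%MS.
Proof. by case/row_subPn => i h; exists (row i A); rewrite row_sub. Qed.

(** Search for a half-string that detects the gap between [R] and [P]. If the part of [P] in the
    image of the next incoming arrow is not inside [R], continue with preimages along that arrow.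
    Otherwise, if the part of [P] in [upper l [::]] is not inside [R], stop. Otherwise the next
    outgoing arrow does not collapse the gap, and the search continues with images along it. [n]
    bounds the remaining steps. *)
Lemma exists_chain n t0 l x (P R : 'M[F]_d) :
  stringb (x, rcons t0 l) -> (nv Q <= size t0 + n)%N ->
  (R <= P)%MS -> (P <= V (ltgt l))%MS -> ~~ (P <= R)%MS ->
  exists2 s, follows l s & ~~ (P :&: upper l s <= R + lower l s)%MS.
Proof.
elim: n t0 l P R => [|n IH] t0 l P R st len RP PV nPR.
  (* The word built so far visits [size t0 + 2] distinct vertices, more than exist. *)
  have /andP [_ un] := thinQ st; have := max_card (mem (verts (x, rcons t0 l))).
  rewrite (card_uniqP un) card_ord /= size_map size_rcons; lia.
have next p : lsrc p = ltgt l -> okpair l p -> stringb (x, rcons (rcons t0 l) p).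
  move=> e o; have /andP [/= w1 s1] := st; apply/andP; split=> /=.
    by rewrite -cats1 walk_cat w1 /= endv_rcons e eqxx.
  move: s1; case: t0 {st len w1} => [|y t0] /=; first by rewrite o.
  by rewrite !rcons_path last_rcons => ->.
have len' : (nv Q <= size (rcons t0 l) + n)%N by rewrite size_rcons; lia.
have [[a [ea nA]]|noA] := classic (exists a, next_arrow l false = Some a /\ ~~ (P :&: act a <= R)%MS).
  have [la oa] := next_arrow_some ea.
  have [s fs ns] : exists2 s, follows (a, false) s & ~~ (preimage a P :&: upper (a, false) s <= preimage a R + lower (a, false) s)%MS.
    apply: (IH (rcons t0 l)) => //; first exact: next.
    - by apply/rV_subP => v; rewrite !preimageP => /andP [-> /=] h; apply: submx_trans RP.
    - exact: capmxSl.
    apply: contra nA => /rV_subP sub; apply/rV_subP => v; rewrite sub_capmx => /andP [vP /submxP [u vE]].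
    have uE : u *m V (src a) *m act a = v by rewrite -mulmxA V_act vE.
    have := sub (u *m V (src a)); rewrite !preimageP uE vP submxMl /=; exact.
  exists ((a, false) :: s); first by rewrite follows_cons oa la eqxx.
  rewrite lower_cons upper_cons /=.
  apply: contra ns => /rV_subP sub; apply/rV_subP => u; rewrite sub_capmx preimageP => /andP [/andP [uV uP] uU].
  have := sub (u *m act a); rewrite sub_capmx uP (submxMr _ uU) => /(_ isT).
  case/sub_addsmxP => -[r c] /= uE; set c' := c *m lower (a, false) s.
  have cV : (c' <= V (src a))%MS.
    by apply: submx_trans (lower_sub fs); apply: submxMl.
  rewrite -[u](subrK c'); apply: addmx_sub_adds; last exact: submxMl.
  rewrite preimageP; apply/andP; split; first by apply: addmx_sub => //; rewrite eqmx_opp.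
  by rewrite mulmxBl uE /c' mulmxA addrK submxMl.
(* No gap is left along the incoming arrow, so [P] meets [lower l [::]] inside [R]. *)
have lowR v : (v <= P)%MS -> (v <= lower l [::])%MS -> (v <= R)%MS.
  rewrite /lower /=; case e : (next_arrow l false) => [a|] vP va; last first.
    by move: va; rewrite submx0 => /eqP ->; apply: sub0mx.
  apply: NNPP => /negP nv; apply: noA; exists a; split=> //.
  by apply: contra nv => sub; apply: submx_trans sub; rewrite sub_capmx vP.
have [nB|/negPn] := boolP (~~ (P :&: upper l [::] <= R)%MS).
  exists [::]; first by [].
  apply: contra nB => /rV_subP sub; apply/rV_subP => v vPU; have := sub v vPU.
  case/sub_addsmxP => -[r c] /= vE.
  have vP : (v <= P)%MS by move: vPU; rewrite sub_capmx => /andP [].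
  rewrite vE; apply: addmx_sub; first exact: submxMl.
  apply: lowR; last exact: submxMl.
  have -> : c *m lower l [::] = v - r *m R by rewrite vE addrC addKr.
  by apply: addmx_sub => //; rewrite eqmx_opp; apply: submx_trans RP; apply: submxMl.
rewrite upper_nil; case e : (next_arrow l true) => [b|] sub; last first.
  case/negP: nPR; apply: submx_trans sub; by rewrite sub_capmx submx_refl.
have [lb ob] := next_arrow_some e.
have [s fs ns] : exists2 s, follows (b, true) s &
    ~~ (P *m act b :&: upper (b, true) s <= R *m act b + lower (b, true) s)%MS.
  apply: (IH (rcons t0 l)) => //; first exact: next.
  - exact: submxMr.
  - by apply: submx_trans (act_sub b); apply: submxMl.
  apply: contra nPR => sub'; apply/rV_subP => v vP.
  have /submxP [u uE] : (v *m act b <= R *m act b)%MS by apply: submx_trans sub'; apply: submxMr.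
  have uRP : (u *m R <= P)%MS by apply: submx_trans RP; apply: submxMl.
  rewrite -[v](subrK (u *m R)); apply: addmx_sub; last exact: submxMl.
  apply: submx_trans sub; rewrite !sub_capmx.
  have h : (v - u *m R <= P)%MS by apply: addmx_sub => //; rewrite eqmx_opp.
  rewrite h (submx_trans h PV) /=; apply/sub_kermxP.
  by rewrite mulmxBl uE mulmxA subrr.
exists ((b, true) :: s); first by rewrite follows_cons ob lb eqxx.
rewrite lower_cons upper_cons /=.
apply: contra ns => /rV_subP sub'; apply/rV_subP => y; rewrite sub_capmx => /andP [/submxP [u yE] yU].
have := sub' (u *m P); rewrite sub_capmx submxMl preimageP.
have -> : (u *m P <= V (src b))%MS.
  by rewrite (lb : src b = _); apply: submx_trans PV; apply: submxMl.
rewrite -mulmxA -yE yU => /(_ isT) /sub_addsmxP [[r c] /= uE].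
rewrite yE mulmxA uE mulmxDl; apply: addmx_sub_adds; first by rewrite -mulmxA submxMl.
by have := submxMl c (preimage b (lower (b, true) s)); rewrite preimageP => /andP [].
Qed.

Local Notation rst := (fun (a : arr Q) (m : 'rV[F]_d) => m *m act a).
Local Notation cst := (fun (a : arr Q) (m : 'cV[F]_d) => act a *m m).

(** The vector is transported along [s]: forward letters apply their arrow, backward letters choose
    a preimage, and the kernel in the base case gives the condition at the end. *)
Lemma upper_family l s (x : 'rV_d) : follows l s -> (x <= upper l s)%MS ->
  exists ms : nat -> 'rV_d, [/\ ms 0%N = x, family true rst s ms,
    forall i, (i <= size s)%N -> ms i *m V (vtx (ltgt l, s) i) = ms i &
    forall a, lsrc (a, true) = endv (ltgt l, s) -> okpair (last l s) (a, true) ->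
      ms (size s) *m act a = 0].
Proof.
elim: s l x => [|p s IH] l x fs xs.
  exists (fun _ => x); split=> // [i l'|i|a ea oa]; first by rewrite onth0n.
    rewrite leqn0 => /eqP ->; apply: sub_V; apply: submx_trans xs _; exact: upper_sub fs.
  by move: xs; rewrite upper_nil (next_arrow_uniq ea oa) sub_capmx => /andP [_ /sub_kermxP].
have xV : x *m V (ltgt l) = x by apply: sub_V; apply: submx_trans xs (upper_sub fs).
move: fs xs; rewrite follows_cons upper_cons => /and3P [_ /eqP lp fs] xs.
have [y ys rel] : exists2 y, (y <= upper p s)%MS & rel_along true rst p x y.
  rewrite /rel_along; case pb : p.2 xs => xs; last by case/submxP: xs => D ->; exists (D *m upper p s); [apply: submxMl | rewrite mulmxA].
  by exists (x *m act p.1) => //; move: xs; rewrite preimageP => /andP [].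
have [ms [m0 fm mV me]] := IH p y fs ys.
exists (fun i => if i is j.+1 then ms j else x); split=> //.
- by apply: family_cons => //; rewrite m0.
- by move=> [|i] //= il; rewrite vtx_cons //; apply: mV.
Qed.

(** A linear form killing the preimage of [U] kills the kernel of the map that [a] induces to the
    quotient by [U], so it factors through that map. *)
Lemma preimage_factor a U (phi : 'cV_d) : (U <= V (tgt a))%MS -> V (src a) *m phi = phi ->
  preimage a U *m phi = 0 -> exists psi, [/\ phi = act a *m psi, U *m psi = 0 & V (tgt a) *m psi = psi].
Proof.
move=> UV Vp pp; have [psi pE] : exists psi, phi = act a *m cokermx U *m psi.
  apply: kermx_factor; rewrite -Vp mulmxA.
  have /submxP [D ->] : (kermx (act a *m cokermx U) *m V (src a) <= preimage a U)%MS.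
    rewrite sub_capmx submxMl /=; apply/sub_kermxP.
    by rewrite -mulmxA [V _ *m (_ *m _)]mulmxA V_act mulmx_ker.
  by rewrite -mulmxA pp mulmx0.
exists (V (tgt a) *m (cokermx U *m psi)); split.
- by rewrite mulmxA act_V mulmxA.
- by rewrite mulmxA (sub_V UV) mulmxA mulmx_coker mul0mx.
- by rewrite mulmxA V_idem.
Qed.

(** Dual to [upper_family], for linear forms: along a forward letter the form is factored through
    the arrow by [preimage_factor], along a backward letter it is composed with the arrow. *)
Lemma lower_family l s (phi : 'cV_d) : follows l s -> V (ltgt l) *m phi = phi -> lower l s *m phi = 0 ->
  exists ms : nat -> 'cV_d, [/\ ms 0%N = phi, family false cst s ms,
    forall i, (i <= size s)%N -> V (vtx (ltgt l, s) i) *m ms i = ms i &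
    forall a, lsrc (a, false) = endv (ltgt l, s) -> okpair (last l s) (a, false) ->
      act a *m ms (size s) = 0].
Proof.
elim: s l phi => [|p s IH] l phi fs Vp lp.
  exists (fun _ => phi); split=> // [i l'|i|a ea oa]; first by rewrite onth0n.
    by rewrite leqn0 => /eqP ->.
  by move: lp; rewrite /lower /= (next_arrow_uniq ea oa).
move: fs lp; rewrite follows_cons lower_cons => /and3P [_ /eqP ep fs] lp.
have [psi [rel psV psl]] : exists psi, [/\ rel_along false cst p phi psi,
    V (ltgt p) *m psi = psi & lower p s *m psi = 0].
  rewrite /rel_along; case: p ep fs lp => a [] /= ep fs lp.
    have [|psi [-> lps vps]] := preimage_factor (lower_sub fs) _ lp.
      by rewrite (_ : src a = ltgt l).
    by exists psi.
  exists (act a *m phi); split=> //; first by rewrite mulmxA V_act.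
  by rewrite mulmxA.
have [ms [m0 fm mV me]] := IH p psi fs psV psl.
exists (fun i => if i is j.+1 then ms j else phi); split=> //.
- by apply: family_cons => //; rewrite m0.
- by move=> [|i] //= il; rewrite vtx_cons //; apply: mV.
Qed.

Lemma hom_of_family w (ms : nat -> 'rV_d) l0 : stringb w -> w.2 != [::] -> family true rst w.2 ms ->
  (forall i, (i <= size w.2)%N -> ms i *m V (vtx w i) = ms i) ->
  (forall b, lsrc (b, true) = w.1 -> okpair (linv (head l0 w.2)) (b, true) -> ms 0%N *m act b = 0) ->
  (forall b, lsrc (b, true) = endv w -> okpair (last l0 w.2) (b, true) -> ms (size w.2) *m act b = 0) ->
  is_hom (Mstr F w) M (\matrix_(i < (size w.2).+1) ms i).
Proof.
move=> sw ne fm mV hs he; have tw := thinQ sw.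
have st0 (a b : arr Q) (m : 'rV[F]_d) : lsrc (b, true) = ltgt (a, true) -> ~~ okpair (a, true) (b, true) ->
    m *m act a *m act b = 0.
  move=> _ nab; rewrite -mulmxA act_rel ?mulmx0 //.
  by move: nab; rewrite /okpair /= andbF /= andbT negbK.
split=> [v|a]; apply/row_matrixP => i; have il : (i <= size w.2)%N by rewrite -ltnS ltn_ord.
  rewrite [RHS]row_mul rowK; have -> : row i (ridem (Mstr F w) v *m (\matrix_(i < (size w.2).+1) ms i)) =
     if vtx w i == v then ms i else 0.
    apply/rowP => j; rewrite mxE mul_ridemE; case: eqP => _; last by rewrite mxE.
    by rewrite mxE.
  rewrite -(mV i il); case: (vtx w i =P v) => [<-|/eqP ne']; first by rewrite -mulmxA V_idem.
  by rewrite -mulmxA (V_orth ne') mulmx0.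
rewrite [RHS]row_mul rowK.
have -> : row i (ract (Mstr F w) a *m (\matrix_(i < (size w.2).+1) ms i)) =
   if neighbour true w.2 a i is Some j then ms j else 0.
  apply/rowP => j; rewrite mxE mxE.
  rewrite (eq_bigr (fun k : 'I__ => (neighbour true w.2 a i == Some (k : nat))%:R * ms k 0 j)); last first.
    by move=> k _; rewrite ract_MstrE mxE step_neighbour_true.
  case nE : (neighbour true w.2 a i) => [k|]; last by rewrite big1 ?mxE // => k _; rewrite mul0r.
  have kl : (k < (size w.2).+1)%N.
    move: nE; rewrite /neighbour; case: eqP => [o [<-]|_]; first by rewrite ltnS (onth_lt o).
    by case: ifP => // _ [<-]; rewrite ltnS (leq_trans (leq_pred _)).
  rewrite (@sum_delta _ _ (fun t : 'I__ => ms t 0 j) (Ordinal kl) (fun t : 'I__ => Some k == Some (t : nat))) /=.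
    by rewrite eqxx mul1r.
  by move=> t; apply: contra => /eqP [e]; apply/eqP/val_inj.
have [ai|nai] := eqVneq (src a) (vtx w i).
  by rewrite -(family_step no3 st0 (l0 := l0) sw fm ne il hs he ai).
have -> : ms i *m ract M a = 0 by rewrite -(mV i il) -/(act a) -V_act -!mulmxA (mulmxA (V (vtx w i))) V_orth 1?eq_sym // mul0mx mulmx0.
case nE : (neighbour true w.2 a i) => [k|] //; have /andP [ww _] := sw.
have : step w.2 a i k by rewrite step_neighbour_true // nE.
by case/(step_vtx ww) => e _; rewrite e eqxx in nai.
Qed.

Lemma hom_to_family w (ms : nat -> 'cV_d) l0 : stringb w -> w.2 != [::] -> family false cst w.2 ms ->
  (forall i, (i <= size w.2)%N -> V (vtx w i) *m ms i = ms i) ->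
  (forall b, lsrc (b, false) = w.1 -> okpair (linv (head l0 w.2)) (b, false) -> act b *m ms 0%N = 0) ->
  (forall b, lsrc (b, false) = endv w -> okpair (last l0 w.2) (b, false) -> act b *m ms (size w.2) = 0) ->
  is_hom M (Mstr F w) (\matrix_(j < d, i < (size w.2).+1) ms i j 0).
Proof.
move=> sw ne fm mV hs he; have tw := thinQ sw.
have st0 (a b : arr Q) (m : 'cV[F]_d) : lsrc (b, false) = ltgt (a, false) -> ~~ okpair (a, false) (b, false) ->
    act b *m (act a *m m) = 0.
  move=> _ nab; rewrite mulmxA act_rel ?mul0mx //.
  by move: nab; rewrite /okpair /= !andbF /= negbK.
set g := \matrix_(j, i) _.
have colg (i : 'I_(size w.2).+1) : col i g = ms i by apply/colP => j; rewrite !mxE.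
have gE n (B : 'M_(n, d)) j i : (B *m g) j i = (B *m ms i) j 0 by rewrite -colg colE mulmxA -colE [RHS]mxE.
split=> [v|a]; apply/matrixP => j i; move: i; refine (fun i : 'I_(size w.2).+1 => _);
  have il : (i <= size w.2)%N by rewrite -ltnS ltn_ord.
  rewrite gE mulr_ridemE -{1}(mV i il) mulmxA -/(V v).
  case: (vtx w i =P v) => [<-|/eqP ne']; first by rewrite V_idem mV // mxE.
  by rewrite V_orth 1?eq_sym // mul0mx mxE.
rewrite gE; have -> : (g *m ract (Mstr F w) a) j i =
   (if neighbour false w.2 a i is Some k then ms k else 0) j 0.
  rewrite mxE (eq_bigr (fun k : 'I__ => (neighbour false w.2 a i == Some (k : nat))%:R * ms k j 0)); last first.
    by move=> k _; rewrite ract_MstrE mxE step_neighbour_false // mulrC.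
  case nE : (neighbour false w.2 a i) => [k|]; last by rewrite big1 ?mxE // => k _; rewrite mul0r.
  have kl : (k < (size w.2).+1)%N.
    move: nE; rewrite /neighbour; case: eqP => [o [<-]|_]; first by rewrite ltnS (onth_lt o).
    by case: ifP => // _ [<-]; rewrite ltnS (leq_trans (leq_pred _)).
  rewrite (@sum_delta _ _ (fun t : 'I__ => ms t j 0) (Ordinal kl) (fun t : 'I__ => Some k == Some (t : nat))) /=.
    by rewrite eqxx mul1r.
  by move=> t; apply: contra => /eqP [e]; apply/eqP/val_inj.
have [ai|nai] := eqVneq (tgt a) (vtx w i).
  by rewrite -(family_step no3 st0 (l0 := l0) sw fm ne il hs he ai).
have -> : ract M a *m ms i = 0 by rewrite -(mV i il) -/(act a) -act_V -!mulmxA (mulmxA (V (tgt a))) V_orth // mul0mx mulmx0.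
case nE : (neighbour false w.2 a i) => [k|] //; have /andP [ww _] := sw.
have : step w.2 a k i by rewrite step_neighbour_false // nE.
by case/(step_vtx ww) => _ e; rewrite e eqxx in nai.
Qed.

Lemma vtx_suffix x s l t k : (k <= size t)%N ->
  vtx (x, s ++ l :: t) ((size s).+1 + k) = vtx (ltgt l, t) k.
Proof.
move=> kt; have := @vtx_cat _ x (rcons s l) t [::] k kt.
by rewrite cats0 cat_rcons endv_rcons size_rcons.
Qed.

Lemma simple_retract i : (forall a, act a = 0) -> V i != 0 -> retract (Mstr F (i, [::])) M.
Proof.
move=> a0 /eqP Vi; have [p [q pq]] : exists p q : 'I_d, V i p q != 0.
  apply: NNPP => nex; apply: Vi; apply/matrixP => p q; rewrite mxE; apply/eqP/negPn/negP => ne.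
  by apply: nex; exists p, q.
pose x : 'M[F]_(1, d) := row p (V i); pose phi : 'M[F]_(d, 1) := (V i p q)^-1 *: (V i *m delta_mx q 0).
have xV : x *m V i = x by rewrite /x -row_mul V_idem.
have Vp : V i *m phi = phi by rewrite /phi -scalemxAr mulmxA V_idem.
have xp : x *m phi = 1%:M.
  rewrite /phi -scalemxAr mulmxA xV -colE; apply/matrixP => u v.
  by rewrite !ord1 !mxE mulVf.
have n0 a : ract (Mstr F (i, [::])) a = 0 by apply: onth_step_none.
have vt (k : 'I_1) : vtx (i, [::]) k = i by rewrite ord1.
exists x, phi; split; [|split=> //].
  split=> [v|a]; last by rewrite n0 mul0mx [ract M a]a0 mulmx0.
  apply/matrixP => u k; rewrite mul_ridemE vt -[ridem M v]/(V v); case: eqP => [<-|/eqP ne].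
    by rewrite xV.
  by rewrite -xV -mulmxA V_orth // mulmx0 mxE.
split=> [v|a]; last by rewrite n0 mulmx0 [ract M a]a0 mul0mx.
apply/matrixP => u k; rewrite mulr_ridemE vt -[ridem M v]/(V v); case: eqP => [<-|/eqP ne].
  by rewrite Vp.
by rewrite -Vp mulmxA V_orth 1?eq_sym // mul0mx mxE.
Qed.

Lemma follows_stringb l s : follows l s -> stringb (lsrc l, l :: s).
Proof. by move=> /andP [ps ws]; rewrite /stringb /= eqxx ws. Qed.

Lemma glue_stringb l s1 s2 : follows (linv l) s1 -> follows l s2 ->
  stringb (endv (lsrc l, s1), (winv (lsrc l, s1)).2 ++ l :: s2).
Proof.
move=> f1 f2; have := stringb_winv (follows_stringb f1).
have -> : winv (lsrc (linv l), linv l :: s1) = (endv (lsrc l, s1), rcons (winv (lsrc l, s1)).2 l).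
  rewrite /winv /= rev_cons negbK -surjective_pairing; congr (_, _).
  by rewrite /endv /= ltgt_inv.
move=> /andP [/= w1 o1]; have /andP [/= w2 o2] := follows_stringb f2.
rewrite -cats1 walk_cat in w1; have /andP [w1a w1b] := w1.
apply/andP; split; first by rewrite /= walk_cat w1a /=; move: w1b w2 => /= /andP [-> _] /andP [_ ->].
move: o1; rewrite /= -cat_rcons; case: (rev _) => [|y t] /=; first by rewrite o2.
by rewrite cat_path last_rcons => -> /=.
Qed.

(** The string is built around [a]: one half-string after it separates the image of [a] from zero,
    one before it separates the preimages of the resulting subspaces. A vector [x] in the upper but
    not in the lower subspace gives a map from the string module; a linear form [phi] vanishing on
    the lower one, with value one at [x], gives a map back. *)
Lemma exists_string_retract a : act a != 0 -> exists2 w, stringb w & retract (Mstr F w) M.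
Proof.
move=> a0; set l : letter Q := (a, true).
have [s2 f2 n2] : exists2 s, follows l s & ~~ (act a :&: upper l s <= (0 : 'M_d) + lower l s)%MS.
  apply: (@exists_chain (nv Q) [::] l (src a)) => //.
  - by rewrite /stringb /= eqxx.
  - exact: sub0mx.
  - exact: act_sub.
  - by rewrite submx0.
rewrite adds0mx in n2.
have [s1 f1 n1] : exists2 s, follows (linv l) s &
    ~~ (preimage a (upper l s2) :&: upper (linv l) s <= preimage a (lower l s2) + lower (linv l) s)%MS.
  apply: (@exists_chain (nv Q) [::] (linv l) (tgt a)) => //.
  - by rewrite /stringb /= eqxx.
  - apply/rV_subP => v; rewrite !preimageP => /andP [-> /=] h.
    by apply: submx_trans h (lower_upper f2).
  - exact: capmxSl.
  apply: contra n2 => /rV_subP sub; apply/rV_subP => v.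
  rewrite sub_capmx => /andP [/submxP [u uE] vU].
  have := sub (u *m V (src a)); rewrite !preimageP submxMl -mulmxA V_act -uE vU /=.
  exact.
set R := (preimage a (lower l s2) + lower (linv l) s1)%MS in n1.
have [x [xP xR]] := rV_notsub n1.
have [xpre xU] : (x <= preimage a (upper l s2))%MS /\ (x <= upper (linv l) s1)%MS.
  by move: xP; rewrite sub_capmx => /andP [].
have [xV xaU] := andP (etrans (esym (preimageP a (upper l s2) x)) xpre).
have RV : (R <= V (src a))%MS by rewrite addsmx_sub capmxSl (lower_sub f1).
(* A column of [cokermx R] not killed by [x], normalized and restricted to [V (src a)]. *)
have [phi [Vphi Rphi xphi]] : exists phi : 'cV_d, [/\ V (src a) *m phi = phi, R *m phi = 0 & x *m phi = 1%:M].
  rewrite submxE in xR; have [j xj] : exists j, (x *m cokermx R) 0 j != 0.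
    apply: NNPP => nex; case/eqP: xR; apply/rowP => j; rewrite [RHS]mxE.
    by apply/eqP/negPn/negP => ne; apply: nex; exists j.
  pose c := ((x *m cokermx R) 0 j)^-1; pose psi : 'cV_d := cokermx R *m delta_mx j 0.
  have Rpsi : R *m psi = 0 by rewrite mulmxA mulmx_coker mul0mx.
  have xpsi : c *: (x *m psi) = 1%:M.
    rewrite mulmxA -colE; apply/matrixP => u v.
    by rewrite !ord1 mxE [col _ _ _ _]mxE mulVf // mxE eqxx.
  clearbody psi; exists (c *: (V (src a) *m psi)); split.
  - by rewrite -scalemxAr mulmxA V_idem.
  - by rewrite -scalemxAr mulmxA (sub_V RV) Rpsi scaler0.
  by rewrite -scalemxAr mulmxA (sub_V xV) xpsi.
have pphi : preimage a (lower l s2) *m phi = 0.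
  have /submxP [D ->] : (preimage a (lower l s2) <= R)%MS by apply: addsmxSl.
  by rewrite -mulmxA Rphi mulmx0.
have lphi : lower (linv l) s1 *m phi = 0.
  have /submxP [D ->] : (lower (linv l) s1 <= R)%MS by apply: addsmxSr.
  by rewrite -mulmxA Rphi mulmx0.
have [phi2 [phiE lphi2 Vphi2]] := preimage_factor (lower_sub f2) Vphi pphi.
have [ms1 [m10 fm1 mV1 me1]] := upper_family f1 xU.
have [ms2 [m20 fm2 mV2 me2]] := upper_family f2 xaU.
have [ps1 [p10 fp1 pV1 pe1]] := lower_family f1 (Vphi : V (ltgt (linv l)) *m phi = phi) lphi.
have [ps2 [p20 fp2 pV2 pe2]] := lower_family f2 (Vphi2 : V (ltgt l) *m phi2 = phi2) lphi2.
pose w : word Q := (endv (src a, s1), (winv (src a, s1)).2 ++ l :: s2).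
have sw : stringb w by apply: glue_stringb.
have ws1 : walk (src a) s1 by have /andP [] := f1.
have sz : size w.2 = (size s1 + (size s2).+1)%N by rewrite size_cat size_winv.
set mm := (fun i => if (i <= size s1)%N then ms1 (size s1 - i)%N else ms2 (i - (size s1).+1)%N).
set pp := (fun i => if (i <= size s1)%N then ps1 (size s1 - i)%N else ps2 (i - (size s1).+1)%N).
have vw i : (i <= size w.2)%N -> vtx w i =
    if (i <= size s1)%N then vtx (src a, s1) (size s1 - i) else vtx (tgt a, s2) (i - (size s1).+1).
  move=> il; case: leqP => is1.
    have -> : vtx w i = vtx (winv (src a, s1)) i.
      have h : (i <= size (winv (src a, s1)).2)%N by rewrite size_winv.
      exact: (@vtx_cat _ w.1 [::] (winv (src a, s1)).2 (l :: s2) i h).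
    by rewrite vtx_winv.
  have h : (i - (size s1).+1 <= size s2)%N by rewrite leq_subLR addSnnS -sz.
  have := @vtx_suffix w.1 (winv (src a, s1)).2 l s2 _ h.
  by rewrite size_winv subnKC.
have hd : linv (head l w.2) = last (linv l) s1.
  rewrite /w /= ; case/lastP: (s1) => [|t r] //=.
  by rewrite map_rcons rev_rcons /= last_rcons -[RHS]linvK.
have la : last l w.2 = last l s2 by rewrite /w last_cat.
have ew : endv w = endv (tgt a, s2) by rewrite /w -cat_rcons /endv /= map_cat last_cat map_rcons last_rcons.
have ne : w.2 != [::] by rewrite -size_eq0 sz addnS.
have gm : family true rst w.2 mm.
  by apply: family_glue => //; rewrite m10 m20 /rel_along /= .
have gp : family false cst w.2 pp.
  by apply: family_glue => //; rewrite p10 p20 /rel_along /= -phiE.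
have mmV i : (i <= size w.2)%N -> mm i *m V (vtx w i) = mm i.
  move=> il; rewrite vw // /mm; case: leqP => is1; first by apply: mV1; apply: leq_subr.
  by apply: mV2; rewrite leq_subLR addSnnS -sz.
have ppV i : (i <= size w.2)%N -> V (vtx w i) *m pp i = pp i.
  move=> il; rewrite vw // /pp; case: leqP => is1; first by apply: pV1; apply: leq_subr.
  by apply: pV2; rewrite leq_subLR addSnnS -sz.
have le0 : (size w.2 <= size s1)%N = false by rewrite sz leqNgt addnS ltnS leq_addr.
have sz2 : (size w.2 - (size s1).+1 = size s2)%N by rewrite sz addnS subSS addKn.
have hf : is_hom (Mstr F w) M (\matrix_(i < (size w.2).+1) mm i).
  apply: (hom_of_family (l0 := l) sw ne gm mmV) => b eb ob.
    by rewrite /mm subn0; apply: me1; rewrite -?hd.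
  by rewrite /mm le0 sz2; apply: me2; rewrite -?la -?ew.
have hg : is_hom M (Mstr F w) (\matrix_(j < d, i < (size w.2).+1) pp i j 0).
  apply: (hom_to_family (l0 := l) sw ne gp ppV) => b eb ob.
    by rewrite /pp subn0; apply: pe1; rewrite -?hd.
  by rewrite /pp le0 sz2; apply: pe2; rewrite -?la -?ew.
exists w => //; exists (\matrix_(i < (size w.2).+1) mm i), (\matrix_(j < d, i < (size w.2).+1) pp i j 0).
split=> //; split=> //.
(* The composite is a scalar, read off at position [size s1], where the families start from [x] and
   [phi]. *)
have := thin_end_scalar (thinQ sw) (hom_comp hf hg); set c := (X in X%:M) => fg; clearbody c.
have kl : (size s1 < (size w.2).+1)%N by rewrite ltnS sz leq_addr.
rewrite fg; have := congr1 (fun A : 'M_((size w.2).+1) => A (Ordinal kl) (Ordinal kl)) fg.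
rewrite /= !mxE eqxx mulr1n => <-; congr (_%:M).
have := congr1 (fun A : 'M_1 => A 0 0) xphi; rewrite /= [RHS]mxE eqxx mxE => e; apply: (etrans _ e).
by apply: eq_bigr => j _; rewrite !mxE /mm /pp /= leqnn subnn m10 p10.
Qed.

Lemma indecomposable_string : indecomposable M ->
  exists2 w, stringb w & iso M (Mstr F w).
Proof.
move=> iM; have [w sw rw] : exists2 w, stringb w & retract (Mstr F w) M.
  have [[a a0]|noa] := classic (exists a, act a <> 0).
    by apply: (@exists_string_retract a); apply/eqP.
  have a0 a : act a = 0 by apply: NNPP => ne; apply: noa; exists a.
  have [i Vi] : exists i, V i != 0.
    apply: NNPP => nex; have [_ [m2 _]] := mM; have [_ [d0 _]] := iM.
    have : (1%:M : 'M[F]_d) = 0.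
      rewrite -m2 big1 // => i _; apply/eqP/negPn/negP => Vi; apply: nex; exists i; exact: Vi.
    by move/mx10_dim => e; move: d0; rewrite -/d e.
  by exists (i, [::]) => //; apply: simple_retract.
by exists w => //; apply: iso_sym; apply: indec_retract_iso.
Qed.
End Classification.

(** * Biclosed subcategories *)

Section SubcatGeneral.
Variables (F : fieldType) (Q : bquiver).
Implicit Types (X Y Z N : rep F Q) (C : rep F Q -> Prop).

Lemma ses_iso_mid X Y Y' Z : ses X Y Z -> iso Y Y' -> ses X Y' Z.
Proof.
move=> [f [g [hf [hg [ff [fg [fg0 rk]]]]]]] isoY; have [h [k [hh [hk [e1 e2]]]]] := isoY.
have fK : f *m h *m k = f by rewrite -mulmxA e1 mulmx1.
have gK : h *m (k *m g) = g by rewrite mulmxA e1 mul1mx.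
have rf : \rank (f *m h) = \rank f.
  by apply/eqP; rewrite eqn_leq mxrankM_maxl -{1}fK mxrankM_maxl.
have rg : \rank (k *m g) = \rank g.
  by apply/eqP; rewrite eqn_leq mxrankM_maxr -{1}gK mxrankM_maxr.
exists (f *m h), (k *m g); split; first exact: hom_comp hf hh.
split; first exact: hom_comp hk hg.
split; first by rewrite /row_free rf.
split; first by rewrite /row_full rg.
split; first by rewrite mulmxA fK.
by rewrite rf rg rk; apply: iso_rdim.
Qed.

Lemma exists_indec_retract N : is_module N -> (0 < rdim N)%N ->
  exists2 X, indecomposable X & retract X N.
Proof.
move=> mN d0; apply: NNPP => nex; suff : rdim N = 0%N by move=> e; rewrite e in d0.
apply: (decomp_ind (P := fun K => rdim K = 0%N)) => //.
- by move=> X Y _ X0 /iso_rdim <-.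
- by move=> X Y /= -> ->.
by move=> X iX rX; case: nex; exists X.
Qed.

(** A nonzero object of the additive closure of an indecomposable [Y] has [Y] as a summand, so it
    can lie in [C] only if [Y] does. *)
Lemma compl_indec C Y : subcategory C -> indecomposable Y -> subcat_compl C Y <-> ~ C Y.
Proof.
move=> sC iY; have [mY [dY _]] := iY.
have md X : X = Y -> is_module X by move=> ->.
split=> [[_ nC] CY|nC].
  suff e : rdim Y = 0%N by rewrite e in dY.
  by apply: nC => //; apply/(addP _ md); split=> //; apply: sums1.
split=> // N /(addP _ md) [mN [L sL rL]] CN.
have [//|Np] := posnP (rdim N); exfalso; apply: nC.
have [N' iN' rN'] := exists_indec_retract mN Np.
have [_ -> rY] := krull_schmidt iN' sL (retract_trans rN' rL).
have [mN' [dN' _]] := iN'.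
have [_ [_ [iC _]]] := sC; apply: (iC N') => //; last exact: indec_retract_iso.
exact: subcat_retract sC mN' CN rN'.
Qed.
End SubcatGeneral.

Section Bic.
Variables (F : fieldType) (A : bquiver).
Hypotheses (r2 : quadratic A) (thinA : forall w : word A, is_string w -> thin w).
Hypothesis classif : forall N : rep F A, indecomposable N ->
  exists2 w, is_string w & iso N (Mstr F w).
Local Notation M := (Mstr F).

Lemma string_indec (w : word A) : is_string w -> indecomposable (M w).
Proof. by move=> sw; apply: thin_indec (thinA sw) (Mstr_module F r2 sw). Qed.

Lemma string_split x p (l : letter A) q : is_string (x, p ++ l :: q) ->
  [/\ is_string (x, p), is_string (ltgt l, q) & endv (x, p) = lsrc l].
Proof.
move=> /(is_stringP _ r2) s; split.
- exact/(is_stringP _ r2)/(@stringb_cat _ x [::] p (l :: q)).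
- apply/(is_stringP _ r2); have := @stringb_cat _ x (rcons p l) q [::].
  by rewrite cats0 cat_rcons endv_rcons; apply.
by move: s => /andP []; rewrite /= walk_cat /= => /and3P [_ /eqP].
Qed.

Section OfSet.
Variable X : word A -> Prop.
Hypothesis bX : biclosed_set X.

Lemma addX_module N : (exists w, X w /\ N = M w) -> is_module N.
Proof. by move=> [w [/bX.1 sw ->]]; apply: Mstr_module. Qed.

Lemma addX_subcat : subcategory (addX X : rep F A -> Prop).
Proof. exact: add_subcat addX_module. Qed.

(** By Krull-Schmidt and [Mstr_rigid], [w] agrees with a word of [X] up to inversion. *)
Lemma addX_string w : is_string w -> addX X (M w) <-> X w.
Proof.
move=> sw; split=> [/(addP _ addX_module) [_ [L sL rL]]|Xw].
  have [_ [v [Xv ->]] rv] := krull_schmidt (string_indec sw) sL rL.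
  have sv := bX.1 v Xv.
  have i : iso (M w) (M v) by apply: indec_retract_iso (string_indec sv) rv _.
  case: (Mstr_rigid (thinA sw) (thinA sv) i) => -> //.
  by have [_ [Xi _]] := bX; apply: Xi.
apply/(addP _ addX_module); split; first exact: Mstr_module.
by apply: sums1; exists w.
Qed.

Lemma addX_iso N w : is_string w -> iso N (M w) -> is_module N -> addX X N <-> X w.
Proof.
move=> sw i mN; rewrite -addX_string //; have [_ [_ [iC _]]] := addX_subcat.
split=> [h|h]; first by apply: iC h _ i; apply: Mstr_module.
exact: iC h mN (iso_sym i).
Qed.

(** By [ses_thin] an exact sequence of indecomposables cuts the middle string at one letter, so both
    closure conditions reduce to those of [X]. *)
Lemma addX_biclosed : biclosed_subcat (addX X : rep F A -> Prop).
Proof.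
have [Xs [Xi [Xc Xcc]]] := bX.
have key (N1 N N2 : rep F A) : indecomposable N1 -> indecomposable N -> indecomposable N2 ->
    ses N1 N N2 -> (addX X N1 -> addX X N2 -> addX X N) /\ (~ addX X N1 -> ~ addX X N2 -> ~ addX X N).
  move=> i1 i i2 s; have [[x t] sw iN] := classif i.
  have [p [l [q [/= wE h]]]] := ses_thin (thinA sw) i1 i2 (ses_iso_mid s iN).
  subst t; have [sp sq ep] := string_split sw.
  have [[m1 _] [[m _] [m2 _]]] := (i1, (i, i2)).
  rewrite (addX_iso sw iN m); case: h => -[j1 j2].
    rewrite (addX_iso sp j1 m1) (addX_iso sq j2 m2); split=> a b.
      exact: (Xc (x, p) (ltgt l, q) l).
    by have [|||_] := Xcc (x, p) (ltgt l, q) l (conj sp a) (conj sq b).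
  rewrite (addX_iso sq j1 m1) (addX_iso sp j2 m2); split=> b a.
    exact: (Xc (x, p) (ltgt l, q) l).
  by have [|||_] := Xcc (x, p) (ltgt l, q) l (conj sp a) (conj sq b).
split; first exact: addX_subcat.
split=> N1 N N2 i1 i i2 s; first by have [] := key _ _ _ i1 i i2 s.
rewrite !compl_indec //; try exact: addX_subcat.
by have [] := key _ _ _ i1 i i2 s.
Qed.
End OfSet.

Section OfSubcat.
Variable C : rep F A -> Prop.
Hypothesis bC : biclosed_subcat C.

Definition strings_in (w : word A) := is_string w /\ C (M w).

(** A concatenation is the middle term of an exact sequence whose ends are the two pieces, in the
    order dictated by the joining letter. *)
Lemma strings_in_biclosed : biclosed_set strings_in.
Proof.
have [sC [eC eCc]] := bC; have [_ [_ [iC _]]] := sC.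
split; first by move=> w [].
split.
  move=> w [sw Cw]; have sw' := (is_stringP _ r2).1 sw.
  have siw : is_string (winv w) by apply/(is_stringP _ r2)/stringb_winv.
  split=> //; apply: iC Cw _ (winv_iso F _); first exact: Mstr_module.
  by have /andP [] := sw'.
have cut u v l : is_string u -> is_string v -> ltgt l = v.1 -> is_string (u.1, u.2 ++ l :: v.2) ->
    (C (M u) -> C (M v) -> C (M (u.1, u.2 ++ l :: v.2))) /\
    (~ C (M u) -> ~ C (M v) -> ~ C (M (u.1, u.2 ++ l :: v.2))).
  move=> su sv e sw; have := @ses_concat F _ (u.1, u.2 ++ l :: v.2) u.2 l v.2 erefl.
  rewrite e -!surjective_pairing.
  have [iu iv iw] := And3 (string_indec su) (string_indec sv) (string_indec sw).
  case: (l.2) => s; split=> a b; try by [apply: eC s _ _ | apply: eC s _ _].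
  - by apply/(compl_indec sC iw); apply: eCc s _ _ => //; apply/compl_indec.
  - by apply/(compl_indec sC iw); apply: eCc s _ _ => //; apply/compl_indec.
split.
  move=> u v l [su Cu] [sv Cv] _ e sw; split=> //.
  by have [h _] := cut u v l su sv e sw; apply: h.
move=> u v l [su nu] [sv nv] _ e sw; split=> // -[_].
have [_ h] := cut u v l su sv e sw; apply: h => Cx; [apply: nu | apply: nv]; split=> //.
Qed.

Lemma subcat_addX N : C N <-> addX strings_in N.
Proof.
have [sC _] := bC; have [Cm [C0 [Ci [Cd _]]]] := sC.
have bX := strings_in_biclosed.
split=> [CN|/(addP _ (addX_module bX)) [mN [L sL rL]]].
  have [_ [a0 [ai [ad _]]]] := addX_subcat bX.
  apply: (decomp_ind (P := addX strings_in)) => //; last first.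
  - move=> X iX rX; have [w sw iw] := classif iX; have [mX _] := iX.
    apply/(addX_iso bX sw iw mX); split=> //.
    by apply: Ci _ (Mstr_module F r2 sw) iw; apply: subcat_retract sC mX CN rX.
  - exact: Cm.
  by move=> X Y mY aX i; apply: ai aX mY i.
apply: subcat_retract sC mN _ rL.
elim: sL => [Z mZ Z0|Z Y [w [[_ Cw] ->]] _ CY]; first exact: C0.
exact: Cd.
Qed.
End OfSubcat.
End Bic.

(** The poset isomorphism is given as a map that preserves and reflects inclusion, hence is
    injective up to pointwise equivalence, and that reaches every torsion shadow up to pointwise
    equivalence. *)
Theorem theorem6p3 (F : fieldType) (A : bquiver) :
  brick_gentle F A ->
  (exists Phi : (word A -> Prop) -> (rep F (Pi A) -> Prop),
     (forall X, biclosed_set X -> torshad (Phi X)) /\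
     (forall S, torshad S -> exists X, biclosed_set X /\ forall M, S M <-> Phi X M) /\
     (forall X Y, biclosed_set X -> biclosed_set Y ->
        ((forall w, X w -> Y w) <-> (forall M, Phi X M -> Phi Y M)))) /\
  (forall C : rep F A -> Prop,
     biclosed_subcat C <-> exists S, torshad S /\ forall M, C M <-> frakT S M).
Proof.
move=> [gA brA]; have r2 := gentle_quadratic gA; have no3 := gentle_no_triple gA.
have thinb (w : word A) : stringb w -> thin w by apply: string_thin r2 brA w.
have thinA (w : word A) : is_string w -> thin w by move=> /(is_stringP _ r2); apply: thinb.
have classif (N : rep F A) : indecomposable N -> exists2 w, is_string w & iso N (Mstr F w).
  move=> iN; have [mN _] := iN.
  have [w sw iw] := indecomposable_string no3 thinb mN iN.
  by exists w => //; apply/(is_stringP _ r2).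
split.
  exists (@Phi F A); split; first by move=> X bX; apply: Phi_torshad.
  split; last by move=> X Y; apply: Phi_le.
  by move=> S /(torshad_Phi r2 thinA) [X bX SX]; exists X.
move=> C; split=> [bC|[S [tS CS]]].
  have bX := strings_in_biclosed r2 thinA bC.
  exists (Phi (strings_in C)); split; first exact: Phi_torshad.
  by move=> N; rewrite (frakT_Phi r2 thinA bX) //; apply: subcat_addX.
have [X bX SX] := torshad_Phi r2 thinA tS.
(* Extensionality turns the pointwise equivalence into an equality, so that [addX_biclosed] speaks
   about [C]. *)
have -> : C = addX X.
  apply: functional_extensionality => N; apply: propositional_extensionality.
  by rewrite CS; apply: frakT_Phi.
exact: addX_biclosed.
Qed.
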